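(* Let $r>0$, $d,m\in\mathbb{N}$, and let $f:\mathbb{R}^d\to\mathbb{R}^d$, $g:C([-r,0],\mathbb{R}^d)\to\mathbb{R}^d$ and $h:C([-r,0],\mathbb{R}^d)\to\mathbb{R}^{d\times m}$ satisfy: (1) $f$ is continuous and $\lim_{|v|\to+\infty}\frac{\langle f(v),v\rangle}{|v|^2}=-\infty$; (2) $g$ and $h$ are continuous and bounded on bounded subsets of $C([-r,0],\mathbb{R}^d)$; (3) there is a constant $L>0$ such that for all $x,y\in C([-r,0],\mathbb{R}^d)$, $$2\langle f(x(0))-f(y(0)),x(0)-y(0)\rangle^{+}+2\langle g(x)-g(y),x(0)-y(0)\rangle^{+}+|\!|\!|h(x)-h(y)|\!|\!|^2\le L\|x-y\|^2 .$$ Let $(\varphi_n)_{n\in\mathbb{N}}$ be a sequence in $C([-r,0],\mathbb{R}^d)$ with $\|\varphi_n-\varphi\|\to0$ as $n\to\infty$ for some $\varphi\in C([-r,0],\mathbb{R}^d)$. Let $x^n$ (resp. $x$) be the solution of $$dx(t)=\big(f(x(t))+g(x_t)\big)\,dt+h(x_t)\,dB(t),\quad t\ge0,$$ with initial condition $\varphi_n$ (resp. $\varphi$) on $[-r,0]$. Then for any $t>0$, $$\mathbb{E}\sup_{t-r\le s\le t}|x^n(s)-x(s)|^4\to0\quad\text{as } n\to\infty .$$ In particular, the segment process $(x_t)_{t\ge0}$ is a Feller process, i.e. for every $t\ge0$ and every bounded continuous $\psi:C([-r,0],\mathbb{R}^d)\to\mathbb{R}$ the function $\varphi\mapsto\mathbb{E}\,\psi(x_t^{\varphi})$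 is bounded and continuous on $C([-r,0],\mathbb{R}^d)$.
   Context: $C([-r,0],\mathbb{R}^d)$ is the space of continuous functions $[-r,0]\to\mathbb{R}^d$ with the maximum norm $\|\cdot\|$. $|\cdot|$ and $\langle\cdot,\cdot\rangle$ are the Euclidean norm and inner product on $\mathbb{R}^d$; $a^+=\max(a,0)$; for a matrix $M$, $|\!|\!|M|\!|\!|=(\mathrm{Tr}(MM^* ))^{1/2}$. $(B(t))_{t\ge0}$ is a standard $\mathbb{R}^m$-valued Brownian motion on a filtered probability space $(\Omega,\mathcal{F},(\mathcal{F}_t)_t,\mathbb{P})$; all solutions are driven by this same Brownian motion. For a process $x$ on $[-r,\infty)$ with continuous paths, the segment at time $t\ge0$ is $x_t\in C([-r,0],\mathbb{R}^d)$, $x_t(\theta)=x(t+\theta)$ for $\theta\in[-r,0]$. A solution of the equation with initial condition $\varphi$ is an $\mathbb{R}^d$-valued process $x$ on $[-r,\infty)$ with continuous paths, with $x_0$ $\mathcal{F}_0$-measurable and $x(t)$ $\mathcal{F}_t$-measurable for $t\ge0$, such that $x(s)=\varphi(s)$ for $s\in[-r,0]$ and $x(t)=x(0)+\int_0^t f(x(s))\,ds+\int_0^t g(x_s)\,ds+\int_0^t h(x_s)\,dB(s)$ for $t>0$. Under hypotheses (1)–(3) the equation has a unique global solution (a known result), and the segment process is a Markov process. $x_t^{\varphi}$ denotes the segment at time $t$ of the solution with deterministic initial condition $\varphi$. *)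

(* Defs.v *)
From HB Require Import structures.
From mathcomp Require Import all_boot all_order all_algebra.
From mathcomp Require Import all_classical all_reals all_analysis.
From mathcomp Require Import ring lra.

Set Implicit Arguments.
Unset Strict Implicit.
Unset Printing Implicit Defensive.

Import Order.TTheory GRing.Theory Num.Theory.
Import numFieldTopology.Exports numFieldNormedType.Exports.

Local Open Scope classical_set_scope.
Local Open Scope ring_scope.

(* The library's norm on matrices is the maximum norm, so the Euclidean
   structure of R^d (column vectors) and the Hilbert-Schmidt norm are
   introduced here; the topology on matrices is the library's. *)

Definition dot (R : realType) (d : nat) (u v : 'cV[R]_d) : R :=
  \sum_(i < d) u i 0 * v i 0.

Definition enorm (R : realType) (d : nat) (u : 'cV[R]_d) : R :=
  Num.sqrt (dot u u).

Definition hsnorm (R : realType) (d m : nat) (M : 'M[R]_(d, m)) : R :=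
  Num.sqrt (\tr (M *m M^T)).

Section euclidean_norm.
Context {R : realType} {d : nat}.
Implicit Types (u v : 'cV[R]_d) (a : R).

Lemma dot_ge0 u : 0 <= dot u u.
Proof. by apply: sumr_ge0 => i _; rewrite -expr2 sqr_ge0. Qed.

Lemma enorm_ge0 u : 0 <= enorm u.
Proof. exact: sqrtr_ge0. Qed.

Lemma sqr_enorm u : enorm u ^+ 2 = dot u u.
Proof. by rewrite sqr_sqrtr// dot_ge0. Qed.

Lemma dotC u v : dot u v = dot v u.
Proof. by apply: eq_bigr => i _; rewrite mulrC. Qed.

Lemma dotDl u v w : dot (u + v) w = dot u w + dot v w.
Proof. by rewrite /dot -big_split/=; apply: eq_bigr => i _; rewrite mxE mulrDl. Qed.

Lemma dotZl a u v : dot (a *: u) v = a * dot u v.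
Proof. by rewrite /dot mulr_sumr; apply: eq_bigr => i _; rewrite mxE mulrA. Qed.

Lemma enorm_eq0 u : enorm u = 0 -> u = 0.
Proof.
move=> u0; have : dot u u = 0 by rewrite -sqr_enorm u0 expr0n.
move/eqP; rewrite psumr_eq0; last by move=> i _; rewrite -expr2 sqr_ge0.
move=> /allP h; apply/matrixP => i j; rewrite ord1 mxE.
by apply/eqP; have := h i (mem_index_enum i); rewrite /= mulf_eq0 orbb.
Qed.

Lemma enormZ a u : enorm (a *: u) = `|a| * enorm u.
Proof.
by rewrite /enorm dotZl dotC dotZl mulrA -expr2 sqrtrM ?sqr_ge0// sqrtr_sqr.
Qed.

Lemma dot_le u v : dot u v <= enorm u * enorm v.
Proof.
have [v0|v0] := eqVneq (enorm v) 0.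
  rewrite v0 mulr0 (enorm_eq0 v0) /dot big1// => i _.
  by rewrite mxE mulr0.
have [u0|u0] := eqVneq (enorm u) 0.
  rewrite u0 mul0r (enorm_eq0 u0) /dot big1// => i _.
  by rewrite mxE mul0r.
have up : 0 < enorm u by rewrite lt_neqAle eq_sym u0 enorm_ge0.
have vp : 0 < enorm v by rewrite lt_neqAle eq_sym v0 enorm_ge0.
have := dot_ge0 (enorm v *: u + (- enorm u) *: v).
rewrite dotDl !dotZl ![dot _ (_ + _)]dotC !dotDl !dotZl.
rewrite (dotC v u) -!sqr_enorm.
set A := enorm u; set B := enorm v; set D := dot u v.
have -> : B * (B * A ^+ 2 + - A * D) + - A * (B * D + - A * B ^+ 2) =
  2 * (A * B) * (A * B - D) by rewrite -/A -/B; ring.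
by rewrite pmulr_rge0 ?subr_ge0// !mulr_gt0.
Qed.

Lemma ler_enormD u v : enorm (u + v) <= enorm u + enorm v.
Proof.
rewrite -(@ler_pXn2r _ 2)// ?nnegrE ?addr_ge0 ?enorm_ge0//.
rewrite sqr_enorm dotDl ![dot _ (_ + _)]dotC !dotDl (dotC v u).
by rewrite sqrrD !sqr_enorm; have := dot_le u v; lra.
Qed.

Lemma enorm_continuous : continuous (@enorm R d).
Proof.
move=> u; apply: (@continuous_comp _ _ _ (fun u => dot u u)); last first.
  exact: sqrt_continuous.
have h (r : seq 'I_d) :
    {for u, continuous (fun u : 'cV[R]_d => \sum_(i <- r) u i 0 * u i 0)}.
  elim: r => [|i r ih].
    by rewrite (_ : (fun _ => _) = cst 0) ?cst_continuous//;
      [exact: cst_continuous | apply/funext => w; rewrite big_nil].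
  rewrite (_ : (fun _ => _) = (fun w : 'cV[R]_d =>
    w i 0 * w i 0 + \sum_(j <- r) w j 0 * w j 0)); last first.
    by apply/funext => w; rewrite big_cons.
  apply: (@continuousD R R^o _ (fun w : 'cV[R]_d => w i 0 * w i 0)) => //.
  by apply: continuousM; exact: coord_continuous.
exact: h.
Qed.

End euclidean_norm.

(* Cseg r d is C([-r, 0], R^d). Its normedModType structure is the one of the
   maximum norm Cseg_norm, taken with respect to the Euclidean norm of R^d, so
   that continuity and Borel sets on Cseg r d refer to this norm. *)

Definition delay_itv (R : realType) (r : {posnum R}) : set R :=
  `[- r%:num, 0%R].

Section segment_space.
Context {R : realType} (r : {posnum R}) (d : nat).

Definition continuous_pred : {pred (delay_itv r -> 'cV[R]_d)} :=
  mem [set u : delay_itv r -> 'cV[R]_d | continuous u].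

Record Cseg := MkCseg {
  Cseg_fun :> delay_itv r -> 'cV[R]_d ;
  _ : Cseg_fun \in continuous_pred }.

HB.instance Definition _ := [isSub for Cseg_fun].
HB.instance Definition _ := [Choice of Cseg by <:].

Lemma continuous_pred_submod : submod_closed continuous_pred.
Proof.
split; first by rewrite inE/=; exact: cst_continuous.
move=> a u v; rewrite !inE/= => cu cv s.
apply: (@continuousD R 'cV[R]_d _ (a *: u)); last exact: cv.
by apply: (@continuousZl_tmp R 'cV[R]_d); exact: cu.
Qed.

HB.instance Definition _ :=
  GRing.isSubmodClosed.Build R (delay_itv r -> 'cV[R]_d) continuous_pred
    continuous_pred_submod.
HB.instance Definition _ := [SubChoice_isSubLmodule of Cseg by <:].

Definition Cseg_norm (u : Cseg) : R := sup (range (fun s => enorm (u s))).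

Lemma delay_itv0 : 0 \in delay_itv r.
Proof. by rewrite inE /delay_itv/= in_itv/= oppr_le0 lexx andbT. Qed.

(* The time 0 as a point of [-r, 0]. *)
Definition now : delay_itv r :=
  exist (fun s => s \in delay_itv r) 0 delay_itv0.

Lemma delay_itv_compact : compact [set: delay_itv r].
Proof.
have clampP (t : R) : Num.max (- r%:num) (Num.min t 0) \in delay_itv r.
  by rewrite inE /delay_itv/= in_itv/= le_max lexx ge_max ge_min lexx oppr_le0
    orbT andbT/=.
pose p (t : R) : delay_itv r := 
    exist (fun s => s \in delay_itv r) _ (clampP t).
have -> : [set: delay_itv r] = p @` `[- r%:num, 0%R].
  apply/esym/seteqP; split => // -[t ht] _.
  have := ht; rewrite inE /delay_itv/= => tI; exists t => //.
  move: tI; rewrite in_itv/= => /andP[rt t0].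
  by apply/val_inj => /=; rewrite (min_idPl t0) (max_idPr rt).
apply: continuous_compact; last exact: segment_compact.
apply: continuous_subspaceT; apply: continuous_comp_initial => t.
have c0 : {for t, continuous ((id : R -> R^o) \min cst 0)}.
  by apply: continuous_min; [exact: cvg_id|exact: cst_continuous].
exact: (continuous_max (@cst_continuous _ _ (- r%:num : R^o) t) c0).
Qed.

Lemma Cseg_continuous (u : Cseg) : continuous u.
Proof. by case: u => u /=; rewrite inE. Qed.

Lemma Cseg_has_sup (u : Cseg) : has_sup (range (fun s => enorm (u s))).
Proof.
apply: compact_has_sup; first by exists (enorm (u now)), now.
apply: continuous_compact; last exact: delay_itv_compact.
apply: continuous_subspaceT => s.
by apply: continuous_comp; [exact: Cseg_continuous|exact: enorm_continuous].
Qed.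

Lemma enorm_le_Cseg_norm (u : Cseg) s : enorm (u s) <= Cseg_norm u.
Proof. by apply: ub_le_sup; [case: (Cseg_has_sup u)|exists s]. Qed.

Lemma Cseg_norm_le (u : Cseg) (c : R) :
  (forall s, enorm (u s) <= c) -> Cseg_norm u <= c.
Proof.
move=> h; apply: sup_le_ub; first by case: (Cseg_has_sup u).
by move=> _ [s _ <-].
Qed.

Lemma Cseg_normD u v : Cseg_norm (u + v) <= Cseg_norm u + Cseg_norm v.
Proof.
apply: Cseg_norm_le => s; apply: (le_trans (ler_enormD (u s) (v s))).
by rewrite lerD// enorm_le_Cseg_norm.
Qed.

Lemma Cseg_normZ (a : R) u : Cseg_norm (a *: u) = `|a| * Cseg_norm u.
Proof.
have le_normZ b w : Cseg_norm (b *: w) <= `|b| * Cseg_norm w.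
  apply: Cseg_norm_le => s; rewrite [_ s]/(b *: w s) enormZ.
  by rewrite ler_wpM2l// enorm_le_Cseg_norm.
apply/le_anti/andP; split; first exact: le_normZ.
have [->|a0] := eqVneq a 0.
  rewrite normr0 mul0r; apply: le_trans (enorm_le_Cseg_norm _ now).
  exact: enorm_ge0.
have := le_normZ a^-1 (a *: u); rewrite scalerA mulVf// scale1r normfV.
by rewrite -ler_pdivlMl ?invr_gt0 ?normr_gt0// invrK.
Qed.

Lemma Cseg_norm_eq0 u : Cseg_norm u = 0 -> u = 0.
Proof.
move=> u0; apply/val_inj/funext => s /=; apply/enorm_eq0/le_anti.
by rewrite enorm_ge0 -u0 enorm_le_Cseg_norm.
Qed.

HB.instance Definition _ :=
  @Lmodule_isNormed.Build R Cseg Cseg_norm Cseg_normD Cseg_normZ Cseg_norm_eq0.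

End segment_space.

(* The segment x_t of a path x, as an element of C([-r, 0], R^d). The default
   value 0 is only taken when x is not continuous on [t - r, t]. *)
Definition segment (R : realType) (r : {posnum R}) (d : nat)
    (x : R -> 'cV[R]_d) (t : R) : Cseg r d :=
  insubd (0 : Cseg r d) (fun s : delay_itv r => x (t + \val s)).

Section stochastic_calculus.
Context {R : realType} {dT : measure_display} {T : measurableType dT}.
Variable P : probability T R.

(* E carries its Borel sigma-algebra, generated by the open sets. *)
Definition measurable_wrt (G : set_system T) (E : topologicalType)
    (X : T -> E) : Prop :=
  forall U : set E, <<s open >> U -> G (X @^-1` U).

(* Only the times t >= 0 matter. *)
Record is_filtration (F : R -> set_system T) : Prop := {
  filtration_sigma_algebra : forall t : R, 0 <= t -> sigma_algebra setT (F t) ;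
  filtration_measurable : forall t : R, 0 <= t -> F t `<=` measurable ;
  filtration_le : forall s t : R, 0 <= s -> s <= t -> F s `<=` F t }.

(* An increment over (s, t] is independent of F_s and has independent
   components of law N(0, t - s); normal_prob takes the standard deviation. *)
Record is_brownian (F : R -> set_system T) (m : nat)
    (B : R -> T -> 'cV[R]_m) : Prop := {
  brownian_adapted : forall t : R, 0 <= t -> measurable_wrt (F t) (B t) ;
  brownian_start : {ae P, forall w, B 0 w = 0} ;
  brownian_continuous :
    {ae P, forall w, {within `[0, +oo[, continuous (B ^~ w)}} ;
  brownian_indep : forall s t : R, 0 <= s -> s < t ->
    forall (A : set T) (U : set 'cV[R]_m), F s A -> <<s open >> U ->
      P (A `&` [set w | U (B t w - B s w)]) =
      (P A * P [set w | U (B t w - B s w)%R])%E ;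
  brownian_normal : forall s t : R, 0 <= s -> s < t ->
    forall U : 'I_m -> set R, (forall i, measurable (U i)) ->
      P [set w | forall i, U i (B t w i 0 - B s w i 0)] =
      (\prod_(i < m) normal_prob 0 (Num.sqrt (t - s)) (U i))%E }.

(* Only used for nonnegative Y k, whence the absence of absolute values. *)
Definition cvg0_in_probability (Y : nat -> T -> \bar R) : Prop :=
  forall e : R, 0 < e ->
    P [set w | (e%:E <= Y k w)%E] @[k --> \oo] --> 0%E.

Variables (d m : nat).

(* The data of a process sum_(j < n) xi_j 1_(t_j, t_(j+1)]. *)
Record simple_process := SimpleProcess {
  sp_size : nat ;
  sp_time : nat -> R ;
  sp_coef : nat -> T -> 'M[R]_(d, m) }.

Record is_simple_on (F : R -> set_system T) (a : R) (S : simple_process) :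
    Prop := {
  simple_start : sp_time S 0 = 0 ;
  simple_stop : sp_time S (sp_size S) = a ;
  simple_lt : forall j, (j < sp_size S)%N -> sp_time S j < sp_time S j.+1 ;
  simple_measurable : forall j, (j < sp_size S)%N ->
    measurable_wrt (F (sp_time S j)) (sp_coef S j) ;
  simple_bounded : forall j, (j < sp_size S)%N ->
    exists M : R, forall w, hsnorm (sp_coef S j w) <= M }.

Definition sp_value (S : simple_process) (s : R) (w : T) : 'M[R]_(d, m) :=
  \sum_(j < sp_size S | sp_time S j < s <= sp_time S j.+1) sp_coef S j w.

Definition sp_integral (B : R -> T -> 'cV[R]_m) (S : simple_process) (w : T) :
    'cV[R]_d :=
  \sum_(j < sp_size S)
    sp_coef S j w *m (B (sp_time S j.+1) w - B (sp_time S j) w).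

(* I is (a version of) the Ito integral of H over [0, a]: simple adapted
   processes S_k satisfy int_0^a |||S_k - H|||^2 ds -> 0 in probability and
   their integrals converge to I in probability. *)
Definition is_ito_integral (F : R -> set_system T) (B : R -> T -> 'cV[R]_m)
    (H : R -> T -> 'M[R]_(d, m)) (a : R) (I : T -> 'cV[R]_d) : Prop :=
  measurable_wrt measurable I /\
  exists S : nat -> simple_process,
    [/\ forall k, is_simple_on F a (S k),
        cvg0_in_probability (fun k w =>
          (\int[lebesgue_measure]_(s in `[0%R, a])
             (hsnorm (sp_value (S k) s w - H s w)%R ^+ 2)%:E)%E) &
        cvg0_in_probability (fun k w =>
          (enorm (sp_integral B (S k) w - I w))%:E)].

Definition time_integral (u : R -> 'cV[R]_d) (t : R) : 'cV[R]_d :=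
  \col_i \int[lebesgue_measure]_(s in `[0, t]) (u s i 0).

(* The solution x is given on all of R; its values before -r are irrelevant. *)
Record is_solution (F : R -> set_system T) (B : R -> T -> 'cV[R]_m)
    (r : {posnum R}) (f : 'cV[R]_d -> 'cV[R]_d) (g : Cseg r d -> 'cV[R]_d)
    (h : Cseg r d -> 'M[R]_(d, m)) (phi : Cseg r d) (x : R -> T -> 'cV[R]_d) :
    Prop := {
  solution_continuous :
    forall w, {within `[- r%:num, +oo[, continuous (x ^~ w)} ;
  solution_measurable0 :
    measurable_wrt (F 0) (fun w => segment r (x ^~ w) 0) ;
  solution_adapted : forall t : R, 0 <= t -> measurable_wrt (F t) (x t) ;
  solution_init : {ae P, forall w, segment r (x ^~ w) 0 = phi} ;
  solution_eq : forall t : R, 0 < t -> exists2 I : T -> 'cV[R]_d,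
    is_ito_integral F B (fun s w => h (segment r (x ^~ w) s)) t I &
    {ae P, forall w, x t w = x 0 w
      + time_integral (fun s => f (x s w)) t
      + time_integral (fun s => g (segment r (x ^~ w) s)) t
      + I w} }.

End stochastic_calculus.

(* Main.v *)
From HB Require Import structures.
Require Import Defs.
From mathcomp Require Import all_boot all_order all_algebra.
From mathcomp Require Import all_classical all_reals all_analysis.
From mathcomp Require Import measurable_realfun.
From mathcomp Require Import ring lra.

Set Implicit Arguments.
Unset Strict Implicit.
Unset Printing Implicit Defensive.

Import Order.TTheory GRing.Theory Num.Theory.
Import numFieldTopology.Exports numFieldNormedType.Exports.

Local Open Scope classical_set_scope.
Local Open Scope ring_scope.

Section independence.
Context {R : realType} {dT : measure_display} {T : measurableType dT}.
Variable P : probability T R.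

Lemma expectation_indep (X Y : T -> R) :
  P.-integrable setT (EFin \o X) -> P.-integrable setT (EFin \o Y) ->
  (forall U V, measurable U -> measurable V ->
    P (X @^-1` U `&` Y @^-1` V) = (P (X @^-1` U) * P (Y @^-1` V))%E) ->
  P.-integrable setT (EFin \o (fun w => X w * Y w)) /\
  \int[P]_w (X w * Y w) = (\int[P]_w X w) * (\int[P]_w Y w).
Proof.
move=> iX iY indep.
have mX : measurable_fun setT X by apply/measurable_EFinP; case/integrableP : iX.
have mY : measurable_fun setT Y by apply/measurable_EFinP; case/integrableP : iY.
have mXY : measurable_fun setT (fun w => (X w, Y w)).
  exact: measurable_fun_pair.
pose X' : {mfun T >-> R} := HB.pack X (isMeasurableFun.Build _ _ _ _ _ mX).
pose Y' : {mfun T >-> R} := HB.pack Y (isMeasurableFun.Build _ _ _ _ _ mY).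
pose XY' : {mfun T >-> (R * R)%type} :=
  HB.pack (fun w => (X w, Y w)) (isMeasurableFun.Build _ _ _ _ _ mXY).
have lawE A : measurable A ->
    (distribution P X' \x distribution P Y')%E A = distribution P XY' A.
  by apply: product_measure_unique => U V mU mV; rewrite /distribution/= /pushforward/= -indep.
pose g : R * R -> \bar R := fun p => (p.1 * p.2)%:E.
have mg : measurable_fun setT g.
  by apply/measurable_EFinP; apply: measurable_funM.
have ig : P.-integrable setT (EFin \o (fun w => X w * Y w)).
  apply/integrableP; split.
    by apply/measurable_EFinP; exact: measurable_funM.
  have -> : (\int[P]_w `|(X w * Y w)%R%:E|)%E =
      (\int[distribution P XY']_p (abse \o g) p)%E.
    rewrite ge0_integral_distribution//; last by move=> y; exact: abse_ge0.
    by apply: measurableT_comp => //; exact: abse_measurable.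
  rewrite (eq_measure_integral (distribution P X' \x distribution P Y')%E); last first.
    by move=> A mA _; exact: (esym (lawE _ mA)).
  rewrite (fubini_tonelli1 (abse \o g))//=; last exact: measurableT_comp.
  rewrite /fubini_F/=.
  under eq_integral do under eq_integral do rewrite normrM EFinM.
  have e : forall x : R, (\int[distribution P Y']_y (`|x|%:E * `|y|%:E))%E =
      (`|x|%:E * \int[P]_w `|Y w|%:E)%E.
    move=> x; transitivity (`|x|%:E * \int[distribution P Y']_y `|y|%:E)%E.
      by apply: (@ge0_integralZl _ _ _ _ setT measurableT (fun y : R => `|y|%:E)) => //;
        exact/measurable_EFinP.
    by rewrite (@ge0_integral_distribution _ _ _ _ _ P Y' (fun y : R => `|y|%:E))//;
        exact/measurable_EFinP.
  under eq_integral do rewrite e.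
  set I := (\int[P]_w `|Y w|%:E)%E.
  have -> : (\int[distribution P X']_(x in [set: R]) (`|x : R|%:E * I) = \int[distribution P X']_(x in [set: R]) `|x : R|%:E * I)%E.
    apply: (@ge0_integralZr _ _ _ _ setT measurableT (fun y : R => `|y|%:E)) => //.
      exact/measurable_EFinP.
    by apply: integral_ge0.
  rewrite (@ge0_integral_distribution _ _ _ _ _ P X' (fun y : R => `|y|%:E))//; last exact/measurable_EFinP.
  case/integrableP : iX => _ iX; case/integrableP : iY => _ iY.
  apply: lte_mul_pinfty; [|rewrite ge0_fin_numE; [exact: iX|]|exact: iY].
    by apply: integral_ge0 => w _; rewrite lee_fin.
  by apply: integral_ge0 => w _; rewrite lee_fin.
split=> //; rewrite /Rintegral.
have -> : (\int[P]_w (X w * Y w)%R%:E)%E = (\int[distribution P XY']_p g p)%E.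
  by rewrite integral_distribution.
have igd : (distribution P X' \x distribution P Y')%E.-integrable setT g.
  have := @integrable_pushforward _ _ _ _ _ _ mXY P setT _ mg.
  rewrite preimage_setT => /(_ ig measurableT) /integrableP[_ h].
  apply/integrableP; split => //.
  rewrite (eq_measure_integral (distribution P XY'))//.
  by move=> A mA _; exact: (lawE _ mA).
rewrite (eq_measure_integral (distribution P X' \x distribution P Y')%E); last first.
  by move=> A mA _; exact: (esym (lawE _ mA)).
rewrite -integral12_prod_meas1//.
rewrite /fubini_F /g/=.
have e (x : R) : (\int[distribution P Y']_y ((x * y)%:E))%E = (x%:E * \int[P]_w (Y w)%:E)%E.
  under eq_integral do rewrite EFinM.
  rewrite integralZl//; last first.
    by apply: (integrable_pushforward mY) => //; rewrite ?preimage_setT.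
  by rewrite integral_distribution.
under eq_integral do rewrite e.
have iYf : (\int[P]_w (Y w)%:E)%E \is a fin_num by exact: integrable_fin_num.
rewrite -(fineK iYf) integralZr//; last first.
  by apply: (integrable_pushforward mX) => //; rewrite ?preimage_setT.
rewrite integral_distribution//=.
have iXf : (\int[P]_w (X w)%:E)%E \is a fin_num by exact: integrable_fin_num.
by rewrite fineM// fineK.
Qed.

End independence.

Section density.
Context d (T : measurableType d) {R : realType}.
Variables (mu nu : {measure set T -> \bar R}) (p : T -> R).
Hypotheses (mp : measurable_fun setT p) (p0 : forall x, 0 <= p x).
Hypothesis nuE : forall A, measurable A -> nu A = (\int[mu]_(x in A) (p x)%:E)%E.

Import HBNNSimple.

Lemma ge0_integral_density (g : T -> \bar R) : measurable_fun setT g ->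
  (forall x, 0 <= g x)%E ->
  (\int[nu]_x g x = \int[mu]_x (g x * (p x)%:E))%E.
Proof.
move=> mg g0; pose g_ := nnsfun_approx measurableT mg.
have cg x : EFin \o g_ ^~ x @ \oo --> g x by exact: cvg_nnsfun_approx.
have gE x : g x = limn (EFin \o g_ ^~ x) by apply/esym/cvg_lim.
have mpE : measurable_fun setT (EFin \o p) by exact/measurable_EFinP.
have p0E x : (0 <= (p x)%:E)%E by rewrite lee_fin.
have mi n y : measurable_fun setT (fun x => (y * \1_(g_ n @^-1` [set y]) x)%:E).
  by apply/measurable_EFinP/measurable_funM => //; exact: measurable_indic.
have step n : (\int[nu]_x (g_ n x)%:E = \int[mu]_x ((g_ n x)%:E * (p x)%:E))%E.
  under eq_integral do rewrite fimfunE -fsumEFin//.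
  rewrite ge0_integral_fsum//; last 2 first.
  - by move=> y; exact: mi.
  - by move=> y x _; rewrite nnfun_muleindic_ge0.
  have gp x : ((g_ n x)%:E * (p x)%:E =
     \sum_(k \in range (g_ n)) (k * \1_(g_ n @^-1` [set k]) x)%:E * (p x)%:E)%E.
    rewrite [in LHS]fimfunE -fsumEFin// ge0_mule_fsuml// => k.
    exact: nnfun_muleindic_ge0.
  under [RHS]eq_integral do rewrite gp.
  rewrite ge0_integral_fsum//; last 2 first.
  - by move=> y; apply: emeasurable_funM => //; exact: mi.
  - by move=> y x _; rewrite mule_ge0// nnfun_muleindic_ge0.
  apply: eq_fsbigr => r _.
  have [r0|r0] := ltP r 0%R.
    by rewrite preimage_nnfun0// !integral0_eq// => x _; rewrite indic0 mulr0 ?mul0e.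
  have mri : measurable_fun setT (fun x => (\1_(g_ n @^-1` [set r]) x : R)%:E).
    by apply/measurable_EFinP/measurable_indic.
  transitivity (r%:E * nu (g_ n @^-1` [set r]))%E.
    under eq_integral do rewrite EFinM.
    by rewrite ge0_integralZl// integral_indic// setIT.
  under eq_integral do rewrite EFinM -muleA.
  rewrite ge0_integralZl//; last 2 first.
    by apply: emeasurable_funM.
    by move=> x _; rewrite mule_ge0// lee_fin.
  congr (_ * _)%E; rewrite nuE// integral_mkcond.
  apply: eq_integral => x _; rewrite patchE indicE.
  by case: (x \in _); rewrite ?mul1e ?mul0e.
transitivity (limn (fun n => \int[nu]_x (g_ n x)%:E))%E.
  rewrite -monotone_convergence//.
  - by apply: eq_integral => y _; rewrite gE.
  - by move=> n; exact/measurable_EFinP/measurable_funP.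
  - by move=> n y _; rewrite lee_fin.
  - by move=> y _ i j ij; rewrite lee_fin; exact/lefP/nd_nnsfun_approx.
under eq_fun do rewrite step.
rewrite -monotone_convergence//.
- apply: eq_integral => y _; rewrite gE muleC -limeMl//.
    by apply: (congr1 (fun u : nat -> \bar R => limn u)); apply/funext => n; rewrite muleC.
  exact: cvgP (cg y).
- by move=> n; apply: emeasurable_funM => //; exact/measurable_EFinP/measurable_funP.
- by move=> n y _; rewrite mule_ge0// lee_fin.
- move=> y _ i j ij; apply: lee_wpmul2r => //; rewrite lee_fin.
  exact/lefP/nd_nnsfun_approx.
Qed.

End density.

Section normal_moments.
Context {R : realType}.
Implicit Types s : R.
Local Notation mu := (@lebesgue_measure R).

Lemma expr4_normal_pdf s x : 0 < s ->
  x ^+ 4 * normal_pdf 0 s x <= 64 * s ^+ 4 * normal_pdf 0 (2 * s) x.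
Proof.
move=> s0; have s20 : 2 * s != 0 by rewrite mulf_neq0// gt_eqF.
rewrite !normal_pdfE ?(gt_eqF s0)//.
have -> : normal_peak s = 2 * normal_peak (2 * s).
  rewrite /normal_peak (_ : (2 * s) ^+ 2 * pi *+ 2 = 2 ^+ 2 * (s ^+ 2 * pi *+ 2)).
    by rewrite sqrtrM ?sqr_ge0// sqrtr_sqr ger0_norm// invfM mulrA divff// mul1r.
  by rewrite exprMn !mulrnAr mulrA.
rewrite /normal_fun subr0.
set y := x ^+ 2 / (4 * s ^+ 2).
have y0 : 0 <= y by rewrite divr_ge0 ?sqr_ge0// mulr_ge0// sqr_ge0.
have sn0 : s != 0 by rewrite gt_eqF.
have xE : x ^+ 2 = 4 * s ^+ 2 * y.
  by rewrite /y mulrCA divff ?mulr1// mulf_neq0// expf_neq0.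
have -> : x ^+ 4 = 16 * s ^+ 4 * y ^+ 2.
  by rewrite -[4%N]/(2 * 2)%N !exprM xE; ring.
have -> : - x ^+ 2 / (s ^+ 2 *+ 2) = - y + - y.
  by rewrite -mulr_natr xE; field.
have -> : - x ^+ 2 / ((2 * s) ^+ 2 *+ 2) = - y + y / 2.
  by rewrite -mulr_natr xE; field.
rewrite !expRD.
have h1 : y ^+ 2 <= 2 * expR y.
  have := @expR_ge1Dxn R y 1 y0; rewrite -[2`!]/2%N => h.
  by rewrite -ler_pdivrMl// mulrC (le_trans _ h)// lerDr.
have e1 : expR (- y) * expR y = 1 by rewrite -expRD addNr expR0.
have h2 : 1 <= expR (y / 2) by rewrite -[leLHS]expR0 ler_expR divr_ge0.
set a := expR (- y) in e1 *; set b := expR y in e1 h1; set c := expR (y / 2) in h2 *.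
have a0 : 0 <= a by exact: expR_ge0.
have pk0 : 0 <= normal_peak (2 * s) by exact: normal_peak_ge0.
have key : y ^+ 2 * (a * a) <= 2 * (a * c).
  apply: (@le_trans _ _ (2 * b * (a * a))); first by rewrite ler_wpM2r// mulr_ge0.
  rewrite (_ : 2 * b * (a * a) = 2 * (a * (a * b))); last by ring.
  by rewrite e1 ler_pM2l// ler_wpM2l.
have := ler_wpM2l (mulr_ge0 (mulr_ge0 (ler0n R 32) (exprn_ge0 4 (ltW s0))) pk0) key.
set Y := y ^+ 2; set p := normal_peak _; set S := s ^+ 4.
by lra.
Qed.

Lemma ge0_integral_opp (g : R -> \bar R) : measurable_fun setT g ->
  (forall x, 0 <= g x)%E ->
  (\int[mu]_x g (- x)%R = \int[mu]_x g x)%E.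
Proof.
move=> mg g0.
have -> : (\int[mu]_x g x = \int[pushforward mu (-%R : _ -> measurableTypeR R)]_x g x)%E.
  by apply: eq_measure_integral => A mA _; exact/esym/lebesgue_measureN.
by rewrite ge0_integral_pushforward// => ? _.
Qed.

End normal_moments.

Section normal_variable.
Context {R : realType} {dT : measure_display} {T : measurableType dT}.
Variables (P : probability T R) (X : T -> R) (s : R).
Hypotheses (s0 : 0 < s) (mX : measurable_fun setT X).
Hypothesis lawX : forall U, measurable U -> P (X @^-1` U) = normal_prob 0 s U.
Local Notation mu := (@lebesgue_measure R).

Lemma ge0_integral_normal_variable (g : R -> \bar R) : measurable_fun setT g ->
  (forall x, 0 <= g x)%E ->
  (\int[P]_w g (X w) = \int[mu]_x (g x * (normal_pdf 0 s x)%:E))%E.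
Proof.
move=> mg g0.
pose X' : {mfun T >-> measurableTypeR R} :=
  HB.pack (X : T -> measurableTypeR R) (isMeasurableFun.Build _ _ T (measurableTypeR R) X mX).
rewrite -(@ge0_integral_density _ _ R mu (distribution P X'))//.
- by rewrite ge0_integral_distribution.
- exact: measurable_normal_pdf.
- by move=> x; exact: normal_pdf_ge0.
Qed.

Lemma normal_variable4 :
  P.-integrable setT (EFin \o (fun w => X w ^+ 4)) /\
  \int[P]_w X w ^+ 4 <= 64 * s ^+ 4.
Proof.
have h : (\int[P]_w (X w ^+ 4)%:E <= (64 * s ^+ 4)%:E)%E.
  rewrite (ge0_integral_normal_variable (g := fun x => (x ^+ 4)%:E)); last 2 first.
    by apply/measurable_EFinP; exact: exprn_measurable.
    by move=> x; rewrite lee_fin exprn_even_ge0.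
  apply: (@le_trans _ _ (\int[mu]_x ((64 * s ^+ 4)%:E * (normal_pdf 0 (2 * s) x)%:E))%E).
    apply: ge0_le_integral => //=.
    - by move=> x _; rewrite mule_ge0// lee_fin ?exprn_even_ge0 ?normal_pdf_ge0.
    - apply: emeasurable_funM; apply/measurable_EFinP.
        exact: exprn_measurable.
      exact: measurable_normal_pdf.
    - apply: emeasurable_funM => //; apply/measurable_EFinP.
      exact: measurable_normal_pdf.
    - by move=> x _; rewrite -!EFinM lee_fin expr4_normal_pdf.
  rewrite ge0_integralZl//=; last 3 first.
  - by apply/measurable_EFinP; exact: measurable_normal_pdf.
  - by move=> x _; rewrite lee_fin normal_pdf_ge0.
  - by rewrite lee_fin mulr_ge0// exprn_ge0// ltW.
  by rewrite integral_normal_pdf mule1.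
have iX : P.-integrable setT (EFin \o (fun w => X w ^+ 4)).
  apply/integrableP; split.
    by apply/measurable_EFinP; exact: measurable_funX.
  under eq_integral do rewrite /= ger0_norm ?exprn_even_ge0//.
  by rewrite (le_lt_trans h)// ltry.
split=> //; rewrite /Rintegral -lee_fin fineK//.
exact: integrable_fin_num.
Qed.

Lemma integrable_normal_variable : P.-integrable setT (EFin \o X).
Proof.
have [i4 _] := normal_variable4.
apply: (@le_integrable _ _ _ P setT measurableT _ (EFin \o (fun w => 1 + X w ^+ 4))).
- exact/measurable_EFinP.
- move=> w _ /=; rewrite lee_fin [leRHS]ger0_norm; last first.
    by rewrite addr_ge0// exprn_even_ge0.
  rewrite -[4%N]/(2 * 2)%N exprM -(real_normK (num_real (X w : R))) /=.
  set a := `|X w|; have := sqr_ge0 (a ^+ 2 - 1 / 2); have := sqr_ge0 (a - 1 / 2); nra.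
- have -> : EFin \o (fun w => 1 + X w ^+ 4) = ((EFin \o cst 1%R) \+ (EFin \o (fun w => X w ^+ 4)%R))%E.
    by apply/funext.
  apply: integrableD => //; exact: finite_measure_integrable_cst.
Qed.

Lemma normal_variable_mean0 : \int[P]_w X w = 0.
Proof.
rewrite /Rintegral integralE.
have -> : (\int[P]_w (EFin \o X)^\- w = \int[P]_w (EFin \o X)^\+ w)%E.
  transitivity (\int[mu]_x ((EFin : R -> \bar R)^\- x * (normal_pdf 0 s x)%:E))%E.
    rewrite -ge0_integral_normal_variable//; last exact: measurable_funeneg.
    by apply: eq_integral => w _; rewrite funeneg_comp.
  transitivity (\int[mu]_x ((EFin : R -> \bar R)^\+ x * (normal_pdf 0 s x)%:E))%E; last first.
    rewrite -ge0_integral_normal_variable//; last exact: measurable_funepos.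
    by apply: eq_integral => w _; rewrite (funepos_comp EFin X).
  rewrite -[RHS]ge0_integral_opp.
  - apply: eq_integral => x _; congr (_ * _%:E)%E.
      by rewrite funenegE funeposE EFinN.
    by rewrite !normal_pdfE ?gt_eqF// /normal_fun !subr0 sqrrN.
  - apply: emeasurable_funM; first exact: measurable_funepos.
    by apply/measurable_EFinP; exact: measurable_normal_pdf.
  - by move=> x; rewrite mule_ge0// lee_fin normal_pdf_ge0.
rewrite subee//; apply: integrable_fin_num => //.
by apply: integrable_funepos => //; exact: integrable_normal_variable.
Qed.

End normal_variable.

Section adapted.
Context {R : realType} {dT : measure_display} {T : measurableType dT}.
Implicit Types (G : set_system T) (X Y : T -> R).

Definition adapted G X : Prop :=
  measurable_fun [set: g_sigma_algebraType G] (X : g_sigma_algebraType G -> R).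

Lemma adaptedP G X : sigma_algebra setT G ->
  adapted G X <-> forall U, measurable U -> G (X @^-1` U).
Proof.
move=> sG; split => [mX U mU|h].
  have := mX measurableT U mU; rewrite setTI.
  by rewrite (measurable_g_measurableTypeE sG).
move=> _ U mU; rewrite setTI (measurable_g_measurableTypeE sG); exact: h.
Qed.

Lemma adapted_sub G G' X : G `<=` G' -> adapted G X -> adapted G' X.
Proof.
move=> GG' mX _ U mU; have := mX measurableT U mU.
have h : <<s G >> `<=` <<s G' >> by exact: sub_sigma_algebra2.
exact: h.
Qed.

Lemma adapted_measurable G X : G `<=` measurable -> adapted G X ->
  measurable_fun setT X.
Proof.
move=> GM mX _ U mU; have := mX measurableT U mU.
by apply: smallest_sub => //; exact: sigma_algebra_measurable.
Qed.

Lemma measurable_wrt_continuous G (E : topologicalType) (X : T -> E) (phi : E -> R) :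
  measurable_wrt G X -> continuous phi -> adapted G (phi \o X).
Proof.
move=> mX /continuousP cphi.
apply: (measurability _ (RGenOpens.measurableE R)).
move=> _ [_ [a [b ->] <-]]; rewrite setTI.
apply: sub_sigma_algebra; rewrite comp_preimage; apply: mX.
by apply: sub_sigma_algebra; apply: cphi; exact: interval_open.
Qed.

Lemma adapted_setP G (A : set T) : sigma_algebra setT G -> G A ->
  adapted G (\1_A : T -> R).
Proof.
move=> sG GA; apply: measurable_indic.
by rewrite (measurable_g_measurableTypeE sG).
Qed.

Lemma adapted_le_set G X c : sigma_algebra setT G -> adapted G X ->
  G [set w | X w <= c].
Proof.
move=> sG /(adaptedP _ sG)/(_ `]-oo, c]%classic).
rewrite (_ : X @^-1` _ = [set w | X w <= c]); first by apply; exact: measurable_itv.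
by apply/seteqP; split => w /=; rewrite in_itv.
Qed.

Lemma adapted_sum G (I : Type) (s : seq I) (p : pred I) (X : I -> T -> R) :
  (forall i, p i -> adapted G (X i)) -> adapted G (fun w => \sum_(i <- s | p i) X i w).
Proof.
move=> mX; elim: s => [|i s ih].
  by under eq_fun do rewrite big_nil; exact: measurable_cst.
have [pi|npi] := boolP (p i); last by under eq_fun do rewrite big_cons (negbTE npi).
under eq_fun do rewrite big_cons pi.
exact: (measurable_funD (mX i pi) ih).
Qed.

End adapted.

Section square_integrable.
Context {R : realType} {dT : measure_display} {T : measurableType dT}.
Variable P : probability T R.
Implicit Types (X Y : T -> R).

Definition rint X := P.-integrable setT (EFin \o X).
Local Notation Ex X := (\int[P]_w (X w)).

Lemma rint_measurable X : rint X -> measurable_fun setT X.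
Proof. by move=> /integrableP[/measurable_EFinP]. Qed.

Lemma rint_le X Y : measurable_fun setT X -> rint Y ->
  (forall w, `|X w| <= Y w) -> rint X.
Proof.
move=> mX iY XY; apply: (@le_integrable _ _ _ P setT measurableT _ (EFin \o Y)) => //.
  exact/measurable_EFinP.
by move=> w _ /=; rewrite lee_fin (le_trans (XY w))// ler_norm.
Qed.

Lemma rint_cst c : rint (fun=> c).
Proof. exact: finite_measure_integrable_cst. Qed.

Lemma rintD X Y : rint X -> rint Y -> rint (fun w => X w + Y w).
Proof. by move=> iX iY; exact: (integrableD measurableT iX iY). Qed.

Lemma rintB X Y : rint X -> rint Y -> rint (fun w => X w - Y w).
Proof. by move=> iX iY; exact: (integrableB measurableT iX iY). Qed.

Lemma rintZ c X : rint X -> rint (fun w => c * X w).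
Proof. by move=> iX; exact: (integrableZl measurableT c iX). Qed.

Lemma rint_sum (I : Type) (s : seq I) (p : pred I) (X : I -> T -> R) :
  (forall i, p i -> rint (X i)) -> rint (fun w => \sum_(i <- s | p i) X i w).
Proof.
move=> iX; elim: s => [|i s ih].
  by under eq_fun do rewrite big_nil; exact: rint_cst.
have [pi|npi] := boolP (p i); last by under eq_fun do rewrite big_cons (negbTE npi).
by under eq_fun do rewrite big_cons pi; exact: (rintD (iX i pi) ih).
Qed.

Lemma rint_bounded X M : measurable_fun setT X -> (forall w, `|X w| <= M) -> rint X.
Proof. by move=> mX XM; apply: rint_le (rint_cst M) _. Qed.

Lemma ExD X Y : rint X -> rint Y -> Ex (fun w => X w + Y w) = Ex X + Ex Y.
Proof. exact: RintegralD. Qed.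

Lemma ExB X Y : rint X -> rint Y -> Ex (fun w => X w - Y w) = Ex X - Ex Y.
Proof. exact: RintegralB. Qed.

Lemma ExZ c X : rint X -> Ex (fun w => c * X w) = c * Ex X.
Proof. exact: RintegralZl. Qed.

Lemma Ex_cst c : Ex (fun=> c) = c.
Proof. rewrite /Rintegral integral_cst//= probability_setT mule1.
by []. Qed.

Lemma Ex_le X Y : rint X -> rint Y -> (forall w, X w <= Y w) -> Ex X <= Ex Y.
Proof. by move=> iX iY XY; exact: le_Rintegral. Qed.

Lemma Ex_ge0 X : (forall w, 0 <= X w) -> 0 <= Ex X.
Proof. by move=> X0; apply: Rintegral_ge0. Qed.

Lemma Ex_sum (I : Type) (s : seq I) (p : pred I) (X : I -> T -> R) :
  (forall i, p i -> rint (X i)) ->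
  Ex (fun w => \sum_(i <- s | p i) X i w) = \sum_(i <- s | p i) Ex (X i).
Proof.
move=> iX; elim: s => [|i s ih].
  by under [LHS]eq_Rintegral do rewrite big_nil; rewrite big_nil Ex_cst.
rewrite big_cons; have [pi|npi] := boolP (p i); last first.
  by under [LHS]eq_Rintegral do rewrite big_cons (negbTE npi).
under [LHS]eq_Rintegral do rewrite big_cons pi.
by rewrite ExD ?ih//; [exact: iX|exact: rint_sum].
Qed.

Definition sqint X := measurable_fun setT X /\ rint (fun w => X w ^+ 2).

Lemma sqint_mul X Y : sqint X -> sqint Y -> rint (fun w => X w * Y w).
Proof.
move=> [mX iX] [mY iY]; apply: rint_le (rintD iX iY) _.
  exact: measurable_funM.
move=> w; rewrite normrM.
have := sqr_ge0 (`|X w| - `|Y w|); rewrite sqrrB !real_normK ?num_real//.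
rewrite -mulr_natr; have := sqr_ge0 (X w); have := sqr_ge0 (Y w); lra.
Qed.

Lemma sqint_bounded X M : measurable_fun setT X -> (forall w, `|X w| <= M) -> sqint X.
Proof.
move=> mX XM; split => //; apply: (@rint_bounded _ (M ^+ 2)).
  exact: measurable_funX.
by move=> w; rewrite normrX ler_pXn2r// ?nnegrE// (le_trans _ (XM w)).
Qed.

Lemma sqintD X Y : sqint X -> sqint Y -> sqint (fun w => X w + Y w).
Proof.
move=> sX sY; have iXY := sqint_mul sX sY; case: sX sY => [mX iX] [mY iY].
split; first exact: measurable_funD.
under eq_fun do rewrite sqrrD -mulr_natl.
by apply: rintD => //; apply: rintD => //; exact: rintZ.
Qed.

Lemma sqintZ c X : sqint X -> sqint (fun w => c * X w).
Proof.
move=> [mX iX]; split; first exact: measurable_funM.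
by under eq_fun do rewrite exprMn; exact: rintZ.
Qed.

Lemma sqintB X Y : sqint X -> sqint Y -> sqint (fun w => X w - Y w).
Proof.
move=> sX sY; under eq_fun do rewrite -mulN1r.
by apply: sqintD => //; exact: sqintZ.
Qed.

Lemma sqint_sum (I : Type) (s : seq I) (p : pred I) (X : I -> T -> R) :
  (forall i, p i -> sqint (X i)) -> sqint (fun w => \sum_(i <- s | p i) X i w).
Proof.
move=> iX; elim: s => [|i s ih].
  under eq_fun do rewrite big_nil; apply: (@sqint_bounded _ 0) => //.
  by move=> w; rewrite normr0.
have [pi|npi] := boolP (p i); last by under eq_fun do rewrite big_cons (negbTE npi).
by under eq_fun do rewrite big_cons pi; exact: (sqintD (iX i pi) ih).
Qed.

Lemma sqint_rint X : sqint X -> rint X.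
Proof.
move=> sX; have s1 : sqint (fun=> 1 : R).
  by apply: (@sqint_bounded _ 1) => // w; rewrite normr1.
by have := sqint_mul sX s1; under eq_fun do rewrite mulr1.
Qed.

Lemma sqint_max X Y : sqint X -> sqint Y -> sqint (fun w => Num.max (X w) (Y w)).
Proof.
move=> sX sY; have [mX iX] := sX; have [mY iY] := sY.
split; first exact: measurable_maxr.
apply: rint_le (rintD iX iY) _.
  by apply: measurable_funX; exact: measurable_maxr.
move=> w; rewrite ger0_norm ?sqr_ge0//.
by rewrite maxEle; case: ifP => _; rewrite ?lerDl ?lerDr sqr_ge0.
Qed.

End square_integrable.

Section running_maximum.
Context {R : realType}.
Implicit Types u : nat -> R.

Fixpoint runmax u (n : nat) : R :=
  if n is k.+1 then Num.max (runmax u k) (u n) else 0.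

Lemma runmax_ge0 u n : 0 <= runmax u n.
Proof. by elim: n => //= n ih; rewrite le_max ih. Qed.

Lemma runmax_ge u n j : (0 < j <= n)%N -> u j <= runmax u n.
Proof.
elim: n => [|n ih] /andP[j0 jn]; first by rewrite leqn0 in jn; rewrite (eqP jn) in j0.
move: jn; rewrite leq_eqVlt => /predU1P[->|jn]; rewrite /= le_max ?lexx ?orbT//.
by rewrite ih// j0.
Qed.

Lemma runmax_le u v n : (forall j, (0 < j <= n)%N -> u j <= v j) ->
  runmax u n <= runmax v n.
Proof.
elim: n => //= n ih uv; rewrite ge_max !le_max ih ?uv ?orbT ?leqnn//.
by move=> j /andP[j0 jn]; rewrite uv// j0 leqW.
Qed.

Lemma runmax_doob u n : u 0 = 0 ->
  runmax u n ^+ 2 <= 4 * u n ^+ 2 - 4 * \sum_(i < n) runmax u i * (u i.+1 - u i).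
Proof.
move=> u0.
have key : runmax u n ^+ 2 <=
    2 * (runmax u n * u n) - 2 * \sum_(i < n) runmax u i * (u i.+1 - u i).
  elim: n => [|n]; first by rewrite big_ord0 /= expr0n/= mul0r !mulr0 subrr.
  rewrite big_ord_recr /=.
  set S := (\sum_(_ < _) _); set m := runmax u n => ih.
  rewrite maxEle; case: (leP m (u n.+1)) => h.
    have := sqr_ge0 (u n.+1 - m).
    rewrite (_ : (u n.+1 - m) ^+ 2 = u n.+1 ^+ 2 - 2 * (m * u n.+1) + m ^+ 2); last by ring.
    lra.
  lra.
have := sqr_ge0 (runmax u n - 2 * u n).
rewrite (_ : (runmax u n - 2 * u n) ^+ 2 = runmax u n ^+ 2 - 4 * (runmax u n * u n) + 4 * u n ^+ 2).
  lra.
by ring.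
Qed.

End running_maximum.

Section martingale_differences.
Context {R : realType} {dT : measure_display} {T : measurableType dT}.
Variable P : probability T R.
Local Notation Ex X := (\int[P]_w (X w)).

Definition mdiff (G0 G1 : set_system T) (D : T -> R) : Prop :=
  [/\ sqint P D, adapted G1 D &
      forall U, adapted G0 U -> sqint P U -> Ex (fun w => U w * D w) = 0].

Lemma mdiff_sum G0 G1 (I : Type) (s : seq I) (D : I -> T -> R) :
  (forall i, mdiff G0 G1 (D i)) -> mdiff G0 G1 (fun w => \sum_(i <- s) D i w).
Proof.
move=> mD; split.
- by apply: sqint_sum => i _; case: (mD i).
- by apply: adapted_sum => i _; case: (mD i).
- move=> U aU sU; under [LHS]eq_Rintegral do rewrite mulr_sumr.
  rewrite Ex_sum ?big1// => i _; have [sD _ UD] := mD i; first exact: UD.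
  exact: sqint_mul.
Qed.

Variables (n : nat) (G : nat -> set_system T) (D : nat -> T -> R).
Hypothesis G_le : forall i j, (i <= j <= n)%N -> G i `<=` G j.
Hypothesis mD : forall j, (j < n)%N -> mdiff (G j) (G j.+1) (D j).

Definition mart (j : nat) (w : T) : R := \sum_(i < j) D i w.

Lemma mart_adapted j : (j <= n)%N -> adapted (G j) (mart j).
Proof.
move=> jn; apply: adapted_sum => i _.
have [|_ aD _] := mD (j := i); first exact: leq_trans (ltn_ord i) jn.
by apply: adapted_sub aD; apply: G_le; rewrite ltn_ord jn.
Qed.

Lemma mart_sqint j : (j <= n)%N -> sqint P (mart j).
Proof.
move=> jn; apply: sqint_sum => i _.
by have [|sD _ _] := mD (j := i); first exact: leq_trans (ltn_ord i) jn.
Qed.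

Lemma mart_isometry j : (j <= n)%N ->
  Ex (fun w => mart j w ^+ 2) = \sum_(i < j) Ex (fun w => D i w ^+ 2).
Proof.
elim: j => [|j ih] jn.
  by rewrite big_ord0 /mart; under eq_Rintegral do rewrite big_ord0 expr0n/=; rewrite Ex_cst.
rewrite big_ord_recr/= -ih; last exact: ltnW.
have sM := mart_sqint (ltnW jn); have aM := mart_adapted (ltnW jn).
have [sD aD UD] := mD jn.
transitivity (Ex (fun w => (mart j w ^+ 2 + D j w ^+ 2) + 2 * (mart j w * D j w))).
  by apply: eq_Rintegral => w _; rewrite /mart big_ord_recr/=; ring.
have iMD := sqint_mul sM sD; case: sM => mM iM; case: (sD) => mDj iD.
rewrite ExD; [|exact: rintD|exact: rintZ].
rewrite ExD// ExZ// UD ?mulr0 ?addr0//.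
Qed.

Lemma runmax_adapted_sqint j : (j <= n)%N ->
  adapted (G j) (fun w => runmax (mart ^~ w) j) /\ sqint P (fun w => runmax (mart ^~ w) j).
Proof.
elim: j => [_|j ih jn] /=.
  split; first exact: measurable_cst.
  by apply: (@sqint_bounded _ _ _ _ _ 0) => // w; rewrite normr0.
have [aj sj] := ih (ltnW jn); split.
  apply: measurable_maxr; last exact: mart_adapted.
  by apply: adapted_sub aj; apply: G_le; rewrite leqnSn.
by apply: sqint_max => //; exact: mart_sqint.
Qed.

Lemma mart_doob : Ex (fun w => runmax (mart ^~ w) n ^+ 2) <=
  4 * \sum_(j < n) Ex (fun w => D j w ^+ 2).
Proof.
rewrite -mart_isometry//.
have [aM sM] := runmax_adapted_sqint (leqnn n).
have sn := mart_sqint (leqnn n).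
have iD (i : 'I_n) : rint P (fun w => runmax (mart ^~ w) i * D i w).
  apply: sqint_mul; first by apply runmax_adapted_sqint; exact: ltnW.
  by have [|? _ _] := mD (j := i).
have e0 : Ex (fun w => \sum_(i < n) runmax (mart ^~ w) i * D i w) = 0.
  rewrite Ex_sum// big1// => i _; have [|sD _ UD] := mD (j := i) => //.
  by apply: UD; have [] := runmax_adapted_sqint (ltnW (ltn_ord i)).
rewrite -ExZ; last by case: sn.
rewrite -[leRHS]subr0 -(mulr0 4) -e0 -ExZ; last exact: rint_sum.
rewrite -ExB; last 2 first.
- by apply: rintZ; case: sn.
- by apply: rintZ; exact: rint_sum.
apply: Ex_le => //; first by case: sM.
  by apply: rintB; apply: rintZ; [case: sn|exact: rint_sum].
move=> w; have := @runmax_doob _ (mart ^~ w) n _.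
rewrite {1}/mart big_ord0 => /(_ erefl) /le_trans; apply.
rewrite lerD2l lerN2 ler_pM2l// le_eqVlt; apply/orP; left; apply/eqP.
apply: eq_bigr => i _; congr (_ * _).
by rewrite /mart big_ord_recr/= addrAC subrr add0r.
Qed.

End martingale_differences.

Section brownian.
Context {R : realType} {dT : measure_display} {T : measurableType dT}.
Variables (P : probability T R) (F : R -> set_system T) (m : nat).
Variable B : R -> T -> 'cV[R]_m.
Hypotheses (HF : is_filtration F) (HB : is_brownian P F B).
Local Notation Ex X := (\int[P]_w (X w)).

Implicit Types s t : R.

Definition dB s t (b : 'I_m) (w : T) : R := B t w b 0 - B s w b 0.
Definition nB s t (w : T) : R := \sum_(b < m) dB s t b w ^+ 2.

Lemma B_adapted t b : 0 <= t -> adapted (F t) (fun w => B t w b 0).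
Proof.
move=> t0; apply: (@measurable_wrt_continuous _ _ _ _ _ (B t) (fun u => u b 0)).
  exact: (brownian_adapted HB).
exact: coord_continuous.
Qed.

Lemma dB_adapted s t b : 0 <= s -> s <= t -> adapted (F t) (dB s t b).
Proof.
move=> s0 st; apply: measurable_funB; first by apply: B_adapted; exact: le_trans st.
apply: adapted_sub (B_adapted b s0); exact: (filtration_le HF).
Qed.

Lemma F_measurable t (X : T -> R) : 0 <= t -> adapted (F t) X -> measurable_fun setT X.
Proof. by move=> t0; apply: adapted_measurable; exact: (filtration_measurable HF). Qed.

Lemma nB_adapted s t : 0 <= s -> s <= t -> adapted (F t) (nB s t).
Proof.
by move=> s0 st; apply: adapted_sum => b _; apply: measurable_funX; exact: dB_adapted.
Qed.

Lemma dB_law s t b : 0 <= s -> s < t -> forall U, measurable U ->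
  P (dB s t b @^-1` U) = normal_prob 0 (Num.sqrt (t - s)) U.
Proof.
move=> s0 st U mU.
pose V (i : 'I_m) := if i == b then U else setT.
have mV i : measurable (V i) by rewrite /V; case: ifP.
have := brownian_normal HB s0 st mV.
rewrite (bigD1 b)//= big1 ?mule1; last first.
  by move=> i ib; rewrite /V (negbTE ib); exact: probability_setT.
rewrite {2}/V eqxx => <-; congr (P _); apply/seteqP; split => w /=.
  by move=> Uw i; rewrite /V; case: ifP => // /eqP ->.
by move=> /(_ b); rewrite /V eqxx.
Qed.

Lemma indep_incr s t (xi : T -> R) (phi : 'cV[R]_m -> R) : 0 <= s -> s < t ->
  adapted (F s) xi -> continuous phi -> rint P xi ->
  rint P (fun w => phi (B t w - B s w)) ->
  rint P (fun w => xi w * phi (B t w - B s w)) /\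
  Ex (fun w => xi w * phi (B t w - B s w)) = Ex xi * Ex (fun w => phi (B t w - B s w)).
Proof.
move=> s0 st axi cphi ixi iphi; apply: expectation_indep => // U V mU mV.
have phiV : <<s open >> (phi @^-1` V).
  suff : measurable_fun [set: g_sigma_algebraType open]
      (phi : g_sigma_algebraType (@open 'cV[R]_m) -> R).
    by move=> /(_ measurableT V mV); rewrite setTI.
  apply: (measurability _ (RGenOpens.measurableE R)).
  move=> _ [_ [a [b ->] <-]]; rewrite setTI.
  apply: sub_sigma_algebra.
  by move/continuousP : cphi; apply; exact: interval_open.
apply: (brownian_indep HB s0 st _ phiV).
by have /adaptedP := axi; apply => //; exact: (filtration_sigma_algebra HF).
Qed.

End brownian.

Section cauchy_schwarz.
Context {R : realType}.

Lemma sqr_dot_le d (u v : 'cV[R]_d) : dot u v ^+ 2 <= dot u u * dot v v.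
Proof.
rewrite -!sqr_enorm -exprMn -(real_normK (num_real (dot u v))).
rewrite ler_pXn2r ?nnegrE ?mulr_ge0 ?enorm_ge0// ler_norml dot_le andbT.
have := dot_le (- u) v; rewrite -scaleN1r enormZ normrN normr1 mul1r dotZl.
by rewrite mulN1r lerNl.
Qed.

Lemma sqr_sum_mul_le d (x y : 'I_d -> R) :
  (\sum_i x i * y i) ^+ 2 <= (\sum_i x i ^+ 2) * (\sum_i y i ^+ 2).
Proof.
have := sqr_dot_le (\col_i x i) (\col_i y i); rewrite /dot.
rewrite (eq_bigr (fun i => x i * y i)); last by move=> i _; rewrite !mxE.
rewrite [X in _ <= X * _](eq_bigr (fun i => x i ^+ 2)); last first.
  by move=> i _; rewrite !mxE expr2.
by rewrite [X in _ <= _ * X](eq_bigr (fun i => y i ^+ 2))// => i _; rewrite !mxE expr2.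
Qed.

Lemma sqr_sum_le d (x : 'I_d -> R) : (\sum_i x i) ^+ 2 <= d%:R * \sum_i x i ^+ 2.
Proof.
have := sqr_sum_mul_le x (fun=> 1).
under eq_bigr do rewrite mulr1.
by rewrite expr1n sumr_const card_ord mulrC.
Qed.

End cauchy_schwarz.

Section increments.
Context {R : realType} {dT : measure_display} {T : measurableType dT}.
Variables (P : probability T R) (F : R -> set_system T) (m : nat).
Variable B : R -> T -> 'cV[R]_m.
Hypotheses (HF : is_filtration F) (HB : is_brownian P F B).
Local Notation Ex X := (\int[P]_w (X w)).
Local Notation dB := (dB B).
Local Notation nB := (nB B).

Section one_increment.
Variables (s t : R).
Hypotheses (s0 : 0 <= s) (st : s < t).

Let t0 : 0 <= t. Proof. exact: le_trans s0 (ltW st). Qed.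
Let st' : s <= t. Proof. exact: ltW. Qed.
Let dt0 : 0 < t - s. Proof. by rewrite subr_gt0. Qed.

Let mdB b : measurable_fun setT (dB s t b).
Proof. exact: (F_measurable HF t0 (dB_adapted HF HB b s0 st')). Qed.

Lemma dB4 b : rint P (fun w => dB s t b w ^+ 4) /\
  Ex (fun w => dB s t b w ^+ 4) <= 64 * (t - s) ^+ 2.
Proof.
have [|? h] := normal_variable4 _ (mdB b) (dB_law HB b s0 st).
  by rewrite sqrtr_gt0.
split=> //; rewrite (le_trans h)// -[4%N]/(2 * 2)%N exprM sqr_sqrtr//; exact: ltW.
Qed.

Lemma dB_mean0 b : Ex (dB s t b) = 0.
Proof.
by apply: (normal_variable_mean0 _ (mdB b) (dB_law HB b s0 st)); rewrite sqrtr_gt0.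
Qed.

Lemma dB_sqint b : sqint P (dB s t b).
Proof.
split=> //; have [i4 _] := dB4 b.
apply: rint_le (rintD (rint_cst P 1) i4) _; first exact: measurable_funX.
move=> w; rewrite ger0_norm ?sqr_ge0//.
have := sqr_ge0 (dB s t b w ^+ 2 - 1 / 2); rewrite -[4%N]/(2 * 2)%N exprM.
set y := dB s t b w ^+ 2; nra.
Qed.

Lemma dB2 b : Ex (fun w => dB s t b w ^+ 2) <= 33 * (t - s).
Proof.
have [i4 e4] := dB4 b; have [_ i2] := dB_sqint b.
rewrite -(ler_pM2l (mulr_gt0 (ltr0n R 2) dt0)).
rewrite -ExZ//.
apply: (@le_trans _ _ ((t - s) ^+ 2 + 64 * (t - s) ^+ 2)); last first.
  by rewrite (_ : 2 * (t - s) * (33 * (t - s)) = 66 * (t - s) ^+ 2);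
    [have := sqr_ge0 (t - s); lra|ring].
apply: (@le_trans _ _ ((t - s) ^+ 2 + Ex (fun w => dB s t b w ^+ 4))); last by rewrite lerD2l.
rewrite -[X in _ <= X + _](Ex_cst P ((t - s) ^+ 2)) -ExD//; last exact: rint_cst.
apply: Ex_le => [||w]; first exact: rintZ.
  by apply: rintD => //; exact: rint_cst.
have := sqr_ge0 (dB s t b w ^+ 2 - (t - s)); rewrite -[4%N]/(2 * 2)%N exprM.
set y := dB s t b w ^+ 2; nra.
Qed.

Lemma nB_sqint : sqint P (nB s t).
Proof.
apply: sqint_sum => b _; split; first exact: measurable_funX.
have [h _] := dB4 b.
by rewrite (_ : (fun w => _) = (fun w => dB s t b w ^+ 4))//; apply/funext => w; rewrite -exprM.
Qed.

Lemma nB_mean : 0 <= Ex (nB s t) <= 33 * m%:R * (t - s).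
Proof.
apply/andP; split; first by apply: Ex_ge0 => w; apply: sumr_ge0 => b _; exact: sqr_ge0.
rewrite Ex_sum; last by move=> b _; case: (dB_sqint b).
apply: (@le_trans _ _ (\sum_(b < m) 33 * (t - s))).
  by apply: ler_sum => b _; exact: dB2.
by rewrite sumr_const card_ord -mulr_natr; set u := t - s; lra.
Qed.

Lemma nB2 : Ex (fun w => nB s t w ^+ 2) <= 64 * m%:R ^+ 2 * (t - s) ^+ 2.
Proof.
have i4 : rint P (fun w => \sum_(b < m) dB s t b w ^+ 4).
  by apply: rint_sum => b _; case: (dB4 b).
apply: (@le_trans _ _ (Ex (fun w => m%:R * \sum_(b < m) dB s t b w ^+ 4))).
  apply: Ex_le; [by case: nB_sqint|exact: rintZ|move=> w].
  apply: le_trans (sqr_sum_le _) _; rewrite ler_wpM2l//.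
  by apply: ler_sum => b _; rewrite -exprM.
rewrite ExZ// Ex_sum; last by move=> b _; case: (dB4 b).
rewrite [X in _ <= X](_ : _ = m%:R * \sum_(b < m) 64 * (t - s) ^+ 2).
  by rewrite ler_wpM2l//; apply: ler_sum => b _; exact: (dB4 b).2.
by rewrite sumr_const card_ord -mulr_natr; ring.
Qed.

Lemma mdiff_incr (xi Y : T -> R) (phi : 'cV[R]_m -> R) :
  continuous phi -> Y = (fun w => phi (B t w - B s w)) ->
  adapted (F s) xi -> sqint P xi ->
  adapted (F t) Y -> sqint P Y -> Ex Y = 0 ->
  mdiff P (F s) (F t) (fun w => xi w * Y w) /\
  Ex (fun w => (xi w * Y w) ^+ 2) = Ex (fun w => xi w ^+ 2) * Ex (fun w => Y w ^+ 2).
Proof.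
move=> cphi YE axi sxi aY sY Y0.
have cphi2 : continuous (fun u => phi u ^+ 2).
  by move=> u; apply: (@continuous_comp _ _ _ phi (fun x => x ^+ 2)); [exact: cphi|exact: exprn_continuous].
have Y2E : (fun w => Y w ^+ 2) = (fun w => phi (B t w - B s w) ^+ 2) by rewrite YE.
have [|i2 e2] := indep_incr HF HB s0 st (measurable_funX 2 axi) cphi2 (proj2 sxi).
  by rewrite -Y2E; case: sY.
have E2 : (fun w => (xi w * Y w) ^+ 2) =
   (fun w => xi w ^+ 2 * phi (B t w - B s w) ^+ 2).
  by apply/funext => w; rewrite exprMn YE.
have sF : F s `<=` F t by exact: (filtration_le HF).
split; last by rewrite E2 e2 Y2E.
split.
- split; last by rewrite E2.
  by case: sxi => mxi _; case: sY => mY _; exact: measurable_funM.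
- by apply: measurable_funM => //; exact: adapted_sub axi.
- move=> U aU sU; under eq_Rintegral do rewrite mulrA.
  have aUxi : adapted (F s) (fun w => U w * xi w) by exact: measurable_funM.
  have [||_] := indep_incr HF HB s0 st aUxi cphi.
  + exact: sqint_mul.
  + by rewrite -YE; exact: sqint_rint.
  + by rewrite YE => ->; rewrite -YE Y0 mulr0.
Qed.

Lemma mdiff_dB (xi : 'I_m -> T -> R) :
  (forall b, adapted (F s) (xi b)) -> (forall b, sqint P (xi b)) ->
  mdiff P (F s) (F t) (fun w => \sum_b xi b w * dB s t b w) /\
  Ex (fun w => (\sum_b xi b w * dB s t b w) ^+ 2) <=
  33 * m%:R * (t - s) * \sum_b Ex (fun w => xi b w ^+ 2).
Proof.
move=> axi sxi.
have cb (b : 'I_m) : continuous (fun u : 'cV[R]_m => u b 0) by exact: coord_continuous.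
have dBE b : dB s t b = (fun w => (B t w - B s w) b 0).
  by apply/funext => w; rewrite !mxE.
have h b := mdiff_incr (cb b) (dBE b) (axi b) (sxi b)
  (dB_adapted HF HB b s0 st') (dB_sqint b) (dB_mean0 b).
have mD : mdiff P (F s) (F t) (fun w => \sum_b xi b w * dB s t b w).
  by apply: mdiff_sum => b; case: (h b).
split=> //.
have ib b : rint P (fun w => (xi b w * dB s t b w) ^+ 2) by case: (h b) => -[[]].
apply: (@le_trans _ _ (Ex (fun w => m%:R * \sum_b (xi b w * dB s t b w) ^+ 2))).
  apply: Ex_le; [by case: mD => -[]|by apply: rintZ; exact: rint_sum|move=> w].
  exact: sqr_sum_le.
rewrite ExZ; last exact: rint_sum.
rewrite Ex_sum// [leRHS](_ : _ = m%:R * \sum_b Ex (fun w => xi b w ^+ 2) * (33 * (t - s))).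
  rewrite ler_wpM2l//; apply: ler_sum => b _; rewrite (h b).2.
  by rewrite ler_wpM2l ?dB2//; apply: Ex_ge0 => w; exact: sqr_ge0.
by rewrite -mulr_suml; ring.
Qed.

Lemma mdiff_nB (q : T -> R) : adapted (F s) q -> sqint P q ->
  mdiff P (F s) (F t) (fun w => q w * (nB s t w - Ex (nB s t))) /\
  Ex (fun w => (q w * (nB s t w - Ex (nB s t))) ^+ 2) <=
  64 * m%:R ^+ 2 * (t - s) ^+ 2 * Ex (fun w => q w ^+ 2).
Proof.
move=> aq sq; set v := Ex (nB s t).
pose phi (u : 'cV[R]_m) : R := enorm u ^+ 2 - v.
have cphi : continuous phi.
  move=> u; apply: (@continuousB R R^o _ (fun u => enorm u ^+ 2) (cst v)); last exact: cst_continuous.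
  by apply: (@continuous_comp _ _ _ (@enorm R m) (fun x => x ^+ 2));
    [exact: enorm_continuous|exact: exprn_continuous].
have phiE : (fun w => nB s t w - v) = (fun w => phi (B t w - B s w)).
  apply/funext => w; rewrite /phi sqr_enorm; congr (_ - _).
  by apply: eq_bigr => b _; rewrite /dB !mxE expr2.
have iN := sqint_rint nB_sqint.
have sphi : sqint P (fun w => nB s t w - v).
  apply: (@sqintB _ _ _ P _ (fun=> v)); first exact: nB_sqint.
  by apply: (@sqint_bounded _ _ _ P (fun=> v) `|v|) => // w.
have aphi : adapted (F t) (fun w => nB s t w - v).
  by apply: measurable_funB; [exact: (nB_adapted HF HB s0 st')|exact: measurable_cst].
have phi0 : Ex (fun w => nB s t w - v) = 0.
  by rewrite ExB ?Ex_cst ?subrr//; exact: rint_cst.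
have [mD eD] := mdiff_incr cphi phiE aq sq aphi sphi phi0.
split=> //; rewrite eD mulrC ler_wpM2r//; first by apply: Ex_ge0 => w; exact: sqr_ge0.
apply: le_trans nB2.
rewrite (_ : (fun w => _) = (fun w => (nB s t w ^+ 2 + v ^+ 2) - (2 * v) * nB s t w)); last first.
  by apply/funext => w; ring.
have [_ iN2] := nB_sqint.
have iv := rint_cst P (v ^+ 2).
rewrite (ExB (rintD iN2 iv) (rintZ (2 * v) iN)) (ExD iN2 iv) (ExZ _ iN) Ex_cst.
by rewrite -/v; have := sqr_ge0 v; nra.
Qed.

End one_increment.
End increments.

Section hilbert_schmidt.
Context {R : realType} (d m : nat).
Implicit Types M N : 'M[R]_(d, m).

Lemma sqr_hsnorm M : hsnorm M ^+ 2 = \sum_i \sum_j M i j ^+ 2.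
Proof.
have e : \tr (M *m M^T) = \sum_i \sum_j M i j ^+ 2.
  by apply: eq_bigr => i _; rewrite mxE; apply: eq_bigr => j _; rewrite mxE expr2.
rewrite sqr_sqrtr e//; apply: sumr_ge0 => i _; apply: sumr_ge0 => j _.
exact: sqr_ge0.
Qed.

Lemma hsnorm_ge0 M : 0 <= hsnorm M.
Proof. exact: sqrtr_ge0. Qed.

Lemma sqr_entry_le M i j : M i j ^+ 2 <= hsnorm M ^+ 2.
Proof.
rewrite sqr_hsnorm (bigD1 i)//= (bigD1 j)//= -addrA lerDl addr_ge0//.
  by apply: sumr_ge0 => k _; exact: sqr_ge0.
by apply: sumr_ge0 => k _; apply: sumr_ge0 => l _; exact: sqr_ge0.
Qed.

Lemma sqr_hsnormB_le M N K :
  hsnorm (M - N) ^+ 2 <= 2 * hsnorm (M - K) ^+ 2 + 2 * hsnorm (K - N) ^+ 2.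
Proof.
rewrite !sqr_hsnorm !mulr_sumr -big_split/=; apply: ler_sum => i _.
rewrite !mulr_sumr -big_split/=; apply: ler_sum => j _; rewrite !mxE.
have := sqr_ge0 (M i j - K i j - (K i j - N i j)); nra.
Qed.

Lemma sqr_hsnormZ c M : hsnorm (c *: M) ^+ 2 = c ^+ 2 * hsnorm M ^+ 2.
Proof.
rewrite !sqr_hsnorm mulr_sumr; apply: eq_bigr => i _; rewrite mulr_sumr.
by apply: eq_bigr => j _; rewrite mxE exprMn.
Qed.

Lemma sqr_enorm_mulmx_le M (v : 'cV[R]_m) :
  enorm (M *m v) ^+ 2 <= hsnorm M ^+ 2 * enorm v ^+ 2.
Proof.
rewrite !sqr_enorm sqr_hsnorm mulr_suml; apply: ler_sum => i _.
rewrite !mxE -expr2 (le_trans (sqr_sum_mul_le _ _))//.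
Qed.

End hilbert_schmidt.

Section partitions.
Context {R : realType}.
Implicit Types (tau : nat -> R).

Definition partition n tau :=
  forall i j, (i <= n)%N -> (j <= n)%N -> (tau i < tau j) = (i < j)%N.

Lemma partition_le n tau i j : partition n tau -> (i <= n)%N -> (j <= n)%N ->
  (tau i <= tau j) = (i <= j)%N.
Proof. by move=> p hi hj; rewrite leNgt p// -leqNgt. Qed.

Lemma partition_step n tau : (forall j, (j < n)%N -> tau j < tau j.+1) ->
  partition n tau.
Proof.
move=> h; have mono i j : (j <= n)%N -> (i < j)%N -> tau i < tau j.
  elim: j => // j ih jn; rewrite ltnS leq_eqVlt => /predU1P[->|ij]; first exact: h.
  by apply: lt_trans (h _ jn); exact: ih (ltnW jn) ij.
move=> i j hi hj; case: (ltngtP i j) => [ij|ij|->].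
- exact: mono.
- by apply/negbTE; rewrite -leNgt ltW// mono.
- by rewrite ltxx.
Qed.

Lemma partition_telescope n tau p q (V : zmodType) (f : R -> V) :
  partition n tau -> (p <= q <= n)%N ->
  \sum_(k < n | tau p < tau k.+1 <= tau q) (f (tau k.+1) - f (tau k)) =
  f (tau q) - f (tau p).
Proof.
move=> pt /andP[pq qn].
rewrite (eq_bigl (fun k : 'I_n => (p <= k < q)%N)); last first.
  move=> k; have kn := ltn_ord k.
  have pn := leq_trans pq qn.
  by rewrite (pt _ _ pn kn) (partition_le pt kn qn) ltnS.
rewrite -(telescope_sumr (fun k => f (tau k)) pq).
rewrite [RHS](big_nat_widen _ _ n)// [RHS](big_nat_widenl _ 0)//.
rewrite big_mkord; apply: eq_bigl => k; by rewrite andbC.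
Qed.

End partitions.

Section step_processes.
Context {R : realType} {dT : measure_display} {T : measurableType dT}.
Variables (d m : nat).
Implicit Types S : @simple_process R dT T d m.

Definition step_partition S := partition (sp_size S) (sp_time S).

Definition sp_qv S (w : T) : R :=
  \sum_(j < sp_size S) hsnorm (sp_coef S j w) ^+ 2 * (sp_time S j.+1 - sp_time S j).

Lemma sp_valueE S (j : 'I_(sp_size S)) s w : step_partition S ->
  sp_time S j < s <= sp_time S j.+1 -> sp_value S s w = sp_coef S j w.
Proof.
move=> pS js; rewrite /sp_value (bigD1 j)//= big1 ?addr0// => i /andP[/andP[i1 i2] ij].
case/andP: js => j1 j2.
have h1 := lt_le_trans i1 j2; have h2 := lt_le_trans j1 i2.
move: h1 h2; rewrite !pS//; last exact: ltnW.
  rewrite !ltnS => h1 h2; suff : i == j by rewrite (negbTE ij).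
  by apply/eqP/val_inj/eqP; rewrite eqn_leq h1.
exact: ltnW.
Qed.

Lemma sp_value_sqr S s w : step_partition S ->
  hsnorm (sp_value S s w) ^+ 2 =
  \sum_(j < sp_size S) hsnorm (sp_coef S j w) ^+ 2 *
    \1_(`]sp_time S j, sp_time S j.+1]%classic) s.
Proof.
move=> pS.
have [[j js]|nj] := pselect (exists j : 'I_(sp_size S), sp_time S j < s <= sp_time S j.+1).
  rewrite (sp_valueE _ pS js) (bigD1 j)//= big1 ?addr0 => [|i ij].
    by rewrite indicE mem_set/= ?mulr1// in_itv.
  rewrite indicE memNset ?mulr0//= in_itv/= => is_.
  case/andP: js => j1 j2; case/andP: is_ => i1 i2.
  have h1 := lt_le_trans i1 j2; have h2 := lt_le_trans j1 i2.
  move: h1 h2; rewrite !pS//; last exact: ltnW.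
    rewrite !ltnS => h1 h2; move/eqP: ij; apply.
    by apply/val_inj/eqP; rewrite eqn_leq h1.
  exact: ltnW.
rewrite /sp_value big_pred0; last first.
  by move=> j; apply/negbTE/negP => js; apply: nj; exists j.
rewrite big1 => [|j _].
  rewrite sqr_hsnorm big1// => i _; rewrite big1// => j _.
  by rewrite mxE expr0n.
rewrite indicE memNset ?mulr0//= in_itv/= => js; apply: nj; exists j.
exact: js.
Qed.

Lemma sp_qvE S a w : step_partition S -> sp_time S 0 = 0 ->
  sp_time S (sp_size S) = a ->
  (\int[lebesgue_measure]_(s in `[0%R, a]) (hsnorm (sp_value S s w) ^+ 2)%:E =
    (sp_qv S w)%:E)%E.
Proof.
move=> pS S0 Sa; under eq_integral do rewrite sp_value_sqr// -sumEFin.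
rewrite ge0_integral_sum//; last 2 first.
- by move=> j; apply/measurable_EFinP; apply: measurable_funM.
- by move=> j s _; rewrite lee_fin mulr_ge0// sqr_ge0.
rewrite /sp_qv -sumEFin; apply: eq_bigr => j _.
under eq_integral do rewrite EFinM.
rewrite ge0_integralZl//; last 2 first.
- by apply/measurable_EFinP.
- by rewrite lee_fin sqr_ge0.
rewrite integral_indic// [RHS]EFinM; congr (_ * _)%E.
have t01 : sp_time S j < sp_time S j.+1 by rewrite pS// ltnW.
rewrite setIidl.
  by have := lebesgue_measure_itv `]sp_time S j, sp_time S j.+1]; rewrite /= lte_fin t01 EFinB.
move=> s /=; rewrite !in_itv/= => /andP[s1 s2]; apply/andP; split.
  by rewrite (le_trans _ (ltW s1))// -S0 (partition_le pS)// ltnW.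
by rewrite (le_trans s2)// -Sa (partition_le pS).
Qed.

Section refinement.
Variables (S : @simple_process R dT T d m) (n : nat) (tau : nat -> R).
Hypotheses (pS : step_partition S) (pt : partition n tau).
Hypothesis sub : forall j, (j <= sp_size S)%N -> exists2 p, (p <= n)%N & sp_time S j = tau p.

Lemma refine_value (k : nat) s w : (k < n)%N -> tau k < s <= tau k.+1 ->
  sp_value S s w = sp_value S (tau k.+1) w.
Proof.
move=> kn /andP[s1 s2]; apply: eq_bigl => j.
have [p pn ->] := sub (ltnW (ltn_ord j)); have [q qn ->] := sub (ltn_ord j).
congr (_ && _).
  rewrite pt//; apply/idP/idP => [h|]; last first.
    by rewrite ltnS => pk; rewrite (le_lt_trans _ s1)// (partition_le pt)// ltnW.
  by rewrite -(pt pn kn) (lt_le_trans h).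
rewrite (partition_le pt)//; apply/idP/idP => [h|kq].
  by rewrite -(pt (ltnW kn) qn) (lt_le_trans s1).
by rewrite (le_trans s2)// (partition_le pt).
Qed.

Lemma refine_integral (B : R -> T -> 'cV[R]_m) w :
  sp_integral B S w = \sum_(k < n) sp_value S (tau k.+1) w *m (B (tau k.+1) w - B (tau k) w).
Proof.
rewrite /sp_integral /sp_value.
under [RHS]eq_bigr do rewrite mulmx_suml.
rewrite (exchange_big_dep xpredT)//=; apply: eq_bigr => j _.
rewrite -mulmx_sumr; congr (_ *m _).
have [p pn Ep] := sub (ltnW (ltn_ord j)); have [q qn Eq] := sub (ltn_ord j).
rewrite Ep Eq (partition_telescope (fun t => B t w) pt)//.
rewrite qn andbT -(partition_le pt)// -Ep -Eq (partition_le pS)//; exact: ltnW.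
Qed.

Lemma refine_adapted (F : R -> set_system T) (k : nat) i l : (k < n)%N -> 
  (forall u v, 0 <= u -> u <= v -> F u `<=` F v) -> 0 <= sp_time S 0 ->
  (forall j, (j < sp_size S)%N -> adapted (F (sp_time S j)) (fun w => sp_coef S j w i l)) ->
  adapted (F (tau k)) (fun w => sp_value S (tau k.+1) w i l).
Proof.
move=> kn Fle S0 aS; rewrite /sp_value; under eq_fun do rewrite summxE.
apply: adapted_sum => j /andP[js _].
have [p pn Ep] := sub (ltnW (ltn_ord j)).
apply: adapted_sub (aS _ (ltn_ord j)); apply: Fle.
  by rewrite (le_trans S0)// (partition_le pS)// ltnW.
by rewrite Ep (partition_le pt)//; [rewrite -ltnS -(pt pn kn) -Ep|exact: ltnW].
Qed.

End refinement.

End step_processes.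

Section markov.
Context {R : realType} {dT : measure_display} {T : measurableType dT}.
Variable P : probability T R.

Lemma measurable_ge_set (X : T -> R) c : measurable_fun setT X ->
  measurable [set w | c <= X w].
Proof.
move=> mX; have := mX measurableT `[c, +oo[%classic (measurable_itv _).
rewrite setTI; congr (measurable _); apply/seteqP.
by split => w /=; rewrite in_itv/= andbT.
Qed.

Lemma markov_le (A : set T) (X : T -> R) c : measurable A -> 0 < c ->
  rint P X -> (forall w, 0 <= X w) -> (forall w, A w -> c <= X w) ->
  (P A <= (\int[P]_w X w / c)%:E)%E.
Proof.
move=> mA c0 iX X0 AX.
have iA : rint P (\1_A : T -> R) by exact: integrable_indic.
have -> : P A = (\int[P]_w (\1_A w : R))%:E.
  rewrite /Rintegral fineK; last exact: integrable_fin_num.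
  by rewrite integral_indic// setIT.
rewrite lee_fin ler_pdivlMr// mulrC -ExZ//; apply: Ex_le => //; first exact: rintZ.
move=> w; rewrite indicE; case: (boolP (w \in A)) => [/set_mem/AX|_].
  by rewrite mulr1.
by rewrite mulr0.
Qed.

End markov.

Section adapted_steps.
Context {R : realType} {dT : measure_display} {T : measurableType dT}.
Variables (P : probability T R) (F : R -> set_system T) (d m : nat).
Variable B : R -> T -> 'cV[R]_m.
Hypotheses (HF : is_filtration F) (HB : is_brownian P F B).
Implicit Types S : @simple_process R dT T d m.
Local Notation Ex X := (\int[P]_w (X w)).

Record adapted_step (a : R) S : Prop := {
  as_start : sp_time S 0 = 0 ;
  as_stop : sp_time S (sp_size S) = a ;
  as_partition : step_partition S ;
  as_adapted : forall j, (j < sp_size S)%N -> forall i b,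
    adapted (F (sp_time S j)) (fun w => sp_coef S j w i b) }.

Lemma simple_adapted_step a S : is_simple_on F a S -> adapted_step a S.
Proof.
case=> S0 Sa Slt Sm _; split => //; first exact: partition_step.
move=> j jn i b.
apply: (@measurable_wrt_continuous _ _ _ _ _ (sp_coef S j) (fun M => M i b)).
  exact: Sm.
exact: coord_continuous.
Qed.

Lemma as_time_ge0 a S j : adapted_step a S -> (j <= sp_size S)%N -> 0 <= sp_time S j.
Proof. by move=> aS jn; rewrite -(as_start aS) (partition_le (as_partition aS)). Qed.

Lemma as_time_lt a S j : adapted_step a S -> (j < sp_size S)%N ->
  sp_time S j < sp_time S j.+1.
Proof. by move=> aS jn; rewrite (as_partition aS)// ltnW. Qed.

Lemma as_time_le a S j : adapted_step a S -> (j <= sp_size S)%N -> sp_time S j <= a.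
Proof. by move=> aS jn; rewrite -(as_stop aS) (partition_le (as_partition aS)). Qed.

Lemma sp_integral_entry S w i : sp_integral B S w i 0 =
  \sum_(j < sp_size S) \sum_b sp_coef S j w i b * dB B (sp_time S j) (sp_time S j.+1) b w.
Proof.
rewrite /sp_integral summxE; apply: eq_bigr => j _; rewrite mxE.
by apply: eq_bigr => b _; rewrite /dB !mxE.
Qed.

Lemma as_coef_measurable a S j i b : adapted_step a S -> (j < sp_size S)%N ->
  measurable_fun setT (fun w => sp_coef S j w i b).
Proof.
move=> aS jn; exact: (F_measurable HF (as_time_ge0 aS (ltnW jn)) (as_adapted aS jn i b)).
Qed.

Lemma as_measurable a S i : adapted_step a S ->
  measurable_fun setT (fun w => sp_integral B S w i 0).
Proof.
move=> aS; under eq_fun do rewrite sp_integral_entry.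
apply: measurable_sum => j; apply: measurable_sum => b.
apply: measurable_funM; first exact: as_coef_measurable aS _.
have t1 := as_time_ge0 aS (ltn_ord j); have t0 := as_time_ge0 aS (ltnW (ltn_ord j)).
apply: (F_measurable HF t1); apply: (dB_adapted HF HB _ t0).
exact/ltW/(as_time_lt aS (ltn_ord j)).
Qed.

Lemma enorm2_as_measurable a S : adapted_step a S ->
  measurable_fun setT (fun w => enorm (sp_integral B S w) ^+ 2).
Proof.
move=> aS; under eq_fun do rewrite sqr_enorm.
apply: measurable_sum => i.
by apply: measurable_funM; exact: as_measurable aS.
Qed.

Lemma sp_qv_measurable a S : adapted_step a S -> measurable_fun setT (sp_qv S).
Proof.
move=> aS; apply: measurable_sum => j; apply: measurable_funM => //.
under eq_fun do rewrite sqr_hsnorm.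
apply: measurable_sum => i; apply: measurable_sum => b; apply: measurable_funX.
exact: as_coef_measurable aS _.
Qed.

Lemma sp_qv_ge0 a S w : adapted_step a S -> 0 <= sp_qv S w.
Proof.
move=> aS; apply: sumr_ge0 => j _; rewrite mulr_ge0 ?sqr_ge0// subr_ge0 ltW//.
exact: (as_time_lt aS).
Qed.

Lemma step_mdiff a S i (j : nat) : adapted_step a S -> (j < sp_size S)%N ->
  (forall b, sqint P (fun w => sp_coef S j w i b)) ->
  mdiff P (F (sp_time S j)) (F (sp_time S j.+1))
    (fun w => \sum_b sp_coef S j w i b * dB B (sp_time S j) (sp_time S j.+1) b w) /\
  Ex (fun w => (\sum_b sp_coef S j w i b * dB B (sp_time S j) (sp_time S j.+1) b w) ^+ 2)
    <= 33 * m%:R * (sp_time S j.+1 - sp_time S j) * \sum_b Ex (fun w => sp_coef S j w i b ^+ 2).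
Proof.
move=> aS jn sS.
apply: (mdiff_dB HF HB (as_time_ge0 aS (ltnW jn)) (as_time_lt aS jn) _ sS).
exact: as_adapted aS _ jn i.
Qed.

Lemma step_isometry a S : adapted_step a S ->
  (forall j, (j < sp_size S)%N -> forall i b, sqint P (fun w => sp_coef S j w i b)) ->
  rint P (fun w => enorm (sp_integral B S w) ^+ 2) /\
  Ex (fun w => enorm (sp_integral B S w) ^+ 2) <= 33 * m%:R * Ex (sp_qv S).
Proof.
move=> aS sS.
pose D i j w := \sum_b sp_coef S j w i b * dB B (sp_time S j) (sp_time S j.+1) b w.
pose n := sp_size S.
have mD i j : (j < n)%N -> mdiff P (F (sp_time S j)) (F (sp_time S j.+1)) (D i j).
  by move=> jn; have [] := @step_mdiff a S i j aS jn (sS j jn i).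
have GF i j : (i <= j <= n)%N -> F (sp_time S i) `<=` F (sp_time S j).
  move=> /andP[ij jn]; apply: (filtration_le HF).
    exact: (as_time_ge0 aS (leq_trans ij jn)).
  by rewrite (partition_le (as_partition aS))// (leq_trans ij).
have sM i := @mart_sqint _ _ _ P n (fun j => F (sp_time S j)) (D i) (mD i) n (leqnn n).
have eM i := mart_isometry GF (mD i) (leqnn n).
have E w : enorm (sp_integral B S w) ^+ 2 = \sum_i mart (D i) n w ^+ 2.
  by rewrite sqr_enorm; apply: eq_bigr => i _; rewrite sp_integral_entry expr2.
split.
  by under eq_fun do rewrite E; apply: rint_sum => i _; case: (sM i).
under [leLHS]eq_Rintegral do rewrite E.
rewrite Ex_sum; last by move=> i _; case: (sM i).
under eq_bigr do rewrite eM.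
have iS j : (j < n)%N -> forall i b, rint P (fun w => sp_coef S j w i b ^+ 2).
  by move=> jn i b; case: (sS j jn i b).
have ihs (j : 'I_n) : rint P (fun w => hsnorm (sp_coef S j w) ^+ 2).
  under eq_fun do rewrite sqr_hsnorm.
  by apply: rint_sum => i _; apply: rint_sum => b _; exact: iS.
rewrite /sp_qv Ex_sum; last first.
  by move=> j _; under eq_fun do rewrite mulrC; exact: rintZ.
rewrite exchange_big mulr_sumr /=; apply: ler_sum => j _.
under [X in _ <= _ * X]eq_Rintegral do rewrite mulrC sqr_hsnorm.
rewrite ExZ; last by under eq_fun do rewrite -sqr_hsnorm; exact: ihs.
rewrite Ex_sum; last by move=> i _; apply: rint_sum => b _; exact: iS.
rewrite mulrA mulr_sumr; apply: ler_sum => i _.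
rewrite Ex_sum; last by move=> b _; exact: iS.
by have [] := @step_mdiff a S i j aS (ltn_ord j) (sS j (ltn_ord j) i).
Qed.

Definition sp_trunc S (delta : R) : @simple_process R dT T d m :=
  SimpleProcess (sp_size S) (sp_time S) (fun j w =>
    \1_[set w | \sum_(i < j.+1) hsnorm (sp_coef S i w) ^+ 2 *
       (sp_time S i.+1 - sp_time S i) <= delta] w *: sp_coef S j w).

Lemma sp_truncE S delta w : 0 <= delta ->
  (forall j, (j < sp_size S)%N -> 0 <= sp_time S j.+1 - sp_time S j) ->
  (sp_qv S w <= delta -> sp_integral B (sp_trunc S delta) w = sp_integral B S w) /\
  sp_qv (sp_trunc S delta) w <= delta.
Proof.
move=> delta0 t0; rewrite /sp_qv /sp_integral /=.
set n := sp_size S; pose term i := hsnorm (sp_coef S i w) ^+ 2 *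
       (sp_time S i.+1 - sp_time S i).
pose q j := \sum_(i < j) term i.
have term0 j : (j < n)%N -> 0 <= term j by move=> jn; rewrite mulr_ge0 ?sqr_ge0 ?t0.
have qmono i j : (i <= j)%N -> (j <= n)%N -> q i <= q j.
  elim: j => [|j ih]; first by rewrite leqn0 => /eqP ->.
  rewrite leq_eqVlt => /predU1P[->//|ij] jn.
  by rewrite (le_trans (ih ij (ltnW jn)))// /q big_ord_recr/= lerDl term0.
split=> [qn|].
  apply: eq_bigr => j _; rewrite indicE mem_set ?scale1r//=.
  exact: le_trans (qmono j.+1 n (ltn_ord j) (leqnn n)) qn.
pose term' j := hsnorm (\1_[set w0 | \sum_(i < j.+1) hsnorm (sp_coef S i w0) ^+ 2 *
     (sp_time S i.+1 - sp_time S i) <= delta] w *: sp_coef S j w) ^+ 2 *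
    (sp_time S j.+1 - sp_time S j).
have term'E j : term' j = if q j.+1 <= delta then term j else 0.
  rewrite /term' indicE sqr_hsnormZ; case: ifP => h.
    by rewrite mem_set//= expr1n mul1r.
  by rewrite memNset/= ?expr0n ?mul0r//= => h'; rewrite /q h' in h.
suff : forall k, (k <= n)%N -> \sum_(j < k) term' j <= delta /\
    (q k <= delta -> \sum_(j < k) term' j <= q k) by move=> /(_ n (leqnn n))[].
elim=> [|k ih] kn; first by rewrite /q !big_ord0.
have [ih1 ih2] := ih (ltnW kn); rewrite big_ord_recr/= term'E.
case: ifP => h; last by rewrite addr0; split=> // h'; rewrite h' in h.
have := ih2 (le_trans (qmono _ _ (leqnSn k) kn) h).
have -> : q k.+1 = q k + term k by rewrite /q big_ord_recr.
move=> le_q; split; last by rewrite lerD2r.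
by rewrite (le_trans _ h)// /q big_ord_recr/= lerD2r.
Qed.

Lemma sp_trunc_adapted a S delta : adapted_step a S ->
  adapted_step a (sp_trunc S delta).
Proof.
move=> aS; split=> /=; [exact: as_start aS|exact: as_stop aS|exact: as_partition aS|].
move=> j jn i b; under eq_fun do rewrite mxE.
have tj0 := as_time_ge0 aS (ltnW jn).
have aj k : (k <= j)%N -> forall i b, adapted (F (sp_time S j)) (fun w => sp_coef S k w i b).
  move=> kj i' b'; have kn := leq_ltn_trans kj jn.
  apply: adapted_sub (as_adapted aS kn i' b'); apply: (filtration_le HF).
    exact: (as_time_ge0 aS (ltnW kn)).
  by rewrite (partition_le (as_partition aS))// ltnW.
have sF := filtration_sigma_algebra HF tj0.
apply: measurable_funM; last exact: aj.
apply: (adapted_setP sF); apply: (adapted_le_set _ sF).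
apply: adapted_sum => k _; apply: measurable_funM; last exact: measurable_cst.
under eq_fun do rewrite sqr_hsnorm.
apply: adapted_sum => i' _; apply: adapted_sum => b' _; apply: measurable_funX.
by apply: aj; rewrite -ltnS.
Qed.

Lemma lenglart a S (G : set T) e delta : adapted_step a S -> measurable G ->
  0 < e -> 0 < delta ->
  (P (G `&` [set w | (e <= enorm (sp_integral B S w))%R]) <=
   P (G `&` [set w | (delta <= sp_qv S w)%R]) + (33 * m%:R * delta / e ^+ 2)%:E)%E.
Proof.
move=> aS mG e0 delta0.
have t0 j : (j < sp_size S)%N -> 0 < sp_time S j.+1 - sp_time S j.
  by move=> jn; rewrite subr_gt0 (as_time_lt aS).
have aS' := sp_trunc_adapted delta aS.
have trE w := @sp_truncE S delta w (ltW delta0) (fun j jn => ltW (t0 j jn)).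
pose A := [set w | e ^+ 2 <= enorm (sp_integral B (sp_trunc S delta) w) ^+ 2].
have mA : measurable A.
  exact/measurable_ge_set/(enorm2_as_measurable aS').
have mq : measurable (G `&` [set w | delta <= sp_qv S w]).
  apply: measurableI => //; exact/measurable_ge_set/(sp_qv_measurable aS).
have sS' j : (j < sp_size S)%N -> forall i b, sqint P (fun w => sp_coef (sp_trunc S delta) j w i b).
  move=> jn i b; apply: (@sqint_bounded _ _ _ _ _ (1 + delta / (sp_time S j.+1 - sp_time S j))).
    exact: as_coef_measurable aS' jn.
  move=> w; have [_ q'] := trE w.
  set x := sp_coef _ _ _ _ _.
  suff : x ^+ 2 <= delta / (sp_time S j.+1 - sp_time S j).
    have := sqr_ge0 (`|x| - 1); rewrite -(real_normK (num_real x)); set y := `|x|; nra.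
  rewrite ler_pdivlMr ?t0// (le_trans _ q')//.
  rewrite /sp_qv /= (bigD1 (Ordinal jn))//=.
  apply: (@le_trans _ _ (hsnorm (sp_coef (sp_trunc S delta) j w) ^+ 2 * (sp_time S j.+1 - sp_time S j))).
    by rewrite ler_wpM2r ?sqr_entry_le// ltW ?t0.
  rewrite lerDl; apply: sumr_ge0 => k _.
  by rewrite mulr_ge0 ?sqr_ge0// ltW ?t0.
have [iX eX] := step_isometry aS' sS'.
have PA : (P A <= (33 * m%:R * delta / e ^+ 2)%:E)%E.
  apply: le_trans (markov_le mA (exprn_gt0 2 e0) iX _ _) _; [by move=> w; exact: sqr_ge0|by []|].
  rewrite lee_fin ler_wpM2r ?invr_ge0 ?sqr_ge0// (le_trans eX)//.
  rewrite ler_wpM2l ?mulr_ge0// -[leRHS](Ex_cst P delta).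
  apply: Ex_le; [|exact: rint_cst|by move=> w; case: (trE w)].
  apply: (@rint_bounded _ _ _ _ _ delta).
    exact: sp_qv_measurable aS'.
  by move=> w; rewrite ger0_norm ?(sp_qv_ge0 _ aS')//; case: (trE w).
apply: (@le_trans _ _ (P ((G `&` [set w | delta <= sp_qv S w]) `|` A))).
  apply: le_measure; rewrite ?inE//.
  - apply: measurableI => //.
    rewrite (_ : [set w | _] = [set w | e ^+ 2 <= enorm (sp_integral B S w) ^+ 2]).
      exact/measurable_ge_set/(enorm2_as_measurable aS).
    by apply/seteqP; split => w /=; rewrite ler_pXn2r// nnegrE ?enorm_ge0// ltW.
  - exact: measurableU.
  - move=> w [Gw /= ew]; have [h|h] := leP delta (sp_qv S w); [by left|right].
    rewrite /A /= (trE w).1; last exact: ltW.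
    by rewrite ler_pXn2r// nnegrE ?enorm_ge0// ltW.
rewrite (le_trans (measureU2 _ _ _))//.
by rewrite leeD2l.
Qed.

End adapted_steps.

Section step_difference.
Context {R : realType} {dT : measure_display} {T : measurableType dT}.
Variables (P : probability T R) (F : R -> set_system T) (d m : nat).
Variable B : R -> T -> 'cV[R]_m.
Hypotheses (HF : is_filtration F) (HB : is_brownian P F B).
Implicit Types S : @simple_process R dT T d m.

Definition sp_times S : seq R := [seq sp_time S j | j <- iota 0 (sp_size S).+1].

Lemma mem_sp_times S j : (j <= sp_size S)%N -> sp_time S j \in sp_times S.
Proof. by move=> jn; apply: map_f; rewrite mem_iota. Qed.

Definition merged_times S S' : seq R :=
  sort <=%O (undup (sp_times S ++ sp_times S')).

Definition sp_sub S S' : @simple_process R dT T d m :=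
  let ts := merged_times S S' in
  SimpleProcess (size ts).-1 (nth 0 ts)
    (fun k w => sp_value S (nth 0 ts k.+1) w - sp_value S' (nth 0 ts k.+1) w).

Variables (a : R) (S S' : @simple_process R dT T d m).
Hypotheses (aS : adapted_step F a S) (aS' : adapted_step F a S').

Let ts := merged_times S S'.
Let n := (size ts).-1.

Let mem_ts t : (t \in ts) = (t \in sp_times S) || (t \in sp_times S').
Proof. by rewrite mem_sort mem_undup mem_cat. Qed.

Let ts_gt0 : (0 < size ts)%N.
Proof.
have : sp_time S 0 \in ts by rewrite mem_ts mem_sp_times.
by case: (ts).
Qed.

Let pts : partition n (nth 0 ts).
Proof.
have sts : sorted <%O ts by rewrite Order.TotalTheory.sort_lt_sorted undup_uniq.
move=> i j hi hj; apply: (Order.POrderTheory.lt_sorted_ltn_nth 0 sts).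
  by rewrite inE -(prednK ts_gt0) ltnS.
by rewrite inE -(prednK ts_gt0) ltnS.
Qed.

Let nth_ts t : t \in ts -> exists2 p, (p <= n)%N & t = nth 0 ts p.
Proof.
move=> tin; exists (index t ts); last by rewrite nth_index.
by rewrite -ltnS prednK// index_mem.
Qed.

Let ts_itv t : t \in ts -> 0 <= t <= a.
Proof.
rewrite mem_ts => /orP[] /mapP[j]; rewrite mem_iota ltnS => /= jn ->.
  by rewrite (as_time_ge0 aS jn) (as_time_le aS jn).
by rewrite (as_time_ge0 aS' jn) (as_time_le aS' jn).
Qed.

Let subS j : (j <= sp_size S)%N -> exists2 p, (p <= n)%N & sp_time S j = nth 0 ts p.
Proof. by move=> jn; apply: nth_ts; rewrite mem_ts mem_sp_times. Qed.

Let subS' j : (j <= sp_size S')%N -> exists2 p, (p <= n)%N & sp_time S' j = nth 0 ts p.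
Proof. by move=> jn; apply: nth_ts; rewrite mem_ts mem_sp_times ?orbT. Qed.

Lemma sp_sub_adapted : adapted_step F a (sp_sub S S').
Proof.
have mem_nth_ts k : (k <= n)%N -> nth 0 ts k \in ts.
  by move=> kn; rewrite mem_nth// -(prednK ts_gt0) ltnS.
split => /=.
- have [p pn e] := subS (leq0n _); rewrite (as_start aS) in e.
  apply/le_anti; rewrite [X in _ && X](andP (ts_itv (mem_nth_ts _ (leq0n n)))).1 andbT.
  by rewrite [leRHS]e (partition_le pts).
- have [p pn e] := subS (leqnn _); rewrite (as_stop aS) in e.
  apply/le_anti; rewrite (andP (ts_itv (mem_nth_ts _ (leqnn n)))).2 /=.
  by rewrite {1}e (partition_le pts).
- exact: pts.
- move=> k kn i b; under eq_fun do rewrite !mxE.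
  apply: measurable_funB.
    apply: (refine_adapted (as_partition aS) pts subS kn (filtration_le HF)).
      by rewrite (as_start aS).
    by move=> j jn; exact: as_adapted aS _ jn i b.
  apply: (refine_adapted (as_partition aS') pts subS' kn (filtration_le HF)).
    by rewrite (as_start aS').
  by move=> j jn; exact: as_adapted aS' _ jn i b.
Qed.

Lemma sp_integral_sub w :
  sp_integral B (sp_sub S S') w = sp_integral B S w - sp_integral B S' w.
Proof.
rewrite (refine_integral (as_partition aS) pts subS).
rewrite (refine_integral (as_partition aS') pts subS').
by rewrite -sumrB; apply: eq_bigr => k _; rewrite -mulmxBl.
Qed.

Lemma partition_cover k (tau : nat -> R) s : tau 0 < s <= tau k ->
  exists2 j, (j < k)%N & tau j < s <= tau j.+1.
Proof.
elim: k => [|k ih] /andP[s0 sk]; first by have := lt_le_trans s0 sk; rewrite ltxx.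
have [h|h] := leP s (tau k).
  by have [|j jk hj] := ih; [rewrite s0|exists j => //; exact: ltnW].
by exists k => //; rewrite h.
Qed.

Lemma sp_value_start S1 w : adapted_step F a S1 -> sp_value S1 0 w = 0.
Proof.
move=> aS1; rewrite /sp_value big_pred0// => j.
by rewrite ltNge (as_time_ge0 aS1 (ltnW (ltn_ord j))).
Qed.

Lemma sp_value_sub s w : 0 <= s <= a ->
  sp_value (sp_sub S S') s w = sp_value S s w - sp_value S' s w.
Proof.
have aD := sp_sub_adapted.
rewrite le_eqVlt => /andP[/predU1P[<- _|s0 sa]].
  by rewrite !sp_value_start ?subr0.
have e0 : nth 0 ts 0 = 0 := as_start aD.
have en : nth 0 ts n = a := as_stop aD.
have [|k kn sk] := @partition_cover n (nth 0 ts) s; first by rewrite e0 en s0.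
rewrite (@sp_valueE _ _ _ _ _ (sp_sub S S') (Ordinal kn) s w (as_partition aD) sk).
rewrite (refine_value pts subS _ kn sk).
by rewrite (refine_value pts subS' _ kn sk).
Qed.

Lemma sp_qv_sub w : (\int[lebesgue_measure]_(s in `[0%R, a])
    (hsnorm (sp_value S s w - sp_value S' s w)%R ^+ 2)%:E =
  (sp_qv (sp_sub S S') w)%:E)%E.
Proof.
have aD := sp_sub_adapted.
rewrite -(sp_qvE w (as_partition aD) (as_start aD) (as_stop aD)).
apply: eq_integral => s; rewrite inE/= in_itv/= => sa.
by rewrite sp_value_sub.
Qed.

End step_difference.

Section convergence_in_probability.
Context {R : realType} {dT : measure_display} {T : measurableType dT}.
Variable P : probability T R.

Lemma cvge0P (u : nat -> \bar R) : (forall n, 0 <= u n)%E ->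
  (u n @[n --> \oo] --> 0%E) <->
  (forall e : R, 0 < e -> \forall n \near \oo, (u n < e%:E)%E).
Proof.
move=> u0; split=> [/fine_cvgP[fu cu] e e0|h].
  move/cvgrPdist_lt : cu => /(_ _ e0); move: fu; apply: filterS2 => n fn.
  rewrite sub0r normrN /= => h; rewrite -(fineK fn) lte_fin.
  by rewrite (le_lt_trans _ h)// ler_norm.
apply/fine_cvgP; split.
  have := h 1 ltr01; apply: filterS => n hn.
  by rewrite ge0_fin_numE// (lt_le_trans hn)// leey.
apply/cvgrPdist_lt => e e0; have := h e e0; apply: filterS => n hn.
have fn : u n \is a fin_num by rewrite ge0_fin_numE// (lt_le_trans hn)// leey.
by rewrite sub0r normrN /= ger0_norm ?fine_ge0// -lte_fin fineK.
Qed.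

Lemma borel_cantelli (A : nat -> set T) : (forall n, measurable (A n)) ->
  (forall n, P (A n) <= (1 / (2 ^ n.+1)%:R)%:E)%E ->
  {ae P, forall w, \forall n \near \oo, ~ A n w}.
Proof.
move=> mA PA; exists (lim_sup_set A); split.
- apply: bigcapT_measurable => n; exact: bigcup_measurable.
- apply: lim_sup_set_cvg0 => //; apply: (@le_lt_trans _ _ 1%:E); last by rewrite ltry.
  apply: le_trans (@epsilon_trick0 R 1 xpredT ler01).
  by apply: lee_nneseries => // n _; exact: PA.
- move=> w /= nw n _; apply: contra_notP nw => h.
  exists n => // k /= nk Ak; apply: h; exists k => //.
Qed.

Lemma cvg0_probability_subseq (Y : nat -> T -> \bar R) :
  (forall n, measurable_fun setT (Y n)) -> (forall n w, 0 <= Y n w)%E ->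
  cvg0_in_probability P Y ->
  exists l : nat -> nat, (forall n, n <= l n)%N /\
    {ae P, forall w, Y (l n) w @[n --> \oo] --> 0%E}.
Proof.
move=> mY Y0 cY.
have ex n : exists k, (n <= k)%N /\
    (P [set w | (n.+1%:R^-1)%:E <= Y k w] <= (1 / (2 ^ n.+1)%:R)%:E)%E.
  have n0 : (0 : R) < n.+1%:R^-1 by rewrite invr_gt0.
  have e0 : (0%:E < (1 / (2 ^ n.+1)%:R : R)%:E)%E.
    by rewrite lte_fin divr_gt0// ltr0n expn_gt0.
  have c := cY _ n0; have PY0 k : (0 <= P [set w | (n.+1%:R^-1)%:E <= Y k w])%E by [].
  have /cvge0P : P [set w | (n.+1%:R^-1)%:E <= Y k w]%E @[k --> \oo] --> 0%E by exact: c.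
  move=> /(_ PY0 _ e0)[N _ hN].
  exists (maxn n N); rewrite leq_maxl; split=> //; apply/ltW/hN => /=.
  exact: leq_maxr.
pose l n := sval (cid (ex n)).
have lE n : (n <= l n)%N /\ (P [set w | (n.+1%:R^-1)%:E <= Y (l n) w] <= (1 / (2 ^ n.+1)%:R)%:E)%E.
  exact: svalP (cid (ex n)).
exists l; split=> [n|]; first by case: (lE n).
have mA n : measurable [set w | ((n.+1%:R^-1 : R)%:E <= Y (l n) w)%E].
  rewrite -[X in measurable X]setTI.
  by apply: emeasurable_fun_c_infty => //.
have := borel_cantelli mA (fun n => proj2 (lE n)).
apply: filterS => w hw; apply/cvge0P => // e e0.
have [N _ hN] : \forall n \near \oo, (n.+1%:R^-1 : R) < e.
  exact: near_infty_natSinv_lt (PosNum e0).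
move: hw => [N' _ hN']; exists (maxn N N') => // n /=; rewrite geq_max => /andP[h1 h2].
have := hN' n h2; rewrite /= => /negP; rewrite -ltNge => /lt_trans; apply.
by rewrite lte_fin; exact: hN.
Qed.

Lemma ae_cvg0_probability (Y : nat -> T -> R) (G : set T) e : measurable G ->
  (forall n, measurable_fun setT (Y n)) -> 0 < e ->
  {ae P, forall w, G w -> Y n w @[n --> \oo] --> (0 : R)} ->
  P (G `&` [set w | e <= Y n w]) @[n --> \oo] --> 0%E.
Proof.
move=> mG mY e0 cY; pose A n := G `&` [set w | e <= Y n w].
have mA n : measurable (A n) by apply: measurableI => //; exact: measurable_ge_set.
have PA0 : P (lim_sup_set A) = 0%E.
  apply/eqP; rewrite eq_le measure_ge0 andbT.
  have [N [mN PN0 NY]] := cY.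
  rewrite -PN0 le_measure ?inE//.
    apply: bigcapT_measurable => n; exact: bigcup_measurable.
  move=> w Aw; apply: NY => /= cw.
  have Gw : G w by have [k _ []] := Aw 0 I.
  have /cvgrPdist_lt/(_ _ e0)[k _ hk] := cw Gw.
  have [j /= kj [_ /= ej]] := Aw k I.
  have := hk j kj; rewrite sub0r normrN => /(le_lt_trans (le_trans ej (ler_norm _))).
  by rewrite ltxx.
have c := lim_sup_set_cvg P A mA.
have {}c : P (\bigcup_(k >= n) A k) @[n --> \oo] --> 0%E.
  rewrite -PA0; apply: c; apply: (@le_lt_trans _ _ 1%E); last by rewrite ltry.
  by apply: probability_le1; exact: bigcup_measurable.
apply/cvge0P => // eps eps0.
have h : \forall n \near \oo, (P (\bigcup_(k >= n) A k) < eps%:E)%E.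
  by move/cvge0P : c; apply.
apply: filterS h => n; apply: le_lt_trans; apply: le_measure; rewrite ?inE//.
- exact: mA.
- exact: bigcup_measurable.
- by move=> w Aw; exists n => /=.
Qed.

End convergence_in_probability.

Section within_continuity.
Context {R : realType} {V : normedModType R}.
Implicit Types (A : set R) (y : R -> V).

Lemma within_eps A y : {within A, continuous y} -> forall s, A s -> forall e : R, 0 < e ->
  exists2 delta : R, 0 < delta & forall t, A t -> `|t - s| < delta -> `|y t - y s| < e.
Proof.
move=> /subspace_continuousP cy s As e e0.
have /cvgrPdist_lt/(_ _ e0) := cy s As.
rewrite near_withinE => /nbhs_ballP[delta /= d0 h].
exists delta => // t At ts; rewrite distrC; apply: h => //.
by rewrite /ball/= distrC.
Qed.

Lemma eps_within A y : (forall s, A s -> forall e : R, 0 < e ->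
  exists2 delta : R, 0 < delta & forall t, A t -> `|t - s| < delta -> `|y t - y s| < e) ->
  {within A, continuous y}.
Proof.
move=> h; apply/subspace_continuousP => s As.
apply/cvgrPdist_lt => e e0; have [delta d0 hd] := h s As e e0.
rewrite near_withinE; apply/nbhs_ballP; exists delta => // t.
by rewrite /ball/= distrC => ts At; rewrite distrC; exact: hd.
Qed.

(* Heine-Cantor *)
Lemma within_unif (a b : R) y : {within `[a, b], continuous y} ->
  forall e : R, 0 < e -> exists2 delta : R, 0 < delta &
    forall s t, s \in `[a, b] -> t \in `[a, b] -> `|t - s| < delta -> `|y t - y s| < e.
Proof.
move=> cy e e0.
have /compact_near_coveringP cov := @segment_compact R a b.
pose Q (delta s : R) := s \in `[a, b] ->
  forall t, t \in `[a, b] -> `|t - s| < delta -> `|y t - y s| < e.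
have : \forall delta \near 0^'+, `[a, b]%classic `<=` Q delta.
  apply: cov => s sab.
  have e20 : 0 < e / 2 by rewrite divr_gt0.
  have [delta d0 hd] := within_eps cy sab e20.
  have d20 : 0 < delta / 2 by rewrite divr_gt0.
  near=> s' delta' => /= s'ab t tab ts'.
  have h1 : `|s' - s| < delta / 2.
    by rewrite distrC; near: s'; exact: (@nbhsx_ballx _ _ s _ d20).
  have h2 : delta' < delta / 2 by near: delta'; exact: nbhs_right_lt.
  have ys' : `|y s' - y s| < e / 2.
    by apply: hd => //; rewrite (lt_trans h1)// ltr_pdivrMr// ltr_pMr// ltr1n.
  have yt : `|y t - y s| < e / 2.
    apply: hd => //; rewrite -(subrKA s') (le_lt_trans (ler_normD _ _))//.
    by rewrite [ltRHS](splitr delta) ltrD// (lt_trans ts').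
  rewrite -(subrKA (y s)) (le_lt_trans (ler_normD _ _))//.
  by rewrite [ltRHS](splitr e) ltrD// distrC.
move=> /nbhs_ballP[eps /= eps0 h].
have e20 : 0 < eps / 2 by rewrite divr_gt0.
exists (eps / 2) => // s t sab tab ts.
apply: (h (eps / 2)) => //=.
by rewrite /ball/= sub0r normrN gtr0_norm// ltr_pdivrMr// ltr_pMr// ltr1n.
Unshelve. all: by end_near. Qed.

Lemma within_sub A A' y : A' `<=` A -> {within A, continuous y} -> {within A', continuous y}.
Proof. by move=> AA' /(continuous_subspaceW AA'). Qed.

Lemma within_comp (W : topologicalType) A y (g : V -> W) :
  {within A, continuous y} -> continuous g -> {within A, continuous (g \o y)}.
Proof.
move=> cy cg s; exact: (@continuous_comp (subspace A) V W y g s (cy s) (cg (y s))).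
Qed.

End within_continuity.

Section norms.
Context {R : realType}.

Lemma ler_entry_norm (d m : nat) (M : 'M[R]_(d, m)) i j : `|M i j| <= `|M|.
Proof.
rewrite [leRHS]/Num.norm /= mx_normrE.
by apply/bigmax_geP; right => /=; exists (i, j).
Qed.

Lemma enorm_le_norm d (u : 'cV[R]_d) : enorm u <= d%:R * `|u|.
Proof.
rewrite -(@ler_pXn2r _ 2)// ?nnegrE ?enorm_ge0 ?mulr_ge0//.
rewrite sqr_enorm exprMn.
apply: (@le_trans _ _ (\sum_(i < d) `|u| ^+ 2)).
  apply: ler_sum => i _; rewrite -expr2 -(real_normK (num_real (u i 0))).
  by rewrite ler_pXn2r// ?nnegrE// ler_entry_norm.
rewrite sumr_const card_ord -[leLHS]mulr_natl ler_wpM2r ?sqr_ge0//.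
by rewrite -natrX ler_nat; case: (d) => // k; rewrite leq_pmulr.
Qed.

Lemma hsnorm_le_norm d m (M : 'M[R]_(d, m)) : hsnorm M <= (d * m)%:R * `|M|.
Proof.
rewrite -(@ler_pXn2r _ 2)// ?nnegrE ?hsnorm_ge0 ?mulr_ge0//.
rewrite sqr_hsnorm exprMn.
apply: (@le_trans _ _ (\sum_(i < d) \sum_(j < m) `|M| ^+ 2)).
  apply: ler_sum => i _; apply: ler_sum => j _.
  rewrite -(real_normK (num_real (M i j))).
  by rewrite ler_pXn2r// ?nnegrE// ler_entry_norm.
rewrite !sumr_const !card_ord -mulrnA -[leLHS]mulr_natl ler_wpM2r ?sqr_ge0// mulnC.
by rewrite -natrX ler_nat; case: (d * m)%N => // k; rewrite leq_pmulr.
Qed.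

Lemma ler_entry_enorm d (u : 'cV[R]_d) i : `|u i 0| <= enorm u.
Proof.
rewrite -(@ler_pXn2r _ 2)// ?nnegrE ?enorm_ge0//.
rewrite sqr_enorm real_normK ?num_real// /dot (bigD1 i)//= -expr2 lerDl.
by apply: sumr_ge0 => k _; rewrite -expr2 sqr_ge0.
Qed.

Lemma enormN d (u : 'cV[R]_d) : enorm (- u) = enorm u.
Proof. by rewrite -scaleN1r enormZ normrN normr1 mul1r. Qed.

End norms.

Section segments.
Context {R : realType} (r : {posnum R}) (d : nat).
Implicit Types (s t a c : R) (x y : R -> 'cV[R]_d).

Lemma segmentE x t (s : delay_itv r) : {within `[- r%:num, +oo[, continuous x} -> 0 <= t ->
  segment r x t s = x (t + \val s).
Proof.
move=> cx t0.
suff cs : (fun s : delay_itv r => x (t + \val s)) \in @continuous_pred R r d.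
  by rewrite /segment; have := insubdK (0 : Cseg r d) cs => /(congr1 (fun f => f s)).
rewrite inE/= => u; have hu (v : delay_itv r) : t + \val v \in `[- r%:num, +oo[.
  have := set_mem (svalP v); rewrite /delay_itv/= !in_itv/= andbT => /andP[h _].
  by rewrite (le_trans h)// lerDr.
apply/(@cvgrPdist_lt _ _ _ (nbhs u) (nbhs_filter u)) => e e0.
have [delta d0 hd] := within_eps cx (hu u) e0.
have cval : {for u, continuous (fun v : delay_itv r => \val v : R)}.
  exact: initial_continuous.
move/(@cvgrPdist_lt _ _ _ (nbhs u) (nbhs_filter u)) : cval => /(_ _ d0).
apply: (@filterS _ (nbhs u) (nbhs_filter u)) => v.
rewrite distrC => uv; rewrite distrC; apply: hd; first exact: hu.
by rewrite opprD addrACA subrr add0r.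
Qed.

Lemma delay_valP (s : delay_itv r) : - r%:num <= \val s <= 0.
Proof. by have := set_mem (svalP s); rewrite /delay_itv/= in_itv. Qed.

Lemma segment_normB x y t c : {within `[- r%:num, +oo[, continuous x} ->
  {within `[- r%:num, +oo[, continuous y} -> 0 <= t ->
  (forall s, t - r%:num <= s <= t -> enorm (x s - y s) <= c) ->
  `|segment r x t - segment r y t| <= c.
Proof.
move=> cx cy t0 h; apply: Cseg_norm_le => s.
rewrite [X in enorm X](_ : _ = segment r x t s - segment r y t s)//.
rewrite !segmentE//; apply: h; have /andP[s1 s2] := delay_valP s.
by rewrite lerD2l s1 gerDl.
Qed.

Lemma segment_norm x t c : {within `[- r%:num, +oo[, continuous x} -> 0 <= t ->
  (forall s, t - r%:num <= s <= t -> enorm (x s) <= c) -> `|segment r x t| <= c.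
Proof.
move=> cx t0 h; apply: Cseg_norm_le => s.
rewrite segmentE//; apply: h; have /andP[s1 s2] := delay_valP s.
by rewrite lerD2l s1 gerDl.
Qed.

Lemma segment_continuous x a : {within `[- r%:num, +oo[, continuous x} ->
  {within `[0, a], continuous (segment r x)}.
Proof.
move=> cx; apply: eps_within => s /=; rewrite in_itv/= => /andP[s0 sa] e e0.
have cx' : {within `[- r%:num, a], continuous x}.
  by apply: within_sub cx => u /=; rewrite !in_itv/= andbT => /andP[].
have e20 : 0 < e / (2 * (d%:R + 1)) by rewrite divr_gt0// mulr_gt0// ltr_wpDl.
have [delta d0 hd] := within_unif cx' e20.
exists delta => // t; rewrite /= in_itv/= => /andP[t0 ta] ts.
apply: (@le_lt_trans _ _ (e / 2)); last by rewrite ltr_pdivrMr// ltr_pMr// ltr1n.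
apply: Cseg_norm_le => u.
rewrite [X in enorm X](_ : _ = segment r x t u - segment r x s u)//.
rewrite !segmentE//; have /andP[u1 u2] := delay_valP u.
have h v : 0 <= v -> v <= a -> v + \val u \in `[- r%:num, a].
  move=> v0 va; rewrite in_itv/= (le_trans u1) ?lerDr//=.
  by rewrite (le_trans _ va)// gerDl.
have hlt : `|x (t + \val u) - x (s + \val u)| < e / (2 * (d%:R + 1)).
  by apply: hd; [exact: h|exact: h|rewrite opprD addrACA subrr addr0].
apply: le_trans (enorm_le_norm _) _.
apply: le_trans (ler_wpM2l (ler0n R d) (ltW hlt)) _.
have d1 : 0 < d%:R + 1 :> R by rewrite ltr_wpDl.
rewrite (_ : d%:R * _ = e / 2 * (d%:R / (d%:R + 1))); last by field; rewrite gt_eqF.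
rewrite ler_piMr ?divr_ge0 ?(ltW e0)// ler_pdivrMr// mul1r lerDl//.
Qed.

End segments.

Section grid_supremum.
Context {R : realType}.
Implicit Types (f : R -> R) (a b : R).

Definition supon f a b : R := sup [set f s | s in `[a, b]].

Definition gridpt a b (k i : nat) : R := a + (b - a) * i%:R / k.+1%:R.

Definition gridmax f a b k : R := \big[Num.max/f a]_(i < k.+2) f (gridpt a b k i).

Lemma gridpt_itv a b k i : a <= b -> (i <= k.+1)%N -> gridpt a b k i \in `[a, b].
Proof.
move=> ab ik; have i0 : 0 <= i%:R / k.+1%:R :> R by rewrite divr_ge0.
rewrite in_itv/= /gridpt lerDl -mulrA mulr_ge0 ?subr_ge0//=.
by rewrite -lerBrDl ler_piMr ?subr_ge0// ler_pdivrMr// mul1r ler_nat.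
Qed.

Lemma gridptS a b k i : gridpt a b k i.+1 - gridpt a b k i = (b - a) / k.+1%:R.
Proof. by rewrite /gridpt -natr1; field. Qed.

Lemma gridpt0 a b k : gridpt a b k 0 = a.
Proof. by rewrite /gridpt mulr0 mul0r addr0. Qed.

Lemma gridpt_last a b k : gridpt a b k k.+1 = b.
Proof. by rewrite /gridpt mulfK// addrC subrK. Qed.

(* Every point of [a, b] lies within one mesh width to the right of a grid point. *)
Lemma gridpt_cover a b k s : s \in `[a, b] ->
  exists2 i, (i <= k)%N & 0 <= s - gridpt a b k i <= (b - a) / k.+1%:R.
Proof.
rewrite in_itv/= le_eqVlt => /andP[/predU1P[<- ab|as_ sb]].
  by exists 0; rewrite // gridpt0 subrr lexx divr_ge0// subr_ge0.
have [|j jk /andP[j1 j2]] := @partition_cover R k.+1 (gridpt a b k) s.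
  by rewrite gridpt0 gridpt_last as_.
by exists j => //; rewrite subr_ge0 ltW//= -(gridptS a b k j) lerD2r.
Qed.

Section continuous_on.
Variables (f : R -> R) (a b : R).
Hypotheses (ab : a <= b) (cf : {within `[a, b], continuous f}).

Let has_sup_f : has_sup [set f s | s in `[a, b]].
Proof.
apply: compact_has_sup.
  by exists (f a), a => //=; rewrite in_itv/= lexx.
exact: continuous_compact cf (@segment_compact _ _ _).
Qed.

Lemma supon_ge s : s \in `[a, b] -> f s <= supon f a b.
Proof. by move=> sab; apply: ub_le_sup; [case: has_sup_f|exists s]. Qed.

Lemma supon_le c : (forall s, s \in `[a, b] -> f s <= c) -> supon f a b <= c.
Proof.
by move=> h; apply: sup_le_ub; [case: has_sup_f|move=> _ [s sab <-]; exact: h].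
Qed.

Lemma gridmax_le_supon k : gridmax f a b k <= supon f a b.
Proof.
apply/bigmax_leP; split; first by apply: supon_ge; rewrite in_itv/= lexx.
by move=> i _; apply: supon_ge; apply: gridpt_itv => //; rewrite -ltnS.
Qed.

Lemma gridmax_cvg : gridmax f a b k @[k --> \oo] --> supon f a b.
Proof.
apply/cvgrPdist_lt => e e0.
have e20 : 0 < e / 2 by rewrite divr_gt0.
have [_ [s sab <-] hs] := sup_adherent e20 has_sup_f.
have [delta d0 hd] := within_eps (cf : {within _, continuous (f : R -> R^o)}) sab e20.
have ba0 : 0 < b - a + 1 by rewrite ltr_wpDl ?subr_ge0.
have [K _ hK] : \forall k \near \oo, (k.+1%:R^-1 : R) < delta / (b - a + 1).
  by apply: (near_infty_natSinv_lt (PosNum _)); rewrite divr_gt0.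
exists K => // k /= Kk.
suff [i ik hi] : exists2 i, (i <= k.+1)%N & `|gridpt a b k i - s| < delta.
  have h1 := gridmax_le_supon k.
  have h2 : f (gridpt a b k i) <= gridmax f a b k.
    have ik' : (i < k.+2)%N by rewrite ltnS.
    by apply/bigmax_geP; right; exists (Ordinal ik').
  have := hd _ (gridpt_itv ab ik) hi; rewrite distrC ltr_norml => /andP[h3 h4].
  rewrite ger0_norm ?subr_ge0//; rewrite -/(supon f a b) in hs.
  move: hs h2 h3 h4 => /=.
  set A := f s; set C := f (gridpt _ _ _ _); set D := supon _ _ _; set E := gridmax _ _ _ _.
  by clearbody A C D E; lra.
have [i ik /andP[i1 i2]] := gridpt_cover k sab.
exists i; first exact: leqW.
rewrite distrC ger0_norm// (le_lt_trans i2)//.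
have := hK k Kk; rewrite ltr_pdivlMr// mulrC; apply: le_lt_trans.
by rewrite ler_wpM2r// lerDl.
Qed.

End continuous_on.
End grid_supremum.

Lemma adapted_cvg {R : realType} {dT : measure_display} {T : measurableType dT}
    (G : set_system T) (h : nat -> T -> R) (f : T -> R) :
  (forall n, adapted G (h n)) -> (forall w, h n w @[n --> \oo] --> f w) -> adapted G f.
Proof.
move=> ah hf.
by apply: (@measurable_fun_cvg _ (g_sigma_algebraType G) _ setT h f) => // w _; exact: hf.
Qed.

Section borel_functions.
Context {R : realType} {dT : measure_display} {T : measurableType dT}.
Variable G : set_system T.
Hypothesis sG : sigma_algebra setT G.

Definition borel_fun (V : topologicalType) (X : T -> V) : Prop :=
  forall psi : V -> R, continuous psi -> adapted G (psi \o X).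

Lemma borel_fun_cst (V : topologicalType) (v : V) : borel_fun (fun=> v).
Proof. by move=> psi _; exact: measurable_cst. Qed.

Lemma adapted_countable (I : countType) (N : T -> I) (Y : I -> T -> R) :
  (forall i, G (N @^-1` [set i])) -> (forall i, adapted G (Y i)) ->
  adapted G (fun w => Y (N w) w).
Proof.
move=> GN aY; apply/adaptedP => // U mU.
have [G0 GC GU] := sG.
have GI A B : G A -> G B -> G (A `&` B).
  rewrite -(measurable_g_measurableTypeE sG); exact: measurableI.
pose A n := if @unpickle I n is Some i then N @^-1` [set i] `&` Y i @^-1` U else set0.
rewrite (_ : _ @^-1` U = \bigcup_n A n).
  apply: GU => n; rewrite /A; case: unpickle => // i; apply: GI => //.
  by move: (aY i) => /adaptedP; apply.
apply/seteqP; split=> w /=.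
  by move=> Uw; exists (pickle (N w)) => //; rewrite /A pickleK.
by move=> [n _]; rewrite /A; case: unpickle => // i [/= -> ].
Qed.

Lemma borel_fun_addZ (V : normedModType R) (X : T -> V) (a : T -> R) (e : V) :
  borel_fun X -> adapted G a -> borel_fun (fun w => X w + a w *: e).
Proof.
move=> bX aa psi cpsi.
pose q n w : R := (Num.floor (a w * n.+1%:R))%:~R / n.+1%:R.
apply: (@adapted_cvg _ _ _ _ (fun n w => psi (X w + q n w *: e))).
  move=> n; pose N w := Num.floor (a w * n.+1%:R).
  apply: (@adapted_countable _ N (fun z w => psi (X w + (z%:~R / n.+1%:R) *: e))).
    move=> z; have am : adapted G (fun w => a w * n.+1%:R).
      by apply: measurable_funM => //; exact: measurable_cst.
    have -> : N @^-1` [set z] = (fun w => a w * n.+1%:R) @^-1` `[z%:~R, (z + 1)%:~R[%classic.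
      apply/seteqP; split => w /=; rewrite in_itv/=.
        by move=> <-; exact: floor_itv.
      by move=> h; apply: floor_def.
    by move/adaptedP : am; apply.
  move=> z; apply: (bX (fun v => psi (v + (z%:~R / n.+1%:R) *: e))).
  move=> v; apply: (@continuous_comp _ _ _ (fun v => v + (z%:~R / n.+1%:R) *: e) psi).
    apply: (@continuousD R V V id (cst ((z%:~R / n.+1%:R) *: e))); first exact: cvg_id.
    exact: cst_continuous.
  exact: cpsi.
move=> w; apply: (@cvg_comp _ _ _ (fun n => X w + q n w *: e) psi); last exact: cpsi.
apply: cvgD; first exact: cvg_cst.
apply: cvgZr_tmp.
apply/cvgrPdist_lt => eps eps0.
have [K _ hK] := near_infty_natSinv_lt (PosNum eps0).
exists K => // n /hK /=; apply: le_lt_trans.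
rewrite /q ger0_norm ?subr_ge0.
  rewrite lerBlDl -[X in _ <= _ + X]mul1r -mulrDl ler_pdivlMr//.
  by rewrite -(intrD _ _ 1) ltW// floorD1_gt.
by rewrite ler_pdivrMr// floor_le.
Qed.

Lemma borel_fun_sum (V : normedModType R) (I : Type) (s : seq I) (a : I -> T -> R) (e : I -> V) :
  (forall i, adapted G (a i)) -> borel_fun (fun w => \sum_(i <- s) a i w *: e i).
Proof.
move=> aa; elim: s => [|i s ih].
  by under eq_fun do rewrite big_nil; exact: borel_fun_cst.
under eq_fun do rewrite big_cons addrC.
exact: borel_fun_addZ.
Qed.

Lemma borel_fun_cvg (V : topologicalType) (Y : nat -> T -> V) (X : T -> V) :
  (forall n, borel_fun (Y n)) -> (forall w, Y n w @[n --> \oo] --> X w) -> borel_fun X.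
Proof.
move=> bY cY psi cpsi.
apply: (@adapted_cvg _ _ _ _ (fun n w => psi (Y n w))).
  by move=> n; exact: bY.
move=> w; apply: (@cvg_comp _ _ _ (Y ^~ w) psi); [exact: cY|exact: cpsi].
Qed.

End borel_functions.

Section hats.
Context {R : realType} (r : {posnum R}).

Definition clamp (x : R) : R := Num.min 1 (Num.max 0 x).

Lemma clamp_le x y : x <= y -> clamp x <= clamp y.
Proof.
by move=> xy; rewrite /clamp le_min ge_min lexx /= ge_min ge_max !le_max xy lexx !orbT.
Qed.

Lemma clamp0 x : x <= 0 -> clamp x = 0.
Proof. by move=> x0; rewrite /clamp (max_idPl x0) (min_idPr ler01). Qed.

Lemma clamp1 x : 1 <= x -> clamp x = 1.
Proof. by move=> x1; rewrite /clamp (min_idPl _)// le_max x1 orbT. Qed.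

Lemma clamp_continuous : continuous clamp.
Proof.
move=> x; apply: (@continuous_min _ _ (cst 1)); first exact: cst_continuous.
by apply: (@continuous_max _ _ (cst 0)); [exact: cst_continuous|exact: cvg_id].
Qed.

(* The piecewise linear bumps centred at the grid points of [-r, 0]. *)
Definition hat (k j : nat) (s : R) : R :=
  clamp ((s + r%:num) / r%:num * k.+1%:R - j%:R + 1) -
  clamp ((s + r%:num) / r%:num * k.+1%:R - j%:R).

Lemma hat_ge0 k j s : 0 <= hat k j s.
Proof. by rewrite subr_ge0 clamp_le// lerDl. Qed.

Lemma hat_sum1 k s : - r%:num <= s <= 0 -> \sum_(j < k.+2) hat k j s = 1.
Proof.
move=> /andP[s1 s2]; set z := (s + r%:num) / r%:num * k.+1%:R.
have z0 : 0 <= z by rewrite mulr_ge0// divr_ge0// -lerBlDr sub0r.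
have zk : z <= k.+1%:R by rewrite ler_piMl// ler_pdivrMr// mul1r gerDr.
pose c j := clamp (z - j%:R + 1).
transitivity (\sum_(0 <= j < k.+2) (c j - c j.+1)).
  rewrite big_mkord; apply: eq_bigr => j _; rewrite /hat -/z /c.
  by congr (_ - clamp _); rewrite -natr1; ring.
under eq_bigr do rewrite -opprB; rewrite sumrN telescope_sumr// opprB /c.
rewrite clamp1; last by rewrite subr0 lerDr.
by rewrite clamp0 ?subr0// -[k.+2%:R]natr1; lra.
Qed.

Lemma hat_near k j s : hat k j s != 0 -> `|s - gridpt (- r%:num) 0 k j| <= r%:num / k.+1%:R.
Proof.
set z := (s + r%:num) / r%:num * k.+1%:R => h.
have -> : s - gridpt (- r%:num) 0 k j = (z - j%:R) * (r%:num / k.+1%:R).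
  have K0 : k.+1%:R != 0 :> R by rewrite pnatr_eq0.
  rewrite /gridpt /z; move: K0; set K := k.+1%:R; clearbody K => K0.
  by field; rewrite K0 gt_eqF.
have rk : 0 <= r%:num / k.+1%:R by rewrite divr_ge0.
rewrite normrM (ger0_norm rk) ler_piMl// leNgt; apply: contra h.
rewrite /hat -/z ltr_normr => /orP[h|h].
  by rewrite !clamp1 ?subrr// ?ltW// ltr_wpDr// ltW.
by rewrite !clamp0 ?subrr//; lra.
Qed.

Lemma hat_continuous k j : continuous (hat k j).
Proof.
have c0 : continuous (fun s : R => (s + r%:num) / r%:num * k.+1%:R - j%:R : R).
  by move=> s; apply: cvgB; [apply: cvgMl; apply: cvgMl; apply: cvgD; [exact: cvg_id|exact: cvg_cst]|exact: cvg_cst].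
have c1 : continuous (fun s : R => (s + r%:num) / r%:num * k.+1%:R - j%:R + 1 : R).
  by move=> s; apply: cvgD; [exact: c0|exact: cvg_cst].
move=> s; apply: (@continuousB R R^o _ (fun s => clamp ((s + r%:num) / r%:num * k.+1%:R - j%:R + 1))).
  by apply: (@continuous_comp _ _ _ _ clamp); [exact: c1|exact: clamp_continuous].
by apply: (@continuous_comp _ _ _ _ clamp); [exact: c0|exact: clamp_continuous].
Qed.

End hats.

Section segment_interpolation.
Context {R : realType} (r : {posnum R}) (d : nat).

Lemma continuous_delay (q : R -> 'cV[R]_d) : continuous q ->
  (fun s : delay_itv r => q (\val s)) \in @continuous_pred R r d.
Proof.
move=> cq; rewrite inE/= => s.
apply: (@continuous_comp _ _ _ (fun s : delay_itv r => \val s : R) q); last exact: cq.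
exact: initial_continuous.
Qed.

Definition hatseg k j (c : 'I_d) : Cseg r d :=
  insubd 0 (fun s : delay_itv r => hat r k j (\val s) *: delta_mx c 0 : 'cV[R]_d).

Lemma hatsegE k j c s : hatseg k j c s = hat r k j (\val s) *: delta_mx c 0.
Proof.
have cq : (fun s : delay_itv r => hat r k j (\val s) *: delta_mx c 0 : 'cV[R]_d) \in
    @continuous_pred R r d.
  apply: (@continuous_delay (fun t => hat r k j t *: delta_mx c 0)) => t.
  by apply: cvgZr_tmp; exact: hat_continuous.
by have := insubdK (0 : Cseg r d) cq => /(congr1 (fun f => f s)).
Qed.

Lemma Cseg_sumE (I : Type) (l : seq I) (u : I -> Cseg r d) s :
  (\sum_(i <- l) u i : Cseg r d) s = \sum_(i <- l) u i s.
Proof. by elim/big_ind2 : _ => // f1 g1 f2 g2 <- <-. Qed.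

Definition interp (x : R -> 'cV[R]_d) t k : Cseg r d :=
  \sum_(p : 'I_k.+2 * 'I_d)
     x (t + gridpt (- r%:num) 0 k p.1) p.2 0 *: hatseg k p.1 p.2.

Lemma interpE x t k s : interp x t k s =
  \sum_(j < k.+2) hat r k j (\val s) *: x (t + gridpt (- r%:num) 0 k j).
Proof.
rewrite /interp Cseg_sumE.
rewrite -(pair_bigA _ (fun (j : 'I_k.+2) (c : 'I_d) =>
  (x (t + gridpt (- r%:num) 0 k j) c 0 *: hatseg k j c : Cseg r d) s)) /=.
apply: eq_bigr => j _; set v := x _.
apply/matrixP => i l; rewrite ord1 summxE mxE.
have key c : ((v c 0 *: hatseg k j c : Cseg r d) s) i 0 = v c 0 * hatseg k j c s i 0.
  by rewrite -[LHS]/((v c 0 *: (hatseg k j c s)) i 0) mxE.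
rewrite (bigD1 i)//= big1 ?addr0 => [|c ci].
  by rewrite key hatsegE !mxE !eqxx mulr1 mulrC.
by rewrite key hatsegE !mxE eq_sym (negbTE ci) !mulr0.
Qed.

Lemma interp_cvg x t : {within `[- r%:num, +oo[, continuous x} -> 0 <= t ->
  interp x t k @[k --> \oo] --> segment r x t.
Proof.
move=> cx t0; apply/cvgrPdist_le => e e0.
have cx' : {within `[- r%:num, t], continuous x}.
  by apply: within_sub cx => u /=; rewrite !in_itv/= andbT => /andP[].
have e1 : 0 < e / (d%:R + 1) by rewrite divr_gt0// ltr_wpDl.
have [delta d0 hd] := within_unif cx' e1.
have [K _ hK] : \forall k \near \oo, (k.+1%:R^-1 : R) < delta / r%:num.
  by apply: (near_infty_natSinv_lt (PosNum _)); rewrite divr_gt0.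
exists K => // k /= Kk; apply: Cseg_norm_le => s.
rewrite [X in enorm X](_ : _ = segment r x t s - interp x t k s)// segmentE// interpE.
have sI := delay_valP s; have /andP[s1 s2] := sI.
rewrite -[x (t + \val s)]scale1r -(hat_sum1 k sI) scaler_suml -sumrB.
apply: (@le_trans _ _ (\sum_(j < k.+2) hat r k j (\val s) * e)).
  have le_sum (l : seq 'I_k.+2) (u : 'I_k.+2 -> 'cV[R]_d) : enorm (\sum_(j <- l) u j) <= \sum_(j <- l) enorm (u j).
    elim: l => [|j l ih]; first by rewrite !big_nil -(scale0r 0) enormZ normr0 mul0r.
    by rewrite !big_cons (le_trans (ler_enormD _ _))// lerD2l.
  apply: le_trans (le_sum _ _) _; apply: ler_sum => j _.
  rewrite -scalerBr enormZ ger0_norm ?hat_ge0//.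
  have [->|h0] := eqVneq (hat r k j (\val s)) 0; first by rewrite !mul0r.
  rewrite ler_wpM2l ?hat_ge0//.
  have hs := hat_near h0.
  have hj : gridpt (- r%:num) 0 k j \in `[- r%:num, 0] by rewrite gridpt_itv ?oppr_le0// -ltnS.
  have it v : v \in `[- r%:num, 0] -> t + v \in `[- r%:num, t].
    by rewrite !in_itv/= => /andP[v1 v2]; rewrite gerDl v2 (le_trans v1) ?lerDr.
  have : `|x (t + \val s) - x (t + gridpt (- r%:num) 0 k j)| < e / (d%:R + 1).
    apply: hd; [exact: it|by apply: it; rewrite in_itv/= s1|].
    rewrite opprD addrACA subrr add0r (le_lt_trans hs)//.
    by have := hK k Kk; rewrite ltr_pdivlMr// mulrC.
  move=> /ltW/(ler_wpM2l (ler0n R d)) => h.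
  apply: le_trans (enorm_le_norm _) _; apply: le_trans h _.
  have d1 : 0 < d%:R + 1 :> R by rewrite ltr_wpDl.
  by rewrite mulrCA ler_piMr ?(ltW e0)// ler_pdivrMr// mul1r lerDl.
by rewrite -mulr_suml hat_sum1// mul1r.
Qed.

End segment_interpolation.

Section adapted_paths.
Context {R : realType} {dT : measure_display} {T : measurableType dT}.
Variables (F : R -> set_system T) (r : {posnum R}) (d : nat).
Hypothesis HF : is_filtration F.
Implicit Types x : R -> T -> 'cV[R]_d.

Record adapted_path x : Prop := {
  ap_continuous : forall w, {within `[- r%:num, +oo[, continuous (x ^~ w)} ;
  ap_adapted : forall u t, - r%:num <= u <= t -> 0 <= t ->
    forall i, adapted (F t) (fun w => x u w i 0) }.

Lemma Cseg_entry_continuous (s : delay_itv r) i :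
  continuous (fun u : Cseg r d => u s i 0).
Proof.
move=> u; apply/(@cvgrPdist_le _ _ _ (nbhs u) (nbhs_filter u)) => e e0.
have : (id : Cseg r d -> Cseg r d) @ u --> u by exact: cvg_id.
move=> /(@cvgrPdist_le _ _ _ (nbhs u) (nbhs_filter u))/(_ _ e0).
apply: (@filterS _ (nbhs u) (nbhs_filter u)) => v; apply: le_trans.
have -> : u s i 0 - v s i 0 = (u - v) s i 0.
  by rewrite -[RHS]/((u s - v s) i 0) !mxE.
by apply: le_trans (ler_entry_enorm _ _) _; exact: enorm_le_Cseg_norm.
Qed.

Lemma segment_borel x (t : R) : adapted_path x -> 0 <= t ->
  borel_fun (R := R) (F t) (fun w => segment r (x ^~ w) t).
Proof.
move=> ax t0; apply: (@borel_fun_cvg _ _ _ _ _ (fun k w => interp r (x ^~ w) t k)).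
  move=> k; apply: borel_fun_sum; first exact: (filtration_sigma_algebra HF).
  move=> -[j c]; apply: (ap_adapted ax) => //=.
  have : gridpt (- r%:num) 0 k j \in `[- r%:num, 0] by rewrite gridpt_itv ?oppr_le0// -ltnS.
  by rewrite !in_itv/= => /andP[v1 v2]; rewrite gerDl v2 (le_trans v1) ?lerDr.
by move=> w; apply: interp_cvg => //; exact: ap_continuous.
Qed.

Lemma adapted_bigmax (G : set_system T) (I : Type) (l : seq I) (y0 : T -> R) (y : I -> T -> R) :
  adapted G y0 -> (forall i, adapted G (y i)) ->
  adapted G (fun w => \big[Num.max/y0 w]_(i <- l) y i w).
Proof.
move=> ay0 ay; elim: l => [|i l ih]; first by under eq_fun do rewrite big_nil.
by under eq_fun do rewrite big_cons; exact: (measurable_maxr (ay i) ih).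
Qed.

Lemma supon_adapted (G : set_system T) (y : R -> T -> R) a b : a <= b ->
  (forall w, {within `[a, b], continuous (y ^~ w)}) ->
  (forall u, u \in `[a, b] -> adapted G (y u)) ->
  adapted G (fun w => supon (y ^~ w) a b).
Proof.
move=> ab cy ay; apply: (@adapted_cvg _ _ _ _ (fun k w => gridmax (y ^~ w) a b k)).
  move=> k; apply: adapted_bigmax => [|i]; first by apply: ay; rewrite in_itv/= lexx.
  by apply: ay; apply: gridpt_itv => //; rewrite -ltnS.
by move=> w; apply: gridmax_cvg.
Qed.

Lemma solution_adapted_path (P : probability T R) (m : nat) (B : R -> T -> 'cV[R]_m)
  (f : 'cV[R]_d -> 'cV[R]_d) (g : Cseg r d -> 'cV[R]_d) (h : Cseg r d -> 'M[R]_(d, m))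
  (phi : Cseg r d) x : is_solution P F B f g h phi x -> adapted_path x.
Proof.
case=> cx m0 ax _ _; split => // u t /andP[u0 ut] t0 i.
have [u1|u1] := leP 0 u.
  apply: adapted_sub (filtration_le HF u1 ut) _.
  apply: (@measurable_wrt_continuous _ _ _ _ _ (x u) (fun v => v i 0)); first exact: ax.
  exact: coord_continuous.
have sI : u \in delay_itv r by rewrite inE /delay_itv/= in_itv/= u0 ltW.
apply: adapted_sub (filtration_le HF (lexx _) t0) _.
have := measurable_wrt_continuous m0 (@Cseg_entry_continuous (exist _ u sI) i).
rewrite [X in adapted _ X](_ : _ = (fun w => x u w i 0))//.
by apply/funext => w; rewrite /= segmentE//= add0r.
Qed.

End adapted_paths.

Lemma cvg_sumr {R : realType} (I : Type) (l : seq I) (u : I -> nat -> R) (v : I -> R) :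
  (forall i, u i n @[n --> \oo] --> v i) ->
  \sum_(i <- l) u i n @[n --> \oo] --> \sum_(i <- l) v i.
Proof.
move=> uv; elim: l => [|i l ih].
  by rewrite big_nil; under eq_fun do rewrite big_nil; exact: cvg_cst.
by rewrite big_cons; under eq_fun do rewrite big_cons; exact: cvgD.
Qed.

Lemma cvg_hsnorm2 {R : realType} d m (u : nat -> 'M[R]_(d, m)) (v : 'M[R]_(d, m)) :
  (forall i j, u n i j @[n --> \oo] --> v i j) ->
  hsnorm (u n) ^+ 2 @[n --> \oo] --> hsnorm v ^+ 2.
Proof.
move=> uv; under eq_fun do rewrite sqr_hsnorm; rewrite sqr_hsnorm.
apply: cvg_sumr => i; apply: cvg_sumr => j.
by rewrite expr2; under eq_fun do rewrite expr2; exact: (cvgM (uv i j) (uv i j)).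
Qed.

Section grid_steps.
Context {R : realType} {dT : measure_display} {T : measurableType dT}.
Variables (P : probability T R) (F : R -> set_system T) (d m : nat).
Variable B : R -> T -> 'cV[R]_m.
Hypotheses (HF : is_filtration F) (HB : is_brownian P F B).
Variable H : R -> T -> 'M[R]_(d, m).
Hypothesis aH : forall t, 0 <= t -> forall i b, adapted (F t) (fun w => H t w i b).
Variable a : R.
Hypothesis a0 : 0 < a.
Hypothesis cH : forall w, {within `[0, a], continuous (H ^~ w)}.

Definition grid_step n : @simple_process R dT T d m :=
  SimpleProcess n.+1 (gridpt 0 a n) (fun j w => H (gridpt 0 a n j) w).

Lemma gridpt_partition n : partition n.+1 (gridpt 0 a n).
Proof.
apply: partition_step => j _.
by rewrite -subr_gt0 gridptS subr0 divr_gt0.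
Qed.

Lemma grid_adapted n : adapted_step F a (grid_step n).
Proof.
split => /=; [exact: gridpt0|exact: gridpt_last|exact: gridpt_partition|].
move=> j jn i b; apply: aH.
by have := gridpt_itv (ltW a0) (ltnW jn); rewrite in_itv/= => /andP[].
Qed.

(* On (0, a] the grid processes converge to H uniformly, for each path. *)
Lemma grid_value_near w (e : R) : 0 < e ->
  \forall n \near \oo, forall s, 0 < s <= a -> hsnorm (sp_value (grid_step n) s w - H s w) < e.
Proof.
move=> e0.
have e1 : 0 < e / ((d * m)%:R + 1) by rewrite divr_gt0// ltr_wpDl.
have [delta d0 hd] := within_unif (@cH w) e1.
have [K _ hK] : \forall k \near \oo, (k.+1%:R^-1 : R) < delta / a.
  by apply: (near_infty_natSinv_lt (PosNum _)); rewrite divr_gt0.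
exists K => // n /= Kn s sa.
have [|j jn sj] := @partition_cover R n.+1 (gridpt 0 a n) s.
  by rewrite gridpt0 gridpt_last.
rewrite (@sp_valueE _ _ _ _ _ (grid_step n) (Ordinal jn) s w (@gridpt_partition n) sj) /=.
apply: le_lt_trans (hsnorm_le_norm _) _.
have h : `|H (gridpt 0 a n j) w - H s w| < e / ((d * m)%:R + 1).
  apply: hd.
  - by rewrite in_itv/=; case/andP: sa => /ltW -> ->.
  - exact: gridpt_itv (ltW a0) (ltnW jn).
  - case/andP: sj => s1 s2; rewrite distrC gtr0_norm ?subr_gt0//.
    apply: (@le_lt_trans _ _ (a / n.+1%:R)).
      by rewrite -[X in X / _]subr0 -(gridptS 0 a n j) lerD2r.
    by have := hK n Kn; rewrite ltr_pdivlMr// mulrC.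
apply: le_lt_trans (ler_wpM2l (ler0n R (d * m)) (ltW h)) _.
have d1 : 0 < (d * m)%:R + 1 :> R by rewrite ltr_wpDl.
by rewrite mulrCA gtr_pMr// ltr_pdivrMr// mul1r ltrDl.
Qed.

Lemma measurable_hsnorm2 (D : set R) (M : R -> 'M[R]_(d, m)) :
  (forall i b, measurable_fun D (fun s => M s i b)) ->
  measurable_fun D (fun s => hsnorm (M s) ^+ 2).
Proof.
move=> mM; under eq_fun do rewrite sqr_hsnorm.
by apply: measurable_sum => i; apply: measurable_sum => b; apply: measurable_funX.
Qed.

Lemma sp_value_measurable (S : @simple_process R dT T d m) w i b :
  measurable_fun setT (fun s => sp_value S s w i b).
Proof.
have E s : sp_value S s w i b = \sum_(j < sp_size S) sp_coef S j w i b *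
    \1_(`]sp_time S j, sp_time S j.+1]%classic) s.
  rewrite /sp_value summxE [RHS](bigID (fun j : 'I_(sp_size S) => sp_time S j < s <= sp_time S j.+1))/=.
  rewrite [X in _ + X]big1 ?addr0.
    by apply: eq_bigr => j js; rewrite indicE mem_set ?mulr1//= in_itv.
  by move=> j js; rewrite indicE memNset ?mulr0//= in_itv/=; exact/negP.
under eq_fun do rewrite E.
by apply: measurable_sum => j; apply: measurable_funM => //; exact: measurable_indic.
Qed.

Lemma path_measurable w i b : measurable_fun `[0, a] (fun s => H s w i b).
Proof.
apply: subspace_continuous_measurable_fun => //.
exact: (within_comp (@cH w) (@coord_continuous _ _ _ i b)).
Qed.

Local Notation mu := (@lebesgue_measure R).

Lemma step_step_measurable (D : set R) (S S' : @simple_process R dT T d m) w : measurable D ->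
  measurable_fun D (fun s => (hsnorm (sp_value S s w - sp_value S' s w) ^+ 2)%:E).
Proof.
move=> mD; apply/measurable_EFinP; apply: measurable_hsnorm2 => i b.
rewrite (_ : (fun s => _) = (fun s => sp_value S s w i b - sp_value S' s w i b)); last first.
  by apply/funext => s; rewrite !mxE.
by apply: measurable_funB; apply: measurable_funTS => //; exact: sp_value_measurable.
Qed.

Lemma step_path_measurable (S : @simple_process R dT T d m) w :
  measurable_fun `[0, a] (fun s => (hsnorm (sp_value S s w - H s w) ^+ 2)%:E).
Proof.
apply/measurable_EFinP; apply: measurable_hsnorm2 => i b.
rewrite (_ : (fun s => _) = (fun s => sp_value S s w i b - H s w i b)); last first.
  by apply/funext => s; rewrite !mxE.
apply: measurable_funB; last exact: path_measurable.
by apply: measurable_funTS => //; exact: sp_value_measurable.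
Qed.

Lemma itv_oc_cc : `]0, a]%classic `<=` `[0, a]%classic.
Proof. by move=> s /=; rewrite !in_itv/= => /andP[/ltW -> ->]. Qed.

Lemma step_path_measurable_oc (S : @simple_process R dT T d m) w :
  measurable_fun `]0, a] (fun s => (hsnorm (sp_value S s w - H s w) ^+ 2)%:E).
Proof.
exact: (measurable_funS (measurable_itv _) itv_oc_cc (@step_path_measurable S w)).
Qed.

Definition L2dist (S : @simple_process R dT T d m) (w : T) : \bar R :=
  (\int[mu]_(s in `[0%R, a]) (hsnorm (sp_value S s w - H s w)%R ^+ 2)%:E)%E.

Lemma hsnorm_path_bounded w : exists M : R, forall s, s \in `[0, a] -> hsnorm (H s w) ^+ 2 <= M.
Proof.
have cN : {within `[0, a], continuous (fun s => `|H s w| : R)}.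
  have cn : continuous (fun M : 'M[R]_(d, m) => `|M| : R) by exact: norm_continuous.
  exact: (within_comp (@cH w) cn).
exists (((d * m)%:R * supon (fun s => `|H s w|) 0 a) ^+ 2) => s sa.
have := supon_ge (ltW a0) cN sa.
move=> /(ler_wpM2l (ler0n R (d * m))) /(le_trans (hsnorm_le_norm _)) h.
by rewrite ler_pXn2r// nnegrE ?hsnorm_ge0// (le_trans (hsnorm_ge0 _) h).
Qed.

Lemma sp_value_bounded (S : @simple_process R dT T d m) w : adapted_step F a S ->
  forall s, hsnorm (sp_value S s w) ^+ 2 <= \sum_(j < sp_size S) hsnorm (sp_coef S j w) ^+ 2.
Proof.
move=> aS s; rewrite (sp_value_sqr _ _ (as_partition aS)); apply: ler_sum => j _.
by rewrite ler_piMr ?sqr_ge0// indicE; case: (_ \in _).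
Qed.

Lemma qv_cvg_L2dist (S : @simple_process R dT T d m) w : adapted_step F a S ->
  (sp_qv (sp_sub S (grid_step n)) w)%:E @[n --> \oo] --> L2dist S w.
Proof.
move=> aS; rewrite /L2dist -integral_itv_obnd_cbnd; last exact: step_path_measurable_oc.
rewrite [X in X @ \oo --> _](_ : _ = fun n => (\int[mu]_(s in `]0%R, a])
  (hsnorm (sp_value S s w - sp_value (grid_step n) s w)%R ^+ 2)%:E)%E); last first.
  apply/funext => n; rewrite -(sp_qv_sub HF aS (grid_adapted n)).
  by rewrite integral_itv_obnd_cbnd//; apply: step_step_measurable.
have [M hM] := hsnorm_path_bounded w.
pose C := 2 * \sum_(j < sp_size S) hsnorm (sp_coef S j w) ^+ 2 + 2 * M.
apply: (@dominated_cvg _ _ _ mu _ _ _ _ (fun=> C%:E)) => //.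
- by move=> n; apply: step_step_measurable.
- move=> s; rewrite /= in_itv/= => sa; apply: cvg_EFin; first exact: nearW.
  apply: cvg_hsnorm2 => i b; under eq_fun do rewrite !mxE; rewrite !mxE.
  apply: cvgB; first exact: cvg_cst.
  apply/cvgrPdist_lt => e e0; have := grid_value_near w e0.
  apply: filterS => n /(_ s sa); apply: le_lt_trans.
  rewrite distrC -(@ler_pXn2r _ 2)// ?nnegrE ?hsnorm_ge0// real_normK ?num_real//.
  have := sqr_entry_le (sp_value (grid_step n) s w - H s w) i b.
  by rewrite !mxE.
- apply/integrableP; split; first exact: measurable_cst.
  rewrite /= integral_cst//= lebesgue_measure_itv/= lte_fin a0.
  by rewrite -EFinB -EFinM ltry.
- move=> n s; rewrite /= in_itv/= => /andP[s0 sa].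
  rewrite lee_fin ger0_norm ?sqr_ge0//.
  have := sqr_hsnormB_le (sp_value S s w) (sp_value (grid_step n) s w) 0.
  rewrite subr0 sub0r -scaleN1r sqr_hsnormZ sqrrN expr1n mul1r => /le_trans; apply.
  apply: lerD; rewrite ler_pM2l//; first exact: sp_value_bounded.
  have [|j jn sj] := @partition_cover R n.+1 (gridpt 0 a n) s.
    by rewrite gridpt0 gridpt_last s0.
  rewrite (@sp_valueE _ _ _ _ _ (grid_step n) (Ordinal jn) s w (@gridpt_partition n) sj) /=.
  by apply: hM; apply: gridpt_itv; [exact: ltW|exact: ltnW].
Qed.

Lemma L2dist_measurable (S : @simple_process R dT T d m) : adapted_step F a S ->
  measurable_fun setT (L2dist S).
Proof.
move=> aS; apply: (emeasurable_fun_cvg (fun n w => (sp_qv (sp_sub S (grid_step n)) w)%:E)).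
  move=> n; apply/measurable_EFinP.
  exact: (sp_qv_measurable HF (sp_sub_adapted HF aS (grid_adapted n))).
by move=> w _; exact: qv_cvg_L2dist.
Qed.

(* Compare both steps with H: if the L2 distances of S_n to H tend to 0, so do
   the quadratic variations of the differences with the grid processes. *)
Lemma qv_sub_cvg0 (S : nat -> @simple_process R dT T d m) w :
  (forall n, adapted_step F a (S n)) -> L2dist (S n) w @[n --> \oo] --> 0%E ->
  sp_qv (sp_sub (S n) (grid_step n)) w @[n --> \oo] --> (0 : R).
Proof.
move=> aS /cvge0P cS.
have L0 n : (0 <= L2dist (S n) w)%E by apply: integral_ge0 => s _; rewrite lee_fin sqr_ge0.
apply/cvgrPdist_lt => e e0.
have e1 : 0 < e / 4 by rewrite divr_gt0.
have e3 : 0 <= e / (4 * a) by rewrite divr_ge0 ?mulr_ge0// ltW.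
have e2 : 0 < Num.sqrt (e / (4 * a)) by rewrite sqrtr_gt0 divr_gt0// mulr_gt0.
have := cS L0 _ e1; have := grid_value_near w e2; apply: filterS2 => n hg hL.
have aD := sp_sub_adapted HF (aS n) (grid_adapted n).
rewrite sub0r normrN ger0_norm ?(sp_qv_ge0 _ aD)//.
rewrite -lte_fin -(sp_qv_sub HF (aS n) (grid_adapted n)).
have /measurable_EFinP mSH := @step_path_measurable (S n) w.
apply: (@le_lt_trans _ _ (\int[mu]_(s in `[0%R, a])
   ((2 * hsnorm (sp_value (S n) s w - H s w)%R ^+ 2)%R%:E + (2 * (e / (4 * a)))%R%:E))%E).
  have mR : measurable_fun `]0, a] (fun s => ((2 * hsnorm (sp_value (S n) s w - H s w)%R ^+ 2)%R%:E + (2 * (e / (4 * a)))%R%:E)%E).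
    apply/measurable_EFinP; apply: measurable_funD => //.
    apply: measurable_funM => //.
    exact: (measurable_funS (measurable_itv _) itv_oc_cc mSH).
  rewrite -integral_itv_obnd_cbnd; last by apply: step_step_measurable.
  rewrite -[leRHS]integral_itv_obnd_cbnd//.
  apply: ge0_le_integral => //.
  - by move=> s _; rewrite lee_fin sqr_ge0.
  - by apply: step_step_measurable.
  - move=> s; rewrite /= in_itv/= => sa; rewrite -EFinD lee_fin.
    apply: le_trans (sqr_hsnormB_le _ _ (H s w)) _.
    rewrite lerD2l ler_pM2l// -(sqr_sqrtr e3).
    rewrite -[X in hsnorm X]opprB -scaleN1r sqr_hsnormZ sqrrN expr1n mul1r.
    by rewrite ler_pXn2r ?nnegrE ?hsnorm_ge0 ?sqrtr_ge0//; exact/ltW/hg.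
rewrite ge0_integralD//; last 3 first.
- by move=> s _; rewrite lee_fin mulr_ge0 ?sqr_ge0.
- by apply/measurable_EFinP; apply: measurable_funM.
- by move=> s _; rewrite lee_fin mulr_ge0.
rewrite integral_cst//= lebesgue_measure_itv/= lte_fin a0 oppr0 adde0.
under eq_integral do rewrite EFinM.
rewrite ge0_integralZl//; last 2 first.
- exact/measurable_EFinP.
- by move=> s _; rewrite lee_fin sqr_ge0.
rewrite -/(L2dist (S n) w).
have -> : (e%:E = (2 * (e / 4))%:E + (2 * (e / (4 * a)))%:E * a%:E)%E.
  by rewrite -EFinM -EFinD; congr (_%:E); field; rewrite gt_eqF.
by rewrite lteD2rE// EFinM lte_pmul2l.
Qed.

Lemma ito_grid (I : T -> 'cV[R]_d) : is_ito_integral P F B H a I ->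
  forall e : R, 0 < e ->
  P [set w | e <= enorm (sp_integral B (grid_step n) w - I w)] @[n --> \oo] --> 0%E.
Proof.
case=> mI [S [sS cJ cI]] e e0.
have aS n : adapted_step F a (S n) by exact: simple_adapted_step.
have L0 n w : (0 <= L2dist (S n) w)%E by apply: integral_ge0 => s _; rewrite lee_fin sqr_ge0.
have [l [ln cl]] := cvg0_probability_subseq (fun n => L2dist_measurable (aS n)) L0 cJ.
pose Q n := sp_qv (sp_sub (S (l n)) (grid_step n)).
have aD n := sp_sub_adapted HF (aS (l n)) (grid_adapted n).
have cQ : {ae P, forall w, setT w -> Q n w @[n --> \oo] --> (0 : R)}.
  by apply: filterS cl => w cw _; apply: qv_sub_cvg0 => // n; exact: aS.
have mQ n : measurable_fun setT (Q n) := sp_qv_measurable HF (aD n).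
have mIi i : measurable_fun setT (fun w => I w i 0).
  apply: (@adapted_measurable _ _ _ measurable) => //.
  apply: (@measurable_wrt_continuous _ _ _ _ _ I (fun v => v i 0) mI).
  exact: coord_continuous.
have mE (Y : T -> 'cV[R]_d) c : (forall i, measurable_fun setT (fun w => Y w i 0)) ->
    0 <= c -> measurable [set w | c <= enorm (Y w)].
  move=> mY c0; rewrite (_ : [set w | _] = [set w | c ^+ 2 <= enorm (Y w) ^+ 2]).
    apply: measurable_ge_set; under eq_fun do rewrite sqr_enorm.
    by apply: measurable_sum => i; apply: measurable_funM; exact: mY.
  by apply/seteqP; split => w /=; rewrite ler_pXn2r// nnegrE enorm_ge0.
have mB (Y Z : T -> 'cV[R]_d) : (forall i, measurable_fun setT (fun w => Y w i 0)) ->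
   (forall i, measurable_fun setT (fun w => Z w i 0)) ->
   forall i, measurable_fun setT (fun w => (Y w - Z w) i 0).
  move=> mY mZ i; rewrite (_ : (fun w => _) = (fun w => Y w i 0 - Z w i 0)).
    exact: measurable_funB.
  by apply/funext => w; rewrite !mxE.
have mS n i : measurable_fun setT (fun w => sp_integral B (S (l n)) w i 0).
  exact: (as_measurable HF HB _ (aS (l n))).
have mG n i : measurable_fun setT (fun w => sp_integral B (grid_step n) w i 0).
  exact: (as_measurable HF HB _ (grid_adapted n)).
have e20 : 0 < e / 2 by rewrite divr_gt0.
apply/cvge0P => // eps eps0.
pose delta := eps / 4 * (e / 2) ^+ 2 / (33 * m%:R + 1).
have C0 : 0 < 33 * m%:R + 1 :> R by rewrite ltr_wpDl// mulr_ge0.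
have delta0 : 0 < delta by rewrite !(divr_gt0, mulr_gt0, exprn_gt0).
have h1 : \forall n \near \oo, (P (setT `&` [set w | (delta <= Q n w)%R]) < (eps / 4)%:E)%E.
  have /cvge0P := ae_cvg0_probability measurableT mQ delta0 cQ.
  by apply => //; rewrite divr_gt0.
have h2 : \forall n \near \oo,
    (P [set w | (e / 2 <= enorm (sp_integral B (S (l n)) w - I w))%R] < (eps / 4)%:E)%E.
  have /cvge0P : P [set w | ((e / 2)%:E <= (enorm (sp_integral B (S k) w - I w))%:E)%E] @[k --> \oo] --> 0%E.
    exact: cI.
  move=> /(_ (fun=> measure_ge0 _ _) (eps / 4)) [|N _ hN]; first by rewrite divr_gt0.
  by exists N => // n /= Nn; have := hN (l n) (leq_trans Nn (ln n)).
near=> n.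
have hQ : (P (setT `&` [set w | (e / 2 <= enorm (sp_integral B (sp_sub (S (l n)) (grid_step n)) w))%R])
    < (eps / 4)%:E + (eps / 4)%:E)%E.
  apply: le_lt_trans (lenglart HF HB (aD n) measurableT e20 delta0) _.
  apply: lte_leD => //; first by near: n.
  rewrite lee_fin /delta ler_pdivrMr ?exprn_gt0//.
  rewrite mulrA ler_pdivrMr// mulrC ler_wpM2l//.
    by rewrite mulr_ge0 ?exprn_ge0 ?divr_ge0 ?ltW.
  by rewrite lerDl.
apply: (@le_lt_trans _ _ (P ((setT `&` [set w | (e / 2 <= enorm (sp_integral B (sp_sub (S (l n)) (grid_step n)) w))%R])
   `|` [set w | (e / 2 <= enorm (sp_integral B (S (l n)) w - I w))%R]))).
  apply: le_measure; rewrite ?inE.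
  - by apply: mE; [exact: mB|exact: ltW].
  - apply: measurableU.
      by rewrite setTI; apply: mE; [move=> i; exact: (as_measurable HF HB _ (aD n))|exact: ltW].
    by apply: mE; [exact: mB|exact: ltW].
  - move=> w /= ew.
    have [h|h] := leP (e / 2) (enorm (sp_integral B (S (l n)) w - I w)); [by right|left; split=> //].
    rewrite (sp_integral_sub _ (aS (l n)) (grid_adapted n)).
    rewrite -enormN opprB leNgt; apply/negP => h'.
    have := ler_enormD (sp_integral B (grid_step n) w - sp_integral B (S (l n)) w)
      (sp_integral B (S (l n)) w - I w).
    by rewrite addrA subrK; lra.
apply: le_lt_trans (measureU2 _ _ _) _.
- by rewrite setTI; apply: mE; [move=> i; exact: (as_measurable HF HB _ (aD n))|exact: ltW].
- by apply: mE; [exact: mB|exact: ltW].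
apply: (@lt_le_trans _ _ ((eps / 4)%:E + (eps / 4)%:E + (eps / 4)%:E)%E).
  by apply: lteD => //; near: n.
by rewrite -!EFinD lee_fin; lra.
Unshelve. all: by end_near. Qed.

End grid_steps.

Section fine_grid_energy.
Context {R : realType} {dT : measure_display} {T : measurableType dT}.
Variables (P : probability T R) (F : R -> set_system T) (d m : nat).
Variable B : R -> T -> 'cV[R]_m.
Hypotheses (HF : is_filtration F) (HB : is_brownian P F B).
Local Notation Ex X := (\int[P]_w (X w)).

Lemma sqint_bounded2 (X : T -> R) M : measurable_fun setT X ->
  (forall w, X w ^+ 2 <= M) -> sqint P X.
Proof.
move=> mX XM; split=> //; apply: (@rint_bounded _ _ _ _ _ M); first exact: measurable_funX.
by move=> w; rewrite ger0_norm ?sqr_ge0.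
Qed.

Lemma sqr_enormD (a b : 'cV[R]_d) :
  enorm (a + b) ^+ 2 = enorm a ^+ 2 + 2 * dot a b + enorm b ^+ 2.
Proof. by rewrite !sqr_enorm dotDl (dotC a (a + b)) (dotC b (a + b)) !dotDl (dotC b a); ring. Qed.

Lemma sqr_enormD_le (a b : 'cV[R]_d) :
  enorm (a + b) ^+ 2 <= 2 * enorm a ^+ 2 + 2 * enorm b ^+ 2.
Proof.
have := sqr_ge0 (enorm (a + (-1) *: b)).
by rewrite !sqr_enormD enormZ normrN normr1 mul1r (dotC a) dotZl (dotC b); lra.
Qed.

Lemma sqr_row_mul_le (z : 'I_d -> R) (M : 'M[R]_(d, m)) :
  \sum_b (\sum_i z i * M i b) ^+ 2 <= (\sum_i z i ^+ 2) * hsnorm M ^+ 2.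
Proof.
rewrite sqr_hsnorm exchange_big/= mulr_sumr; apply: ler_sum => b _.
exact: sqr_sum_mul_le.
Qed.

Variables (H : R -> T -> 'M[R]_(d, m)) (Z : R -> T -> 'cV[R]_d) (W : R -> T -> R).
Variables (L M t : R).
Hypothesis aH : forall s, 0 <= s -> forall i b, adapted (F s) (fun w => H s w i b).
Hypothesis aZ : forall s, 0 <= s -> forall i, adapted (F s) (fun w => Z s w i 0).
Hypothesis aW : forall s, 0 <= s -> adapted (F s) (W s).
Hypotheses (L0 : 0 <= L) (M0 : 0 <= M) (t0 : 0 < t).
Hypothesis HM : forall s w, 0 <= s -> hsnorm (H s w) ^+ 2 <= M.
Hypothesis WM : forall s w, 0 <= s -> 0 <= W s w <= M.
Hypothesis HW : forall s w, 0 <= s -> hsnorm (H s w) ^+ 2 <= L * W s w.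
Hypothesis ZHW : forall s u w, 0 <= s -> s <= u ->
  enorm (Z s w) ^+ 2 * hsnorm (H u w) ^+ 2 <= L * W u w ^+ 2.

Variables (k l : nat).
Let N := (k.+1 * l.+1)%N.
Let n := N.-1.
Let nN : n.+1 = N. Proof. by rewrite prednK// muln_gt0. Qed.
Let tau := gridpt 0 t n.
Let delta := t / N%:R.
Let c33 : R := 33 * m%:R.
Let blk p := ((p %/ l.+1) * l.+1)%N.

Let N0 : 0 < N%:R :> R. Proof. by rewrite ltr0n muln_gt0. Qed.
Let delta0 : 0 < delta. Proof. by rewrite divr_gt0. Qed.
Let c330 : 0 <= c33. Proof. by rewrite mulr_ge0. Qed.

Let tauS p : tau p.+1 - tau p = delta.
Proof. by rewrite gridptS subr0 nN. Qed.

Let tau_le p q : (p <= q)%N -> tau p <= tau q.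
Proof.
move=> pq; rewrite /tau /gridpt lerD2l subr0 ler_pM2r ?invr_gt0 ?nN//.
by rewrite ler_pM2l// ler_nat.
Qed.

Let tau_ge0 p : 0 <= tau p.
Proof. by have := tau_le (leq0n p); rewrite {1}/tau gridpt0. Qed.

Let tau_lt p : tau p < tau p.+1.
Proof. by rewrite -subr_gt0 tauS. Qed.

Let G p := F (tau p).

Let G_le i j : (i <= j <= N)%N -> G i `<=` G j.
Proof. by move=> /andP[ij _]; apply: (filtration_le HF); [exact: tau_ge0|exact: tau_le]. Qed.

Let blk_le p : (blk p <= p)%N.
Proof. exact: leq_trunc_div. Qed.

Definition fine_incr (i : 'I_d) (p : nat) (w : T) : R :=
  \sum_b H (tau p) w i b * dB B (tau p) (tau p.+1) b w.

Definition fine_int (p : nat) (w : T) : 'cV[R]_d := \col_i mart (fine_incr i) p w.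

Let D1 p w := \sum_b (\sum_i Z (tau (blk p)) w i 0 * H (tau p) w i b) *
  dB B (tau p) (tau p.+1) b w.
Let Y p w : 'cV[R]_d := fine_int p w - fine_int (blk p) w.
Let D2 p w := \sum_b (\sum_i Y p w i 0 * H (tau p) w i b) *
  dB B (tau p) (tau p.+1) b w.
Let v p := Ex (nB B (tau p) (tau p.+1)).
Let D3 p w := hsnorm (H (tau p) w) ^+ 2 * (nB B (tau p) (tau p.+1) w - v p).

Let Gm p (X : T -> R) : adapted (G p) X -> measurable_fun setT X.
Proof. by move=> aX; exact: (F_measurable HF (tau_ge0 p)). Qed.

Let Hsq p : Ex (fun w => hsnorm (H (tau p) w) ^+ 2) <= M.
Proof.
rewrite -(Ex_cst P M); apply: Ex_le => [||w]; [|exact: rint_cst|exact: HM].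
apply: (@rint_bounded _ _ _ _ _ M).
  under eq_fun do rewrite sqr_hsnorm.
  apply: measurable_sum => i; apply: measurable_sum => b; apply: measurable_funX.
  exact: Gm (aH _ _ _).
by move=> w; rewrite ger0_norm ?sqr_ge0// HM.
Qed.

Let sH p i b : sqint P (fun w => H (tau p) w i b).
Proof.
apply: (@sqint_bounded2 _ M); first exact: Gm (aH _ _ _).
by move=> w; exact: le_trans (sqr_entry_le _ _ _) (HM _ _).
Qed.

Let mdN i p : mdiff P (G p) (G p.+1) (fine_incr i p) /\
  Ex (fun w => fine_incr i p w ^+ 2) <= c33 * delta * \sum_b Ex (fun w => H (tau p) w i b ^+ 2).
Proof.
have := mdiff_dB HF HB (tau_ge0 p) (tau_lt p) (xi := fun b w => H (tau p) w i b).
rewrite tauS; apply; [by move=> b; exact: aH|by move=> b; exact: sH].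
Qed.

Let mdN' i q p : mdiff P (G p) (G p.+1) (fun w => if (q <= p)%N then fine_incr i p w else 0).
Proof.
case: (q <= p)%N; first by case: (mdN i p).
split; [by apply: (@sqint_bounded _ _ _ _ _ 0) => // w; rewrite normr0|exact: measurable_cst|].
by move=> U _ _; under eq_Rintegral do rewrite mulr0; rewrite Ex_cst.
Qed.

Let Yi q p w i : (q <= p)%N -> (fine_int p w - fine_int q w) i 0 =
  mart (fun p w => if (q <= p)%N then fine_incr i p w else 0) p w.
Proof.
move=> qp; rewrite /fine_int !mxE /mart.
rewrite -(big_mkord xpredT (fun j => fine_incr i j w)).
rewrite -(big_mkord xpredT (fun j => fine_incr i j w)).
rewrite -(big_mkord xpredT (fun j => if (q <= j)%N then fine_incr i j w else 0)).
rewrite (big_cat_nat (leq0n q) qp)/= [RHS](big_cat_nat (leq0n q) qp)/=.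
rewrite [X in _ = X + _]big_nat_cond [X in _ = X + _]big1 ?add0r; last first.
  by move=> j /andP[/andP[_ jq] _]; rewrite leqNgt jq.
rewrite addrC addrA addNr add0r.
by rewrite big_nat_cond [RHS]big_nat_cond; apply: eq_bigr => j /andP[/andP[-> _] _].
Qed.

Let aY q p i : (q <= p <= N)%N -> adapted (G p) (fun w => (fine_int p w - fine_int q w) i 0).
Proof.
move=> /andP[qp pN]; under eq_fun do rewrite (Yi _ _ qp).
by apply: (@mart_adapted _ _ _ P N G) => // j _; exact: mdN'.
Qed.

Let sY q p i : (q <= p <= N)%N -> sqint P (fun w => (fine_int p w - fine_int q w) i 0).
Proof.
move=> /andP[qp pN]; under eq_fun do rewrite (Yi _ _ qp).
by apply: (@mart_sqint _ _ _ P N G) => // j _; exact: mdN'.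
Qed.

Let EY q p : (q <= p <= N)%N ->
  \sum_i Ex (fun w => (fine_int p w - fine_int q w) i 0 ^+ 2) <= c33 * delta * M * (p - q)%:R.
Proof.
move=> /andP[qp pN].
have E i : Ex (fun w => (fine_int p w - fine_int q w) i 0 ^+ 2) =
    \sum_(j < p) Ex (fun w => (if (q <= j)%N then fine_incr i j w else 0) ^+ 2).
  under eq_Rintegral do rewrite (Yi _ _ qp).
  by apply: (@mart_isometry _ _ _ P N G) => // j _; exact: mdN'.
under eq_bigr do rewrite E.
rewrite exchange_big /=.
apply: (@le_trans _ _ (\sum_(j < p) (if (q <= j)%N then c33 * delta * M else 0))).
  apply: ler_sum => j _; case: ifP => qj; last first.
    by rewrite big1// => i _; under eq_Rintegral do rewrite expr0n; rewrite Ex_cst.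
  apply: (@le_trans _ _ (\sum_i c33 * delta * \sum_b Ex (fun w => H (tau j) w i b ^+ 2))).
    by apply: ler_sum => i _; case: (mdN i j).
  rewrite -mulr_sumr; apply: ler_wpM2l; first exact: mulr_ge0 c330 (ltW delta0).
  apply: le_trans (Hsq j); under [leRHS]eq_Rintegral do rewrite sqr_hsnorm.
  rewrite Ex_sum; last by move=> i _; apply: rint_sum => b _; case: (sH j i b).
  by apply: ler_sum => i _; rewrite Ex_sum// => b _; case: (sH j i b).
rewrite -(big_mkord xpredT (fun j => if (q <= j)%N then c33 * delta * M else 0)).
rewrite (big_cat_nat (leq0n q) qp)/=.
rewrite big_nat_cond big1 ?add0r; last by move=> j /andP[/andP[_ jq] _]; rewrite leqNgt jq.
rewrite big_nat_cond (eq_bigr (fun=> c33 * delta * M)).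
  by rewrite -big_nat_cond sumr_const_nat mulr_natr.
by move=> j /andP[/andP[-> _] _].
Qed.


Let Gp_of p q i : (q <= p)%N -> adapted (G p) (fun w => Z (tau q) w i 0).
Proof.
move=> qp; apply: adapted_sub (aZ (tau_ge0 q) i).
by apply: (filtration_le HF); [exact: tau_ge0|exact: tau_le].
Qed.

(* linear functionals of the increments *)
Let lin_mdiff (V : T -> 'cV[R]_d) (K : T -> R) p :
  (forall i, adapted (G p) (fun w => V w i 0)) ->
  rint P K -> (forall w, enorm (V w) ^+ 2 * hsnorm (H (tau p) w) ^+ 2 <= K w) ->
  let D := fun w => \sum_b (\sum_i V w i 0 * H (tau p) w i b) *
    dB B (tau p) (tau p.+1) b w in
  mdiff P (G p) (G p.+1) D /\ Ex (fun w => D w ^+ 2) <= c33 * delta * Ex K.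
Proof.
move=> aV iK VK.
have xiK w : \sum_b (\sum_i V w i 0 * H (tau p) w i b) ^+ 2 <= K w.
  apply: le_trans (VK w); apply: le_trans (sqr_row_mul_le _ _) _.
  by rewrite sqr_enorm.
have axi b : adapted (G p) (fun w => \sum_i V w i 0 * H (tau p) w i b).
  by apply: adapted_sum => i _; apply: measurable_funM; [exact: aV|exact: aH].
have sxi b : sqint P (fun w => \sum_i V w i 0 * H (tau p) w i b).
  split; first exact: Gm (axi b).
  apply: rint_le iK _; first by apply: measurable_funX; exact: Gm (axi b).
  move=> w; rewrite ger0_norm ?sqr_ge0//; apply: le_trans (xiK w).
  rewrite [leRHS](bigD1 b)//= lerDl; apply: sumr_ge0 => c _; exact: sqr_ge0.
have := mdiff_dB HF HB (tau_ge0 p) (tau_lt p) axi sxi.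
rewrite tauS => -[mD ED]; split=> //.
apply: le_trans ED _; apply: ler_wpM2l; first exact: mulr_ge0 c330 (ltW delta0).
rewrite -Ex_sum; last by move=> b _; case: (sxi b).
by apply: Ex_le => //; apply: rint_sum => b _; case: (sxi b).
Qed.

Let sW p : sqint P (W (tau p)).
Proof.
apply: (@sqint_bounded _ _ _ _ _ M); first exact: Gm (aW _).
by move=> w; have /andP[w0 wM] := WM w (tau_ge0 p); rewrite ger0_norm.
Qed.

Let mD1 p : mdiff P (G p) (G p.+1) (D1 p) /\
  Ex (fun w => D1 p w ^+ 2) <= c33 * delta * (L * Ex (fun w => W (tau p) w ^+ 2)).
Proof.
rewrite -(ExZ L (sW p).2).
apply: lin_mdiff => [i||w]; first exact: Gp_of.
  exact: rintZ (sW p).2.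
by apply: ZHW => //; exact: tau_le.
Qed.

Let mD2 p : (p < N)%N -> mdiff P (G p) (G p.+1) (D2 p) /\
  Ex (fun w => D2 p w ^+ 2) <= c33 * delta * (M * (c33 * delta * M * l.+1%:R)).
Proof.
move=> pN; have bpN : (blk p <= p <= N)%N by rewrite blk_le ltnW.
have iY : rint P (fun w => M * \sum_i Y p w i 0 ^+ 2).
  by apply: rintZ; apply: rint_sum => i _; case: (sY i bpN).
have [|w|mD ED] := @lin_mdiff (Y p) _ p _ iY.
- by move=> i; exact: aY.
- rewrite mulrC sqr_enorm; apply: ler_pM; rewrite ?sqr_ge0 ?dot_ge0 ?HM//.
split=> //; apply: le_trans ED _.
apply: ler_wpM2l; first exact: mulr_ge0 c330 (ltW delta0).
rewrite ExZ; last by apply: rint_sum => i _; case: (sY i bpN).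
apply: ler_wpM2l => //; rewrite Ex_sum; last by move=> i _; case: (sY i bpN).
apply: le_trans (EY bpN) _; apply: ler_wpM2l; first by rewrite !mulr_ge0// ltW.
by rewrite ler_nat leq_subLR /blk {1}(divn_eq p l.+1) leq_add2l ltnW// ltn_pmod.
Qed.

Let sq p : sqint P (fun w => hsnorm (H (tau p) w) ^+ 2).
Proof.
apply: (@sqint_bounded _ _ _ _ _ M); last by move=> w; rewrite ger0_norm ?sqr_ge0 ?HM.
under eq_fun do rewrite sqr_hsnorm.
apply: measurable_sum => i; apply: measurable_sum => b; apply: measurable_funX.
exact: Gm (aH _ _ _).
Qed.

Let mD3 p : mdiff P (G p) (G p.+1) (D3 p) /\
  Ex (fun w => D3 p w ^+ 2) <= 64 * m%:R ^+ 2 * delta ^+ 2 * M ^+ 2.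
Proof.
have aq : adapted (F (tau p)) (fun w => hsnorm (H (tau p) w) ^+ 2).
  under eq_fun do rewrite sqr_hsnorm.
  apply: adapted_sum => i _; apply: adapted_sum => b _.
  by apply: measurable_funX; exact: aH.
have := mdiff_nB HF HB (tau_ge0 p) (tau_lt p) aq (sq p); rewrite tauS => -[mD ED].
split=> //; apply: le_trans ED _.
apply: ler_wpM2l; first by rewrite (mulr_ge0 _ (sqr_ge0 _))// (mulr_ge0 _ (sqr_ge0 _)).
rewrite -(Ex_cst P (M ^+ 2)); apply: Ex_le => [||w]; [by case: (sq p)|exact: rint_cst|].
by rewrite ler_pXn2r ?nnegrE ?sqr_ge0 ?HM.
Qed.

(* grouping the fine steps by coarse steps *)
Let sum_blk (u : nat -> R) j : \sum_(p < j * l.+1) u p =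
  \sum_(i < j) \sum_(s < l.+1) u (i * l.+1 + s)%N.
Proof.
elim: j => [|j ih]; first by rewrite !big_ord0.
by rewrite [RHS]big_ord_recr/= -ih mulSn addnC big_split_ord.
Qed.

Let blkE i s : (s < l.+1)%N -> blk (i * l.+1 + s) = (i * l.+1)%N.
Proof. by move=> sl; rewrite /blk divnMDl// divn_small// addn0. Qed.

Let vec_incr p w := H (tau p) w *m (B (tau p.+1) w - B (tau p) w).

Let vec_incrE p w i : vec_incr p w i 0 = fine_incr i p w.
Proof. by rewrite mxE; apply: eq_bigr => b _; rewrite /dB !mxE. Qed.

Let fine_intS p w : fine_int p.+1 w = fine_int p w + vec_incr p w.
Proof. by apply/colP => i; rewrite mxE [RHS]mxE vec_incrE !mxE /mart big_ord_recr. Qed.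

Let dot_incr p (V : 'cV[R]_d) w : dot V (vec_incr p w) =
  \sum_b (\sum_i V i 0 * H (tau p) w i b) * dB B (tau p) (tau p.+1) b w.
Proof.
under [RHS]eq_bigr do rewrite mulr_suml.
rewrite exchange_big; apply: eq_bigr => i _; rewrite vec_incrE mulr_sumr.
by apply: eq_bigr => b _; rewrite mulrA.
Qed.

Let blk_dot i w : dot (Z (tau (i * l.+1)) w)
    (fine_int (i.+1 * l.+1) w - fine_int (i * l.+1) w) =
  \sum_(s < l.+1) D1 (i * l.+1 + s) w.
Proof.
have h s : (s <= l.+1)%N -> dot (Z (tau (i * l.+1)) w)
    (fine_int (i * l.+1 + s) w - fine_int (i * l.+1) w) =
    \sum_(s' < s) D1 (i * l.+1 + s') w.
  elim: s => [_|s ih sl].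
    by rewrite addn0 subrr big_ord0 /dot big1// => c _; rewrite mxE mulr0.
  rewrite big_ord_recr/= -ih ?(ltnW sl)// addnS fine_intS addrAC.
  by rewrite dotC dotDl -!(dotC (Z _ _)) dot_incr /D1 blkE.
by rewrite -h// mulSn addnC.
Qed.

Let blk_sqr i w : enorm (fine_int (i.+1 * l.+1) w - fine_int (i * l.+1) w) ^+ 2 <=
  \sum_(s < l.+1) (2 * D2 (i * l.+1 + s) w + D3 (i * l.+1 + s) w +
    hsnorm (H (tau (i * l.+1 + s)) w) ^+ 2 * v (i * l.+1 + s)).
Proof.
have h s : (s <= l.+1)%N -> enorm (fine_int (i * l.+1 + s) w - fine_int (i * l.+1) w) ^+ 2 <=
    \sum_(s' < s) (2 * D2 (i * l.+1 + s') w + D3 (i * l.+1 + s') w +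
      hsnorm (H (tau (i * l.+1 + s')) w) ^+ 2 * v (i * l.+1 + s')).
  elim: s => [_|s ih sl].
    by rewrite addn0 subrr big_ord0 sqr_enorm /dot big1// => c _; rewrite mxE mulr0.
  rewrite big_ord_recr/=; have := ih (ltnW sl); set S := \sum_(s' < s) _ => ihs.
  rewrite addnS fine_intS addrAC.
  have D2E : D2 (i * l.+1 + s) w = dot (fine_int (i * l.+1 + s) w - fine_int (i * l.+1) w)
     (vec_incr (i * l.+1 + s) w) by rewrite dot_incr /D2 /Y blkE.
  have D3E : enorm (vec_incr (i * l.+1 + s) w) ^+ 2 <= D3 (i * l.+1 + s) w +
      hsnorm (H (tau (i * l.+1 + s)) w) ^+ 2 * v (i * l.+1 + s).
    rewrite /D3 mulrBr subrK; apply: le_trans (sqr_enorm_mulmx_le _ _) _.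
    apply: ler_wpM2l; first exact: sqr_ge0.
    by rewrite sqr_enorm /dot /nB; apply: ler_sum => b _; rewrite /dB !mxE expr2.
  move: D2E D3E ihs; set Y0 := fine_int _ w - _; set V := vec_incr _ w => D2E D3E ihs.
  by rewrite sqr_enormD -D2E; lra.
by have := h _ (leqnn l.+1); rewrite {1}mulSn addnC.
Qed.

Let fine_bound w := 2 * runmax (mart D1 ^~ w) N +
  2 * (2 * mart D2 N w + mart D3 N w + c33 * delta * L * \sum_(p < N) W (tau p) w).

Let vle p : 0 <= v p <= c33 * delta.
Proof. by have := nB_mean HF HB (tau_ge0 p) (tau_lt p); rewrite tauS. Qed.

Let fine_pathwise w j : (j <= k.+1)%N ->
  2 * \sum_(i < j) dot (Z (tau (i * l.+1)) w)
    (fine_int (i.+1 * l.+1) w - fine_int (i * l.+1) w) +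
  2 * \sum_(i < j) enorm (fine_int (i.+1 * l.+1) w - fine_int (i * l.+1) w) ^+ 2 <=
  fine_bound w.
Proof.
move=> jk; apply: lerD; rewrite ler_pM2l//.
  under eq_bigr do rewrite blk_dot.
  rewrite -(sum_blk (D1 ^~ w)).
  case: j jk => [_|j jk]; first by rewrite mul0n big_ord0 runmax_ge0.
  have -> : \sum_(p < j.+1 * l.+1) D1 p w = (mart D1 ^~ w) (j.+1 * l.+1)%N by [].
  by apply: runmax_ge; rewrite muln_gt0/= leq_mul2r jk orbT.
apply: (@le_trans _ _ (\sum_(i < k.+1)
    enorm (fine_int (i.+1 * l.+1) w - fine_int (i * l.+1) w) ^+ 2)).
  rewrite -!(big_mkord xpredT (fun i => enorm (fine_int (i.+1 * l.+1) w - fine_int (i * l.+1) w) ^+ 2)).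
  by rewrite [leRHS](big_cat_nat (leq0n j) jk)/= lerDl; apply: sumr_ge0 => i _; exact: sqr_ge0.
apply: (le_trans (ler_sum _ _)) => [i _|]; first exact: blk_sqr.
rewrite -(sum_blk (fun p => 2 * D2 p w + D3 p w + hsnorm (H (tau p) w) ^+ 2 * v p)).
rewrite !big_split/= -mulr_sumr -!addrA lerD2l lerD2l mulr_sumr.
apply: ler_sum => p _; rewrite mulrC -mulrA; have /andP[v0 vc] := vle p.
by apply: ler_pM => //; [exact: sqr_ge0|exact: HW].
Qed.

Let energy : exists Phi : T -> R, [/\ sqint P Phi,
  (forall w j, (j <= k.+1)%N ->
    2 * \sum_(i < j) dot (Z (tau (i * l.+1)) w)
      (fine_int (i.+1 * l.+1) w - fine_int (i * l.+1) w) +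
    2 * \sum_(i < j) enorm (fine_int (i.+1 * l.+1) w - fine_int (i * l.+1) w) ^+ 2 <= Phi w) &
  Ex (fun w => Phi w ^+ 2) <=
    (64 * c33 * L + 16 * c33 ^+ 2 * t * L ^+ 2) *
      (delta * \sum_(p < N) Ex (fun w => W (tau p) w ^+ 2)) +
    (64 * c33 ^+ 2 + 1024 * m%:R ^+ 2) * (M * t) ^+ 2 / k.+1%:R].
Proof.
have m1 p : (p < N)%N -> mdiff P (G p) (G p.+1) (D1 p) by move=> _; case: (mD1 p).
have m2 p : (p < N)%N -> mdiff P (G p) (G p.+1) (D2 p) by move=> /mD2[].
have m3 p : (p < N)%N -> mdiff P (G p) (G p.+1) (D3 p) by move=> _; case: (mD3 p).
have [_ s1] := runmax_adapted_sqint G_le m1 (leqnn N).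
have s2 := mart_sqint m2 (leqnn N); have s3 := mart_sqint m3 (leqnn N).
have s4 : sqint P (fun w => \sum_(p < N) W (tau p) w) by apply: sqint_sum.
pose E0 := delta * \sum_(p < N) Ex (fun w => W (tau p) w ^+ 2).
have Nd : N%:R * delta = t by rewrite mulrC divfK// gt_eqF.
have ld : l.+1%:R * delta = t / k.+1%:R.
  rewrite /delta natrM; have : l.+1%:R != 0 :> R by rewrite pnatr_eq0.
  have : k.+1%:R != 0 :> R by rewrite pnatr_eq0.
  by move: (l.+1%:R : R) (k.+1%:R : R) => y x x0 y0; field; rewrite x0 y0.
have e1 : Ex (fun w => runmax (mart D1 ^~ w) N ^+ 2) <= 4 * c33 * L * E0.
  apply: le_trans (mart_doob G_le m1) _; rewrite -mulrA -mulrA; apply: ler_wpM2l => //.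
  apply: (le_trans (ler_sum _ _)) => [p _|]; first exact: (mD1 p).2.
  rewrite -!mulr_sumr /E0; set S := \sum_(i < N) _.
  by rewrite le_eqVlt; apply/orP; left; apply/eqP; ring.
have e2 : Ex (fun w => mart D2 N w ^+ 2) <= c33 ^+ 2 * (M * t) ^+ 2 / k.+1%:R.
  rewrite (mart_isometry G_le m2 (leqnn N)).
  apply: (le_trans (ler_sum _ _)) => [p _|]; first exact: (mD2 (ltn_ord p)).2.
  rewrite sumr_const card_ord -[leLHS]mulr_natl.
  rewrite [leLHS](_ : _ = c33 ^+ 2 * M ^+ 2 * (N%:R * delta) * (l.+1%:R * delta)); last by ring.
  rewrite Nd ld le_eqVlt; apply/orP; left; apply/eqP.
  by generalize (k.+1%:R^-1 : R) => y; ring.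
have e3 : Ex (fun w => mart D3 N w ^+ 2) <= 64 * m%:R ^+ 2 * (M * t) ^+ 2 / k.+1%:R.
  rewrite (mart_isometry G_le m3 (leqnn N)).
  apply: (le_trans (ler_sum _ _)) => [p _|]; first exact: (mD3 p).2.
  rewrite sumr_const card_ord -[leLHS]mulr_natl.
  rewrite [leLHS](_ : _ = 64 * m%:R ^+ 2 * M ^+ 2 * (N%:R * delta) * delta); last by ring.
  rewrite Nd [leRHS](_ : _ = 64 * m%:R ^+ 2 * M ^+ 2 * t * (t / k.+1%:R)); last first.
    by generalize (k.+1%:R^-1 : R) => y; ring.
  apply: ler_wpM2l; first by rewrite !mulr_ge0 ?sqr_ge0 ?(ltW t0).
  by rewrite ler_wpM2l ?(ltW t0)// lef_pV2 ?posrE ?ltr0n// ler_nat leq_pmulr.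
have e4 : Ex (fun w => (c33 * delta * L * \sum_(p < N) W (tau p) w) ^+ 2) <=
    c33 ^+ 2 * t * L ^+ 2 * E0.
  apply: (@le_trans _ _ (Ex (fun w => (c33 * delta * L) ^+ 2 *
      (N%:R * \sum_(p < N) W (tau p) w ^+ 2)))).
    apply: Ex_le => [||w].
    - by have [] := sqintZ (c33 * delta * L) s4.
    - by do 2 apply: rintZ; apply: rint_sum => p _; case: (sW p).
    - by rewrite exprMn; apply: ler_wpM2l; [exact: sqr_ge0|exact: sqr_sum_le].
  rewrite ExZ; last by apply: rintZ; apply: rint_sum => p _; case: (sW p).
  rewrite ExZ; last by apply: rint_sum => p _; case: (sW p).
  rewrite Ex_sum; last by move=> p _; case: (sW p).
  rewrite /E0; set S := \sum_(p < N) _.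
  rewrite [leLHS](_ : _ = c33 ^+ 2 * (N%:R * delta) * L ^+ 2 * (delta * S)); last by ring.
  by rewrite Nd lexx.
have sPhi : sqint P fine_bound.
  apply: sqintD; first exact: sqintZ.
  apply: sqintZ; apply: sqintD; last exact: sqintZ.
  by apply: sqintD => //; exact: sqintZ.
exists fine_bound; split=> //.
pose Q w := 16 * runmax (mart D1 ^~ w) N ^+ 2 + 64 * mart D2 N w ^+ 2 +
   16 * mart D3 N w ^+ 2 + 16 * (c33 * delta * L * \sum_(p < N) W (tau p) w) ^+ 2.
have i4 := (sqintZ (c33 * delta * L) s4).2.
have i1 := rintZ 16 s1.2; have i2 := rintZ 64 s2.2; have i3 := rintZ 16 s3.2.
have i5 := rintZ 16 i4.
apply: (@le_trans _ _ (Ex Q)).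
  apply: Ex_le => [||w]; first by case: sPhi.
    by apply: rintD => //; apply: rintD => //; exact: rintD.
  rewrite /fine_bound /Q.
  move: (runmax _ _) (mart D2 N w) (mart D3 N w) (c33 * delta * L * _) => a b c e.
  have := sqr_sum_le (fun i : 'I_4 => [tuple 2 * a; 4 * b; 2 * c; 2 * e]`_i).
  rewrite !big_ord_recl !big_ord0 /= !exprMn.
  move=> h; apply: le_trans (le_trans h _); last by lra.
  by rewrite le_eqVlt; apply/orP; left; apply/eqP; congr (_ ^+ 2); ring.
rewrite /Q ExD //; last by apply: rintD => //; exact: rintD.
rewrite ExD //; last exact: rintD.
rewrite ExD // !ExZ //; [|by case: s3|by case: s2|by case: s1].
rewrite -/E0.
rewrite [leRHS](_ : _ = 16 * (4 * c33 * L * E0) + 64 * (c33 ^+ 2 * (M * t) ^+ 2 / k.+1%:R) +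
   16 * (64 * m%:R ^+ 2 * (M * t) ^+ 2 / k.+1%:R) + 16 * (c33 ^+ 2 * t * L ^+ 2 * E0)); last first.
  by generalize (k.+1%:R^-1 : R) => y; ring.
by apply: lerD; [apply: lerD; [apply: lerD|]|]; rewrite ler_pM2l.
Qed.

Lemma fine_grid_energy (tp : nat -> R := gridpt 0 t (k.+1 * l.+1).-1) : exists Phi : T -> R, [/\ sqint P Phi,
  (forall w j, (j <= k.+1)%N ->
    2 * \sum_(i < j) dot (Z (tp (i * l.+1)%N) w)
      (fine_int (i.+1 * l.+1) w - fine_int (i * l.+1) w) +
    2 * \sum_(i < j) enorm (fine_int (i.+1 * l.+1) w - fine_int (i * l.+1) w) ^+ 2 <= Phi w) &
  Ex (fun w => Phi w ^+ 2) <=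
    (64 * (33 * m%:R) * L + 16 * (33 * m%:R) ^+ 2 * t * L ^+ 2) *
      (t / (k.+1 * l.+1)%:R * \sum_(p < k.+1 * l.+1) Ex (fun w => W (tp p) w ^+ 2)) +
    (64 * (33 * m%:R) ^+ 2 + 1024 * m%:R ^+ 2) * (M * t) ^+ 2 / k.+1%:R].
Proof. exact: energy. Qed.

End fine_grid_energy.

Section fatou_squares.
Context {R : realType} {dT : measure_display} {T : measurableType dT}.
Variable P : probability T R.
Local Notation Ex X := (\int[P]_w (X w)).

Lemma le_limn_einf (a : R) (u : nat -> R) :
  (forall e : R, 0 < e -> \forall k \near \oo, a <= u k + e) ->
  (a%:E <= limn_einf (fun k => (u k)%:E))%E.
Proof.
move=> h; apply/lee_addgt0Pr => e e0; rewrite -leeBlDr//.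
have [N _ hN] := h e e0.
rewrite limn_einf_lim; apply: lime_ge; first exact: is_cvg_einfs.
exists N => // n Nn; apply: le_ereal_inf_tmp => _ [k /= nk <-].
by rewrite -EFinB lee_fin lerBlDr; apply: hN => /=; exact: leq_trans nk.
Qed.

Lemma ex_sqr_fatou (G : set T) (X : T -> R) (Y : nat -> T -> R) (b : R) :
  measurable G -> measurable_fun setT X -> (forall w, 0 <= X w) ->
  (forall k, sqint P (Y k)) ->
  (forall k w, 0 <= Y k w) ->
  {ae P, forall w, G w -> forall e : R, 0 < e -> \forall k \near \oo, X w <= Y k w + e} ->
  (\forall k \near \oo, Ex (fun w => Y k w ^+ 2) <= b) ->
  rint P (fun w => \1_G w * X w ^+ 2) /\ Ex (fun w => \1_G w * X w ^+ 2) <= b.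
Proof.
move=> mG mX X0 sY Y0 XY Yb.
have mGX : measurable_fun setT (fun w => \1_G w * X w ^+ 2).
  by apply: measurable_funM; [exact: measurable_indic|exact: measurable_funX].
have GX0 w : 0 <= \1_G w * X w ^+ 2 by rewrite mulr_ge0 ?sqr_ge0// indicE.
have mY k : measurable_fun setT (fun w => (Y k w ^+ 2)%:E).
  by apply/measurable_EFinP; apply: measurable_funX; case: (sY k).
have key : (\int[P]_w (\1_G w * X w ^+ 2)%:E <= b%:E)%E.
  apply: (@le_trans _ _ (\int[P]_w (limn_einf (fun k => (Y k w ^+ 2)%:E)))%E).
    apply: ae_ge0_le_integral => //.
    - by move=> w _; rewrite lee_fin.
    - exact/measurable_EFinP.
    - move=> w _; apply: le_limn_einf => e e0; apply: nearW => k.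
      by rewrite addr_ge0// ?sqr_ge0// ltW.
    - apply: (emeasurable_fun_cvg (fun n w => einfs (fun k => (Y k w ^+ 2)%:E) n)).
        by move=> n; exact: measurable_fun_einfs.
      by move=> w _; rewrite limn_einf_lim; exact: is_cvg_einfs.
    apply: filterS XY => w XY _; apply: le_limn_einf => e e0.
    rewrite indicE; have [Gw|nGw] := pselect (G w); last first.
      rewrite memNset// mul0r; apply: nearW => k.
      by rewrite addr_ge0// ?sqr_ge0// ltW.
    rewrite mem_set// mul1r.
    have c0 : 0 < 2 * X w + 1 by rewrite ltr_wpDl// mulr_ge0.
    have d0 : 0 < e / (2 * X w + 1) by rewrite divr_gt0.
    have := XY Gw _ d0; apply: filterS => k; rewrite -lerBlDl => h.
    have [XYk|YXk] := leP (X w) (Y k w).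
      apply: (@le_trans _ _ (Y k w ^+ 2)); last by rewrite lerDl ltW.
      by rewrite ler_pXn2r ?nnegrE.
    rewrite -lerBlDl subr_sqr; apply: (@le_trans _ _ (e / (2 * X w + 1) * (2 * X w + 1))).
      apply: ler_pM => //; [by rewrite subr_ge0 ltW|by rewrite addr_ge0|].
      by have := X0 w; lra.
    by rewrite divfK// gt_eqF.
  apply: le_trans (fatou P measurableT mY _) _; first by move=> k w _; rewrite lee_fin sqr_ge0.
  rewrite limn_einf_lim; apply: lime_le; first exact: is_cvg_einfs.
  move: Yb => [N _ hN]; apply: nearW => k.
  apply: (@le_trans _ _ (\int[P]_w (Y (maxn k N) w ^+ 2)%:E)%E).
    by apply: ereal_inf_lbound; exists (maxn k N) => //=; exact: leq_maxl.
  have := hN (maxn k N) (leq_maxr k N); rewrite /= -lee_fin; apply: le_trans.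
  by rewrite /Rintegral fineK//; apply: integrable_fin_num => //; case: (sY (maxn k N)).
have iX : rint P (fun w => \1_G w * X w ^+ 2).
  apply/integrableP; split; first exact/measurable_EFinP.
  under eq_integral do rewrite /= ger0_norm//.
  by apply: le_lt_trans key _; rewrite ltry.
split=> //; rewrite -lee_fin; apply: le_trans key.
by rewrite /Rintegral fineK//; apply: integrable_fin_num.
Qed.

Lemma cvg0_probabilityD (X Y : nat -> T -> R) :
  (forall n, measurable_fun setT (X n)) -> (forall n, measurable_fun setT (Y n)) ->
  cvg0_in_probability P (fun n w => (X n w)%:E) ->
  cvg0_in_probability P (fun n w => (Y n w)%:E) ->
  cvg0_in_probability P (fun n w => (X n w + Y n w)%:E).
Proof.
move=> mX mY cX cY e e0; have e2 : 0 < e / 2 by rewrite divr_gt0.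
have := cvgeD _ (cX _ e2) (cY _ e2); rewrite adde0 => /(_ _ isT) c.
apply: (squeeze_cvge _ (cvg_cst 0%E) c); apply: nearW => n; rewrite measure_ge0/=.
have mS (Z : nat -> T -> R) c' : measurable_fun setT (Z n) ->
    measurable [set w | (c'%:E <= (Z n w)%:E)%E].
  move=> mZ; rewrite (_ : [set w | _] = [set w | c' <= Z n w]); first exact: measurable_ge_set.
  by apply/seteqP; split=> w /=; rewrite lee_fin.
apply: (@le_trans _ _ (P ([set w | (((e / 2)%:E <= (X n w)%:E)%E)] `|` [set w | ((e / 2)%:E <= (Y n w)%:E)%E]))).
  apply: le_measure; rewrite ?inE.
  - by apply: (mS (fun n w => X n w + Y n w)); exact: measurable_funD.
  - by apply: measurableU; exact: mS.
  move=> w /=; rewrite !lee_fin => h; have [x1|x1] := leP (e / 2) (X n w); [by left|right].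
  by move: h x1; set a := X n w; set b := Y n w; lra.
by apply: measureU2; exact: mS.
Qed.

Lemma cvg0_probability_sum J (Y : nat -> nat -> T -> R) :
  (forall j n, measurable_fun setT (Y j n)) ->
  (forall j, (j < J)%N -> cvg0_in_probability P (fun n w => (Y j n w)%:E)) ->
  cvg0_in_probability P (fun n w => (\sum_(j < J) Y j n w)%:E).
Proof.
move=> mY; elim: J => [_|J ih cY].
  under eq_fun do under eq_fun do rewrite big_ord0.
  move=> e e0; rewrite (_ : (fun _ => _) = (fun=> 0%E)); first exact: cvg_cst.
  apply/funext => n; rewrite -(measure0 P); congr (P _).
  by apply/seteqP; split=> w //=; rewrite lee_fin leNgt e0.
under eq_fun do under eq_fun do rewrite big_ord_recr /=.
apply: cvg0_probabilityD => // [n||]; first exact: measurable_sum.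
  by apply: ih => j jJ; apply: cY; rewrite ltnW.
exact: cY.
Qed.

End fatou_squares.

Section exponential_sums.
Context {R : realType}.
Implicit Types t lam : R.

Lemma exp_increment lam (s u : R) : 0 < lam -> s <= u ->
  (u - s) * expR (lam * s) <= (expR (lam * u) - expR (lam * s)) / lam.
Proof.
move=> l0 su; rewrite ler_pdivlMr// lerBrDr.
have -> : lam * u = lam * s + lam * (u - s) by ring.
rewrite expRD; have := expR_ge1Dx (lam * (u - s)).
have := expR_gt0 (lam * s); set x := expR (lam * s); set y := expR (_ * (_ - _)).
move=> x0 h; rewrite (_ : _ + _ = x * (1 + lam * (u - s))); last by ring.
by rewrite ler_pM2l.
Qed.

Lemma exp_left_sum lam t n : 0 < lam -> 0 < t ->
  t / n.+1%:R * \sum_(p < n.+1) expR (lam * gridpt 0 t n p) <= expR (lam * t) / lam.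
Proof.
move=> l0 t0; rewrite mulr_sumr.
apply: (@le_trans _ _ (\sum_(p < n.+1)
    (expR (lam * gridpt 0 t n p.+1) - expR (lam * gridpt 0 t n p)) / lam)).
  apply: ler_sum => p _; have E := gridptS 0 t n p; rewrite subr0 in E; rewrite -E.
  by apply: exp_increment => //; rewrite -subr_ge0 E divr_ge0// ltW.
rewrite -mulr_suml -(big_mkord xpredT (fun p => expR (lam * gridpt 0 t n p.+1) - expR (lam * gridpt 0 t n p))).
rewrite telescope_sumr// gridpt0 gridpt_last mulr0 expR0.
by rewrite ler_pM2r ?invr_gt0// lerBlDr lerDl.
Qed.

Lemma exp_right_sum lam t n : 0 < lam -> 0 < t -> lam * (t / n.+1%:R) <= 1 ->
  t / n.+1%:R * \sum_(p < n.+1) expR (lam * gridpt 0 t n p.+1) <= expR 1 * (expR (lam * t) / lam).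
Proof.
move=> l0 t0 ht; apply: (@le_trans _ _ (expR 1 * (t / n.+1%:R * \sum_(p < n.+1) expR (lam * gridpt 0 t n p)))).
  rewrite mulrCA ler_pM2l ?divr_gt0// mulr_sumr; apply: ler_sum => p _.
  rewrite -expRD ler_expR -lerBlDr -mulrBr gridptS subr0//.
by rewrite ler_pM2l ?expR_gt0//; exact: exp_left_sum.
Qed.

End exponential_sums.

Section coarse_limit.
Context {R : realType} {dT : measure_display} {T : measurableType dT}.
Variables (P : probability T R) (F : R -> set_system T) (d m : nat).
Variable B : R -> T -> 'cV[R]_m.
Hypotheses (HF : is_filtration F) (HB : is_brownian P F B).
Local Notation Ex X := (\int[P]_w (X w)).

Lemma gridpt_refine (t : R) k l i :
  gridpt 0 t (k.+1 * l.+1).-1 (i * l.+1) = gridpt 0 t k i.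
Proof.
rewrite /gridpt prednK ?muln_gt0// !natrM.
have : l.+1%:R != 0 :> R by rewrite pnatr_eq0.
have : k.+1%:R != 0 :> R by rewrite pnatr_eq0.
by move: (l.+1%:R : R) (k.+1%:R : R) (i%:R : R) => y x z x0 y0; field; rewrite x0 y0.
Qed.

Lemma fine_int_entry (H : R -> T -> 'M[R]_(d, m)) t k l p w i :
  fine_int B H t k l p w i 0 = \sum_(j < p) \sum_b
    H (gridpt 0 t (k.+1 * l.+1).-1 j) w i b *
    dB B (gridpt 0 t (k.+1 * l.+1).-1 j) (gridpt 0 t (k.+1 * l.+1).-1 j.+1) b w.
Proof. by rewrite /fine_int mxE. Qed.

Lemma gridpt_ge0 (t : R) n p : 0 <= t -> 0 <= gridpt 0 t n p.
Proof. by move=> t0; rewrite /gridpt add0r subr0 divr_ge0// mulr_ge0. Qed.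

Lemma fine_int_measurable (H : R -> T -> 'M[R]_(d, m)) t k l p i : 0 <= t ->
  (forall s, 0 <= s -> forall i b, adapted (F s) (fun w => H s w i b)) ->
  measurable_fun setT (fun w => fine_int B H t k l p w i 0).
Proof.
move=> t0 aH; under eq_fun do rewrite fine_int_entry.
apply: measurable_sum => j; apply: measurable_sum => b; apply: measurable_funM.
  by apply: (F_measurable HF (gridpt_ge0 _ _ t0)); apply: aH; exact: gridpt_ge0.
apply: measurable_funB; apply: (F_measurable HF (gridpt_ge0 _ _ t0));
  by apply: (B_adapted HB); exact: gridpt_ge0.
Qed.

Lemma measurable_enorm (V : T -> 'cV[R]_d) :
  (forall i, measurable_fun setT (fun w => V w i 0)) -> measurable_fun setT (fun w => enorm (V w)).
Proof.
move=> mV; apply: (measurableT_comp (continuous_measurable_fun (@sqrt_continuous R))).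
by apply: measurable_sum => i; apply: measurable_funM.
Qed.

Definition coarse_noise (Z : R -> T -> 'cV[R]_d) (I : nat -> T -> 'cV[R]_d) t k j w :=
  2 * \sum_(i < j) dot (Z (gridpt 0 t k i) w) (I i.+1 w - I i w) +
  2 * \sum_(i < j) enorm (I i.+1 w - I i w) ^+ 2.

Lemma coarse_noise_cvg (Z : R -> T -> 'cV[R]_d) (I : nat -> T -> 'cV[R]_d)
    (N : nat -> nat -> T -> 'cV[R]_d) t k J w :
  (forall j, (j <= J)%N -> enorm (N j n w - I j w) @[n --> \oo] --> (0 : R)) ->
  forall j, (j <= J)%N ->
  coarse_noise Z (N ^~ n) t k j w @[n --> \oo] --> coarse_noise Z I t k j w.
Proof.
move=> cN j jJ.
have cE i c : (i <= J)%N -> N i n w c 0 @[n --> \oo] --> I i w c 0.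
  move=> iJ; apply/cvgrPdist_lt => e e0.
  have /cvgrPdist_lt/(_ _ e0) := cN i iJ; apply: filterS => n /=.
  rewrite sub0r normrN ger0_norm ?enorm_ge0//; apply: le_lt_trans.
  by have := ler_entry_enorm (N i n w - I i w) c; rewrite !mxE distrC.
have cD i c : (i < J)%N -> (N i.+1 n w - N i n w) c 0 @[n --> \oo] --> (I i.+1 w - I i w) c 0.
  move=> iJ; under eq_fun do rewrite !mxE; rewrite !mxE.
  by apply: cvgB; apply: cE => //; exact: ltnW.
rewrite /coarse_noise; apply: cvgD; apply: cvgM; (try exact: cvg_cst).
  apply: cvg_sumr => i; apply: cvg_sumr => c; apply: cvgM; first exact: cvg_cst.
  by apply: cD; exact: leq_trans (ltn_ord i) jJ.
apply: cvg_sumr => i; rewrite sqr_enorm; under eq_fun do rewrite sqr_enorm.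
by apply: cvg_sumr => c; apply: cvgM; apply: cD; exact: leq_trans (ltn_ord i) jJ.
Qed.

Variables (H HU : R -> T -> 'M[R]_(d, m)) (Z : R -> T -> 'cV[R]_d) (W : R -> T -> R).
Variables (L M t : R).
Hypothesis aHU : forall s, 0 <= s -> forall i b, adapted (F s) (fun w => HU s w i b).
Hypothesis aH : forall s, 0 <= s -> forall i b, adapted (F s) (fun w => H s w i b).
Hypothesis aZ : forall s, 0 <= s -> forall i, adapted (F s) (fun w => Z s w i 0).
Hypothesis aW : forall s, 0 <= s -> adapted (F s) (W s).
Hypotheses (L0 : 0 <= L) (M0 : 0 <= M) (t0 : 0 < t).
Hypothesis HM : forall s w, 0 <= s -> hsnorm (H s w) ^+ 2 <= M.
Hypothesis WM : forall s w, 0 <= s -> 0 <= W s w <= M.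
Hypothesis HW : forall s w, 0 <= s -> hsnorm (H s w) ^+ 2 <= L * W s w.
Hypothesis ZHW : forall s u w, 0 <= s -> s <= u ->
  enorm (Z s w) ^+ 2 * hsnorm (H u w) ^+ 2 <= L * W u w ^+ 2.
Variables (G : set T) (k : nat) (I : nat -> T -> 'cV[R]_d) (lam K : R).
Hypothesis mG : measurable G.
Hypothesis HUE : forall w, G w -> forall s, 0 <= s <= t -> H s w = HU s w.
Hypothesis mI : forall j i, measurable_fun setT (fun w => I j w i 0).
Hypothesis cI : forall j, (j <= k.+1)%N -> cvg0_in_probability P
  (fun l w => (enorm (fine_int B HU t k l (j * l.+1) w - I j w))%:E).
Hypotheses (lam0 : 0 < lam) (K0 : 0 <= K).
Hypothesis WK : forall s, 0 <= s <= t -> Ex (fun w => W s w ^+ 2) <= K * expR (lam * s).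

Let Phi w := runmax (coarse_noise Z I t k ^~ w) k.+1.

Lemma coarse_noise_measurable j : measurable_fun setT (coarse_noise Z I t k j).
Proof.
have mD i c : measurable_fun setT (fun w => (I i.+1 w - I i w) c 0).
  by under eq_fun do rewrite !mxE; apply: measurable_funB.
apply: measurable_funD; apply: measurable_funM => //; apply: measurable_sum => i.
  apply: measurable_sum => c; apply: measurable_funM => //.
  by apply: (F_measurable HF (gridpt_ge0 _ _ (ltW t0))); apply: aZ; apply: gridpt_ge0; exact: ltW.
by apply: measurable_funX; exact: measurable_enorm.
Qed.

Lemma runmax_measurable (u : nat -> T -> R) n :
  (forall j, measurable_fun setT (u j)) -> measurable_fun setT (fun w => runmax (u ^~ w) n).
Proof. by move=> mu; elim: n => [|n ih] /=; [exact: measurable_cst|exact: measurable_maxr]. Qed.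

Lemma coarse_noise_sqr : rint P (fun w => \1_G w * Phi w ^+ 2) /\
  Ex (fun w => \1_G w * Phi w ^+ 2) <=
    (64 * (33 * m%:R) * L + 16 * (33 * m%:R) ^+ 2 * t * L ^+ 2) * (K * (expR (lam * t) / lam)) +
    (64 * (33 * m%:R) ^+ 2 + 1024 * m%:R ^+ 2) * (M * t) ^+ 2 / k.+1%:R.
Proof.
pose D j l w := enorm (fine_int B HU t k l (j * l.+1) w - I j w).
have mD j l : measurable_fun setT (D j l).
  apply: measurable_enorm => i.
  rewrite (_ : (fun w => _) = (fun w => fine_int B HU t k l (j * l.+1) w i 0 - I j w i 0)).
    by apply: measurable_funB => //; exact: fine_int_measurable (ltW t0) aHU.
  by apply/funext => w; rewrite !mxE.
have [|||ln [_ cln]] := @cvg0_probability_subseq _ _ _ P (fun l w => (\sum_(j < k.+2) D j l w)%:E).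
- by move=> n; apply/measurable_EFinP; exact: measurable_sum.
- by move=> n w; rewrite lee_fin; apply: sumr_ge0 => j _; exact: enorm_ge0.
- by apply: cvg0_probability_sum => // j jk; apply: cI.
have fge l := fine_grid_energy HF HB aH aZ aW M0 t0 HM WM HW ZHW k l.
pose Ph l := sval (cid (fge l)).
have PhE l := svalP (cid (fge l)).
apply: (@ex_sqr_fatou _ _ _ P G Phi (fun n => Ph (ln n))) => //.
- by apply: runmax_measurable; exact: coarse_noise_measurable.
- by move=> w; exact: runmax_ge0.
- by move=> n; case: (PhE (ln n)).
- by move=> n w; case: (PhE (ln n)) => _ /(_ w 0%N (leq0n _)); rewrite !big_ord0 mulr0 addr0.
- apply: filterS cln => w cln Gw e e0.
  have cD j : (j <= k.+1)%N ->
      enorm (fine_int B H t k (ln n) (j * (ln n).+1) w - I j w) @[n --> \oo] --> (0 : R).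
    move=> jk.
    have -> : (fun n => enorm (fine_int B H t k (ln n) (j * (ln n).+1) w - I j w)) =
        (fun n => D j (ln n) w).
      apply/funext => n; rewrite /D; congr (enorm (_ - _)); apply/colP => i.
      rewrite !fine_int_entry; apply: eq_bigr => p _; apply: eq_bigr => b _.
      rewrite HUE//.
      suff : gridpt 0 t (k.+1 * (ln n).+1).-1 p \in `[0, t] by rewrite in_itv.
      apply: gridpt_itv; first exact: ltW.
      rewrite prednK ?muln_gt0//.
      by apply: leq_trans (ltnW (ltn_ord p)) _; rewrite leq_mul2r jk orbT.
    have /fine_cvgP[_ c0] := cln.
    apply: (squeeze_cvgr _ (cvg_cst 0) c0); apply: nearW => n /=.
    rewrite enorm_ge0/= (bigD1 (Ordinal (jk : (j < k.+2)%N)))//= lerDl.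
    by apply: sumr_ge0 => i _; exact: enorm_ge0.
  have cN := @coarse_noise_cvg Z I (fun j n => fine_int B H t k (ln n) (j * (ln n).+1)) t k k.+1 w cD.
  suff h J : (J <= k.+1)%N -> \forall n \near \oo,
      runmax (coarse_noise Z I t k ^~ w) J <= Ph (ln n) w + e by exact: h.
  elim: J => [_|J ih Jk] /=.
    apply: nearW => n; case: (PhE (ln n)) => _ /(_ w 0%N (leq0n _)).
    by rewrite !big_ord0 mulr0 addr0 => h _; rewrite addr_ge0// ltW.
  have := ih (ltnW Jk); have /cvgrPdist_lt/(_ _ e0) := cN J.+1 Jk.
  apply: filterS2 => n /= h1 h2; rewrite ge_max h2/=.
  move: h1; rewrite ltr_norml ltrBlDl => /andP[_ h1]; apply: le_trans (ltW h1) _; rewrite lerD2r.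
  case: (PhE (ln n)) => _ /(_ w _ Jk) + _; rewrite /coarse_noise.
  by under eq_bigr do rewrite gridpt_refine.
apply: nearW => n; case: (PhE (ln n)) => _ _ h; apply: (le_trans h).
rewrite lerD2r; apply: ler_wpM2l.
  by rewrite addr_ge0// !mulr_ge0 ?exprn_ge0 ?(ltW t0) ?mulr_ge0.
set N := (k.+1 * (ln n).+1)%N; have NE : N = N.-1.+1 by rewrite prednK// muln_gt0.
apply: (@le_trans _ _ (t / N%:R * \sum_(p < N) (K * expR (lam * gridpt 0 t N.-1 p)))).
  rewrite ler_wpM2l ?divr_ge0 ?(ltW t0)//; apply: ler_sum => p _; apply: WK.
  suff : gridpt 0 t N.-1 p \in `[0, t] by rewrite in_itv.
  by apply: gridpt_itv; [exact: ltW|rewrite -NE; exact: ltnW].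
rewrite -mulr_sumr mulrCA ler_wpM2l// NE; exact: exp_left_sum.
Qed.

End coarse_limit.

Section path_energy.
Context {R : realType} {d : nat}.
Local Notation mu := (@lebesgue_measure R).
Implicit Types (a z : R -> 'cV[R]_d) (s u v t : R).

Lemma segment_integrable (f : R -> R) v : {within `[0, v], continuous (f : R -> R^o)} ->
  mu.-integrable `[0, v] (EFin \o f).
Proof. by move=> cf; apply: continuous_compact_integrable => //; exact: segment_compact. Qed.

Lemma cst_continuous_within (A : set R) (c : R) : {within A, continuous (fun=> c : R^o)}.
Proof. by apply: continuous_subspaceT => x; exact: cst_continuous. Qed.

Lemma integral_increment_le (f : R -> R) u v c :
  {within `[0, v], continuous (f : R -> R^o)} -> 0 <= u -> u <= v ->
  (forall s, u <= s <= v -> f s <= c) ->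
  \int[mu]_(s in `[0, v]) f s - \int[mu]_(s in `[0, u]) f s <= c * (v - u).
Proof.
move=> cf u0 uv fc; have iF := segment_integrable cf.
have sub g : mu.-integrable `[0, v] g -> mu.-integrable `]u, v] g.
  apply: integrableS => // s /=; rewrite !in_itv/= => /andP[us ->].
  by rewrite (le_trans u0 (ltW us)).
rewrite Rintegral_itvB//.
have -> : c * (v - u) = \int[mu]_(s in `]u, v]) c.
  rewrite Rintegral_cst//; congr (_ * _).
  have := lebesgue_measure_itv `]u, v]; rewrite /= lte_fin => ->.
  by case: ltP => //= vu; have -> : u = v by [apply/le_anti; rewrite uv vu]; rewrite subrr.
apply: le_Rintegral => //.
- exact: sub iF.
- by apply: sub; apply: segment_integrable; exact: cst_continuous_within.
- by move=> s /=; rewrite in_itv/= => /andP[us sv]; apply: fc; rewrite ltW.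
Qed.

Variables (a z : R -> 'cV[R]_d) (t L : R) (Wf : R -> R) (Iu : R -> 'cV[R]_d).
Hypotheses (t0 : 0 < t) (ca : {within `[0, t], continuous a}) (cz : {within `[0, t], continuous z}).
Hypotheses (L0 : 0 <= L) (Wf0 : forall s, 0 <= s <= t -> 0 <= Wf s).
Hypothesis zaW : forall s u, 0 <= s -> s <= u -> u <= t -> 2 * dot (z s) (a s) <= L * Wf u.

Let entry_continuous v i : v <= t -> {within `[0, v], continuous (fun s => a s i 0 : R^o)}.
Proof.
move=> vt; apply: (@within_sub _ _ `[0, t]%classic `[0, v]%classic).
  by move=> s /=; rewrite !in_itv/= => /andP[-> sv]; exact: le_trans vt.
exact: (within_comp ca (@coord_continuous _ _ _ i 0)).
Qed.

Lemma dot_time_integral (p : 'cV[R]_d) v : v <= t ->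
  dot p (time_integral a v) = \int[mu]_(s in `[0, v]) dot p (a s).
Proof.
move=> vt; rewrite /dot /time_integral.
have iE i : mu.-integrable `[0, v] (EFin \o (fun s => a s i 0)).
  by apply: segment_integrable; exact: entry_continuous.
under eq_bigr do rewrite mxE -RintegralZl//.
suff h (l : seq 'I_d) : mu.-integrable `[0, v] (EFin \o (fun s => \sum_(i <- l) p i 0 * a s i 0)) /\
   \sum_(i <- l) \int[mu]_(s in `[0, v]) (p i 0 * a s i 0) =
   \int[mu]_(s in `[0, v]) \sum_(i <- l) p i 0 * a s i 0 by case: (h (index_enum _)).
elim: l => [|i l [il ih]].
  rewrite big_nil; split.
    by under [X in EFin \o X]eq_fun do rewrite big_nil; apply: segment_integrable; exact: cst_continuous_within.
  by under eq_Rintegral do rewrite big_nil; rewrite Rintegral_cst// mul0r.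
have iZ : mu.-integrable `[0, v] (EFin \o (fun s => p i 0 * a s i 0)).
  exact: (integrableZl _ _ (iE i)).
rewrite big_cons ih -RintegralD//; split; last first.
  by apply: eq_Rintegral => s _; rewrite big_cons.
under [X in EFin \o X]eq_fun do rewrite big_cons.
exact: (integrableD _ iZ il).
Qed.

Let dA u v p c : 0 <= u -> u <= v -> v <= t -> (forall s, u <= s <= v -> dot p (a s) <= c) ->
  dot p (time_integral a v - time_integral a u) <= c * (v - u).
Proof.
move=> u0 uv vt h; rewrite dotC dotDl -scaleN1r dotZl mulN1r !(dotC _ p).
rewrite !dot_time_integral ?(le_trans uv)//; apply: integral_increment_le => //.
have cd : continuous (dot p : 'cV[R]_d -> R).
  move=> w; rewrite /dot; apply: cvg_big => [||i _]; [exact: add_continuous|exact: nbhs_filter|].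
  by apply: (@cvgM _ _ (nbhs w) (nbhs_filter w)); [exact: cst_continuous|exact: coord_continuous].
apply: (@within_sub _ _ `[0, t]%classic `[0, v]%classic).
  by move=> s /=; rewrite !in_itv/= => /andP[-> sv]; exact: le_trans vt.
exact: (within_comp ca cd).
Qed.

Let Amax := supon (fun s => enorm (a s)) 0 t.

Let enorm_a s : 0 <= s <= t -> enorm (a s) <= Amax.
Proof.
move=> st; apply: (@supon_ge _ (fun s => enorm (a s))); first exact: ltW.
  exact: (within_comp ca (@enorm_continuous R d)).
by rewrite in_itv.
Qed.

Let Amax0 : 0 <= Amax.
Proof. by apply: le_trans (enorm_ge0 (a 0)) _; apply: enorm_a; rewrite lexx ltW. Qed.

Let sqr_dA u v : 0 <= u -> u <= v -> v <= t ->
  enorm (time_integral a v - time_integral a u) ^+ 2 <= d%:R * (Amax * (v - u)) ^+ 2.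
Proof.
move=> u0 uv vt; rewrite sqr_enorm /dot.
have -> : d%:R * (Amax * (v - u)) ^+ 2 = \sum_(i < d) (Amax * (v - u)) ^+ 2.
  by rewrite sumr_const card_ord mulr_natl.
apply: ler_sum => i _; set y := (time_integral a v - time_integral a u) i 0.
have : `|y| <= Amax * (v - u).
  have ye (c : R) : c * y = dot (c *: delta_mx i 0) (time_integral a v - time_integral a u).
    rewrite dotZl /dot (bigD1 i)//= big1 ?addr0.
      by rewrite [delta_mx _ _ _ _]mxE !eqxx mul1r.
    by move=> j ji; rewrite [delta_mx _ _ _ _]mxE (negbTE ji) mul0r.
  have b (c : R) : `|c| = 1 -> c * y <= Amax * (v - u).
    move=> c1; rewrite ye; apply: dA => // s /andP[us sv].
    rewrite dotZl /dot (bigD1 i)//= big1 ?addr0; last first.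
      by move=> j ji; rewrite !mxE (negbTE ji) mul0r.
    rewrite !mxE !eqxx mul1r; apply: le_trans (ler_norm _) _; rewrite normrM c1 mul1r.
    apply: le_trans (ler_entry_enorm _ _) _; apply: enorm_a.
    by rewrite (le_trans u0 us) (le_trans sv vt).
  rewrite ler_norml lerNl; apply/andP; split.
    by have := b (-1); rewrite mulN1r normrN normr1 => /(_ erefl).
  by have := b 1; rewrite mul1r normr1 => /(_ erefl).
by rewrite -expr2 -(real_normK (num_real y)) ler_pXn2r ?nnegrE ?mulr_ge0 ?subr_ge0.
Qed.

Let noise k j := 2 * \sum_(i < j) dot (z (gridpt 0 t k i))
    (Iu (gridpt 0 t k i.+1) - Iu (gridpt 0 t k i)) +
  2 * \sum_(i < j) enorm (Iu (gridpt 0 t k i.+1) - Iu (gridpt 0 t k i)) ^+ 2.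

Let g_itv k i : (i <= k.+1)%N -> 0 <= gridpt 0 t k i <= t.
Proof.
move=> ik; suff : gridpt 0 t k i \in `[0, t] by rewrite in_itv.
by apply: gridpt_itv => //; exact: ltW.
Qed.

Hypothesis zE : forall k j, (j <= k.+1)%N -> z (gridpt 0 t k j) =
  z 0 + time_integral a (gridpt 0 t k j) + Iu (gridpt 0 t k j).

Let energy_step k eta delta : 0 <= eta -> t / k.+1%:R < delta ->
  (forall s u, s \in `[0, t] -> u \in `[0, t] -> `|u - s| < delta -> `|z u - z s| < eta) ->
  forall j, (j <= k.+1)%N -> enorm (z (gridpt 0 t k j)) ^+ 2 <= enorm (z 0) ^+ 2 +
    L * (t / k.+1%:R * \sum_(i < j) Wf (gridpt 0 t k i.+1)) + noise k j +
    j%:R * (t / k.+1%:R) * (2 * (d%:R * eta * Amax) + 2 * (d%:R * Amax ^+ 2 * (t / k.+1%:R))).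
Proof.
move=> eta0 kd zd; set h := t / k.+1%:R; have h0 : 0 <= h by rewrite divr_ge0// ltW.
have gS i : gridpt 0 t k i.+1 - gridpt 0 t k i = h by rewrite gridptS subr0.
elim=> [_|j ih jk].
  by rewrite gridpt0 /noise !big_ord0 !mulr0 !mul0r !addr0.
have /andP[g0 gt] := g_itv (ltnW jk); have /andP[g1 gt1] := g_itv jk.
have gg : gridpt 0 t k j <= gridpt 0 t k j.+1 by rewrite -subr_ge0 gS.
set A := time_integral a (gridpt 0 t k j.+1) - time_integral a (gridpt 0 t k j).
set DI := Iu (gridpt 0 t k j.+1) - Iu (gridpt 0 t k j).
have zS : z (gridpt 0 t k j.+1) = z (gridpt 0 t k j) + (A + DI).
  rewrite (zE jk) (zE (ltnW jk)) /A /DI.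
  by apply/colP => i; rewrite !mxE; ring.
have dz : dot (2 *: z (gridpt 0 t k j)) A <=
    (L * Wf (gridpt 0 t k j.+1) + 2 * (d%:R * eta * Amax)) * h.
  rewrite -(gS j); apply: dA => // s /andP[js sj].
  have s0t : 0 <= s <= t by rewrite (le_trans g0 js) (le_trans sj gt1).
  have /andP[s0 st] := s0t.
  rewrite dotZl.
  have -> : dot (z (gridpt 0 t k j)) (a s) = dot (z s) (a s) +
      dot (z (gridpt 0 t k j) - z s) (a s) by rewrite -dotDl addrC subrK.
  rewrite mulrDr; apply: lerD; first exact: zaW.
  rewrite ler_pM2l//; apply: le_trans (dot_le _ _) _.
  apply: ler_pM; rewrite ?enorm_ge0 ?enorm_a//.
  apply: le_trans (enorm_le_norm _) _; apply: ler_wpM2l => //; apply: ltW.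
  apply: zd; rewrite ?in_itv//= ?g0 ?gt//.
  rewrite distrC ger0_norm ?subr_ge0//; apply: le_lt_trans kd.
  by rewrite -/h -(gS j) lerD2r.
have dA2 : enorm A ^+ 2 <= d%:R * (Amax * h) ^+ 2 by rewrite -(gS j); exact: sqr_dA.
have dAI := sqr_enormD_le A DI.
have dD : dot (z (gridpt 0 t k j)) (A + DI) =
    dot (z (gridpt 0 t k j)) A + dot (z (gridpt 0 t k j)) DI.
  by rewrite dotC dotDl !(dotC _ (z _)).
have nS : noise k j.+1 = noise k j + 2 * dot (z (gridpt 0 t k j)) DI + 2 * enorm DI ^+ 2.
  by rewrite /noise !big_ord_recr/= -/DI; ring.
rewrite zS sqr_enormD dD nS big_ord_recr/= -(natr1 j).
move: (ih (ltnW jk)) dz dA2 dAI; rewrite -/h dotZl exprMn.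
set S := \sum_(i < j) _; set w := Wf _; set x := enorm (z 0) ^+ 2.
set y := enorm (z _) ^+ 2; set n := noise k j; set p := dot _ A; set q := dot _ DI.
set ee := 2 * (d%:R * eta * Amax); set E2 := Amax ^+ 2.
move=> h1 h2 h3 h4.
have -> : x + L * (h * (S + w)) + (n + 2 * q + 2 * enorm DI ^+ 2) +
  (j%:R + 1) * h * (ee + 2 * (d%:R * E2 * h)) =
  (x + L * (h * S) + n + j%:R * h * (ee + 2 * (d%:R * E2 * h))) +
  ((L * w + ee) * h + 2 * q + (2 * (d%:R * (E2 * h ^+ 2)) + 2 * enorm DI ^+ 2)) by ring.
lra.
Qed.

Lemma path_energy (e : R) : 0 < e -> \forall k \near \oo,
  supon (fun s => enorm (z s) ^+ 2) 0 t <= enorm (z 0) ^+ 2 +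
    L * (t / k.+1%:R * \sum_(i < k.+1) Wf (gridpt 0 t k i.+1)) + runmax (noise k) k.+1 + e.
Proof.
move=> e0; have e4 : 0 < e / 4 by rewrite divr_gt0.
pose c1 := 2 * t * d%:R * Amax; pose c2 := 2 * t * d%:R * Amax ^+ 2.
have c10 : 0 <= c1 by rewrite !mulr_ge0// ltW.
have c20 : 0 <= c2 by rewrite !mulr_ge0 ?exprn_ge0// ltW.
have p1 : 0 < c1 + 1 by rewrite ltr_wpDl.
have p2 : 0 < c2 + 1 by rewrite ltr_wpDl.
pose eta := e / 4 / (c1 + 1); have eta0 : 0 < eta by rewrite divr_gt0.
have [delta d0 zd] := within_unif cz eta0.
pose h0 := Num.min delta (e / 4 / (c2 + 1)).
have h00 : 0 < h0 by rewrite lt_min d0 divr_gt0.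
have cz2 : {within `[0, t], continuous ((fun s => enorm (z s) ^+ 2) : R -> R^o)}.
  have cg : continuous (fun v : 'cV[R]_d => enorm v * enorm v : R^o).
    by move=> v; apply: (@cvgM _ _ (nbhs v) (nbhs_filter v)); exact: enorm_continuous.
  exact: (within_comp cz cg).
have e2 : 0 < e / 2 by rewrite divr_gt0.
have hk : \forall k \near \oo, (k.+1%:R^-1 : R) < h0 / t.
  by apply: (near_infty_natSinv_lt (PosNum _)); rewrite divr_gt0.
have /cvgrPdist_lt/(_ _ e2) := gridmax_cvg (ltW t0) cz2.
move: hk; apply: filterS2 => k /= hk; rewrite ltr_norml ltrBlDl => /andP[_ hs].
apply: le_trans (ltW hs) _.
have {}hk : t / k.+1%:R < h0 by rewrite mulrC -ltr_pdivlMr.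
have [hd hc] : t / k.+1%:R < delta /\ t / k.+1%:R < e / 4 / (c2 + 1).
  by move: hk; rewrite lt_min => /andP[].
rewrite -lerBrDr -addrA (_ : e - e / 2 = e / 2); last by lra.
suff h j : (j <= k.+1)%N -> enorm (z (gridpt 0 t k j)) ^+ 2 <= enorm (z 0) ^+ 2 +
    L * (t / k.+1%:R * \sum_(i < k.+1) Wf (gridpt 0 t k i.+1)) + runmax (noise k) k.+1 + e / 2.
  apply/bigmax_leP; split; first by have := h 0%N (leq0n _); rewrite gridpt0.
  by move=> i _; apply: h; rewrite -ltnS.
move=> jk; apply: le_trans (energy_step (ltW eta0) hd zd jk) _.
have k0 : 0 < k.+1%:R :> R by [].
have T0 : 0 <= t / k.+1%:R by rewrite divr_ge0// ltW.
have Wsum : \sum_(i < j) Wf (gridpt 0 t k i.+1) <= \sum_(i < k.+1) Wf (gridpt 0 t k i.+1).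
  rewrite -!(big_mkord xpredT (fun i => Wf (gridpt 0 t k i.+1))).
  rewrite [leRHS](big_cat_nat (leq0n j) jk)/= lerDl big_nat_cond.
  by apply: sumr_ge0 => i /andP[/andP[_ ik] _]; apply: Wf0; exact: g_itv.
apply: lerD; first apply: lerD; first rewrite lerD2l.
- by apply: ler_wpM2l => //; exact: ler_wpM2l.
- case: j jk {Wsum} => [_|j jk]; last by apply: runmax_ge; rewrite jk.
  by rewrite {1}/noise !big_ord0 mulr0 addr0 runmax_ge0.
have jT : j%:R * (t / k.+1%:R) <= t.
  by rewrite mulrCA ler_piMr ?(ltW t0)// ler_pdivrMr// mul1r ler_nat.
set x := t / k.+1%:R in T0 hc jT *.
apply: (@le_trans _ _ (t * (2 * (d%:R * eta * Amax) + 2 * (d%:R * Amax ^+ 2 * x)))).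
  apply: ler_wpM2r => //; apply: addr_ge0; apply: mulr_ge0 => //; apply: mulr_ge0 => //.
    by apply: mulr_ge0 => //; exact: ltW.
  by apply: mulr_ge0 => //; exact: sqr_ge0.
have -> : t * (2 * (d%:R * eta * Amax) + 2 * (d%:R * Amax ^+ 2 * x)) = c1 * eta + c2 * x.
  by rewrite /c1 /c2; ring.
have e1 : c1 * eta <= e / 4.
  by rewrite /eta mulrCA ler_piMr ?(ltW e4)// ler_pdivrMr// mul1r lerDl.
have e3 : c2 * x <= e / 4.
  apply: (@le_trans _ _ (c2 * (e / 4 / (c2 + 1)))); first by rewrite ler_wpM2l// ltW.
  by rewrite mulrCA ler_piMr ?(ltW e4)// ler_pdivrMr// mul1r lerDl.
by apply: le_trans (lerD e1 e3) _; lra.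
Qed.

End path_energy.

Section ito_fine.
Context {R : realType} {dT : measure_display} {T : measurableType dT}.
Variables (P : probability T R) (F : R -> set_system T) (d m : nat).
Variable B : R -> T -> 'cV[R]_m.
Hypotheses (HF : is_filtration F) (HB : is_brownian P F B).

Lemma gridpt_sub (t : R) k l j p : (0 < j)%N ->
  gridpt 0 (gridpt 0 t k j) (j * l.+1).-1 p = gridpt 0 t (k.+1 * l.+1).-1 p.
Proof.
move=> j0; rewrite /gridpt !prednK ?muln_gt0 ?j0// !natrM.
have : l.+1%:R != 0 :> R by rewrite pnatr_eq0.
have : k.+1%:R != 0 :> R by rewrite pnatr_eq0.
have : j%:R != 0 :> R by rewrite pnatr_eq0 -lt0n.
by move: (l.+1%:R : R) (k.+1%:R : R) (j%:R : R) (p%:R : R) => y x z q z0 x0 y0; field; rewrite x0 y0 z0.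
Qed.

Lemma ito_fine (H : R -> T -> 'M[R]_(d, m)) t k j (I : T -> 'cV[R]_d) : 0 < t -> (0 < j)%N ->
  (forall s, 0 <= s -> forall i b, adapted (F s) (fun w => H s w i b)) ->
  (forall w, {within `[0, gridpt 0 t k j], continuous (H ^~ w)}) ->
  is_ito_integral P F B H (gridpt 0 t k j) I ->
  cvg0_in_probability P (fun l w => (enorm (fine_int B H t k l (j * l.+1) w - I w))%:E).
Proof.
move=> t0 j0 aH cH iI e e0.
have a0 : 0 < gridpt 0 t k j by rewrite /gridpt add0r subr0 divr_gt0// mulr_gt0// ltr0n.
have := ito_grid HF HB aH a0 cH iI e0 => c.
have -> : (fun l => P [set w | e%:E <= (enorm (fine_int B H t k l (j * l.+1) w - I w))%:E]%E) =
  (fun n => P [set w | e <= enorm (sp_integral B (grid_step H (gridpt 0 t k j) n) w - I w)]) \o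
  (fun l => (j * l.+1).-1).
  apply/funext => l /=; congr (P _); apply/seteqP.
  suff E w : fine_int B H t k l (j * l.+1) w = sp_integral B (grid_step H (gridpt 0 t k j) (j * l.+1).-1) w.
    by split=> w /=; rewrite lee_fin E.
  apply/colP => i; rewrite fine_int_entry sp_integral_entry /= prednK ?muln_gt0 ?j0//.
  by apply: eq_bigr => p _; apply: eq_bigr => b _; rewrite !gridpt_sub.
apply: cvg_comp c => A [N _ hN]; exists N => // n /= Nn; apply: hN => /=.
rewrite -ltnS prednK ?muln_gt0 ?j0//; apply: leq_ltn_trans Nn _.
by rewrite -[X in (X <= _)%N]mul1n leq_mul.
Qed.

End ito_fine.

Section time_integral_linear.
Context {R : realType} {d : nat}.

Lemma time_integralD (a b : R -> 'cV[R]_d) v : {within `[0, v], continuous a} ->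
  {within `[0, v], continuous b} ->
  time_integral (fun s => a s + b s) v = time_integral a v + time_integral b v.
Proof.
move=> ca cb; apply/colP => i; rewrite !mxE -RintegralD//.
- by apply: eq_Rintegral => s _; rewrite mxE.
- exact/segment_integrable/(within_comp ca (@coord_continuous _ _ _ i 0)).
- exact/segment_integrable/(within_comp cb (@coord_continuous _ _ _ i 0)).
Qed.

Lemma time_integralB (a b : R -> 'cV[R]_d) v : {within `[0, v], continuous a} ->
  {within `[0, v], continuous b} ->
  time_integral (fun s => a s - b s) v = time_integral a v - time_integral b v.
Proof.
move=> ca cb; apply/colP => i; rewrite !mxE -RintegralB//.
- by apply: eq_Rintegral => s _; rewrite !mxE.
- exact/segment_integrable/(within_comp ca (@coord_continuous _ _ _ i 0)).
- exact/segment_integrable/(within_comp cb (@coord_continuous _ _ _ i 0)).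
Qed.

End time_integral_linear.

Section two_solutions.
Context {R : realType} {dT : measure_display} {T : measurableType dT}.
Variables (P : probability T R) (F : R -> set_system T) (d m : nat).
Variables (B : R -> T -> 'cV[R]_m) (r : {posnum R}).
Variables (f : 'cV[R]_d -> 'cV[R]_d) (g : Cseg r d -> 'cV[R]_d) (h : Cseg r d -> 'M[R]_(d, m)).
Hypotheses (HF : is_filtration F) (HB : is_brownian P F B).
Hypotheses (cf : continuous f) (cg : continuous g) (ch : continuous h).
Hypothesis h_bounded : forall K : R, exists M : R, forall x : Cseg r d,
  `|x| <= K -> hsnorm (h x) <= M.
Variable L : R.
Hypothesis L0 : 0 <= L.
Hypothesis mono : forall x y : Cseg r d,
  2 * Num.max (dot (f (x (now r)) - f (y (now r))) (x (now r) - y (now r))) 0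
  + 2 * Num.max (dot (g x - g y) (x (now r) - y (now r))) 0
  + hsnorm (h x - h y) ^+ 2 <= L * `|x - y| ^+ 2.
Variables (phi psi : Cseg r d) (x y : R -> T -> 'cV[R]_d).
Hypotheses (sx : is_solution P F B f g h phi x) (sy : is_solution P F B f g h psi y).
Local Notation Ex X := (\int[P]_w (X w)).

Let ax := solution_adapted_path HF sx.
Let ay := solution_adapted_path HF sy.
Let r0 : - r%:num <= 0. Proof. by rewrite oppr_le0. Qed.
Let cx w : {within `[- r%:num, +oo[, continuous (x ^~ w)}.
Proof. exact: (solution_continuous sx). Qed.
Let cy w : {within `[- r%:num, +oo[, continuous (y ^~ w)}.
Proof. exact: (solution_continuous sy). Qed.

Definition path_diff (s : R) w : 'cV[R]_d := x s w - y s w.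
Definition sup_diff (s : R) w : R := supon (fun u => enorm (path_diff u w) ^+ 2) (- r%:num) s.
Definition bounded_until (R0 s : R) : set T := [set w |
  supon (fun u => enorm (x u w)) (- r%:num) s <= R0 /\
  supon (fun u => enorm (y u w)) (- r%:num) s <= R0].

Let within_to (s : R) (q : R -> 'cV[R]_d) : {within `[- r%:num, +oo[, continuous q} ->
  {within `[- r%:num, s], continuous q}.
Proof. by apply: within_sub => u /=; rewrite !in_itv/= andbT => /andP[]. Qed.

Let cz w : {within `[- r%:num, +oo[, continuous (path_diff ^~ w)}.
Proof.
by move=> u; apply: (@cvgB _ _ _ (nbhs u) (nbhs_filter u)); [exact: cx|exact: cy].
Qed.

Let cez w (s : R) : {within `[- r%:num, s], continuous ((fun u => enorm (path_diff u w) ^+ 2) : R -> R^o)}.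
Proof.
have cg' : continuous (fun v : 'cV[R]_d => enorm v * enorm v : R^o).
  by move=> v; apply: (@cvgM _ _ (nbhs v) (nbhs_filter v)); exact: enorm_continuous.
exact: (within_comp (@within_to s _ (@cz w)) cg').
Qed.

Lemma sup_diff_ge (s u : R) w : - r%:num <= u <= s -> enorm (path_diff u w) ^+ 2 <= sup_diff s w.
Proof.
move=> us; apply: (@supon_ge _ (fun u => enorm (path_diff u w) ^+ 2)); last by rewrite in_itv.
  by case/andP: us; exact: le_trans.
exact: cez.
Qed.

Lemma sup_diff_ge0 (s : R) w : 0 <= s -> 0 <= sup_diff s w.
Proof.
move=> s0; apply: le_trans (sqr_ge0 (enorm (path_diff 0 w))) _; apply: sup_diff_ge.
by rewrite r0.
Qed.

Lemma sup_diff_le (s : R) w c : 0 <= s ->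
  (forall u, - r%:num <= u <= s -> enorm (path_diff u w) ^+ 2 <= c) -> sup_diff s w <= c.
Proof.
move=> s0 hc; apply: supon_le; [exact: le_trans s0|exact: cez|].
by move=> u; rewrite in_itv; exact: hc.
Qed.

Lemma sup_diff_homo (s u : R) w : 0 <= s -> s <= u -> sup_diff s w <= sup_diff u w.
Proof.
move=> s0 su; apply: sup_diff_le => // v /andP[v1 v2]; apply: sup_diff_ge.
by rewrite v1 (le_trans v2 su).
Qed.

Lemma segment_diff_le (s : R) w : 0 <= s ->
  `|segment r (x ^~ w) s - segment r (y ^~ w) s| ^+ 2 <= sup_diff s w.
Proof.
move=> s0; have S0 := sup_diff_ge0 w s0.
rewrite -[leRHS]sqr_sqrtr// ler_pXn2r ?nnegrE ?sqrtr_ge0//.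
apply: segment_normB => // u /andP[u1 u2].
rewrite -(@ler_pXn2r _ 2) ?nnegrE ?enorm_ge0 ?sqrtr_ge0// (sqr_sqrtr S0).
apply: (@sup_diff_ge s u w); rewrite u2 andbT (le_trans _ u1)//.
by rewrite lerDr.
Qed.


Lemma bounded_until_homo R0 (s u : R) w : 0 <= s -> s <= u ->
  bounded_until R0 u w -> bounded_until R0 s w.
Proof.
have mon (q : R -> 'cV[R]_d) (c : {within `[- r%:num, +oo[, continuous q}) : 0 <= s -> s <= u ->
    supon (fun u => enorm (q u)) (- r%:num) s <= supon (fun u => enorm (q u)) (- r%:num) u.
  move=> s0 su; apply: supon_le; first exact: le_trans s0.
    exact: (within_comp (@within_to s _ c) (@enorm_continuous R d)).
  move=> v; rewrite in_itv/= => /andP[v1 v2]; apply: (@supon_ge _ (fun u => enorm (q u))).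
  - exact: le_trans (le_trans s0 su).
  - exact: (within_comp (@within_to u _ c) (@enorm_continuous R d)).
  - by rewrite in_itv/= v1 (le_trans v2 su).
move=> s0 su [b1 b2]; split; [apply: le_trans b1|apply: le_trans b2]; apply: mon => //.
Qed.

Lemma bounded_until_le R0 (s u : R) w : 0 <= s -> bounded_until R0 s w -> - r%:num <= u <= s ->
  enorm (x u w) <= R0 /\ enorm (y u w) <= R0.
Proof.
have le (q : R -> 'cV[R]_d) (c : {within `[- r%:num, +oo[, continuous q}) : 0 <= s ->
    - r%:num <= u <= s -> enorm (q u) <= supon (fun u => enorm (q u)) (- r%:num) s.
  move=> s0 us; apply: (@supon_ge _ (fun u => enorm (q u))); last by rewrite in_itv.
    exact: le_trans s0.
  exact: (within_comp (@within_to s _ c) (@enorm_continuous R d)).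
by move=> s0 [b1 b2] us; split; [apply: le_trans b1|apply: le_trans b2]; apply: le.
Qed.

Let F_sub u s : 0 <= s -> - r%:num <= u <= s -> forall i,
  adapted (F s) (fun w => x u w i 0) /\ adapted (F s) (fun w => y u w i 0).
Proof. by move=> s0 us i; split; [apply: (ap_adapted ax)|apply: (ap_adapted ay)]. Qed.

Lemma adapted_enorm (G : set_system T) (V : T -> 'cV[R]_d) :
  (forall i, adapted G (fun w => V w i 0)) -> adapted G (fun w => enorm (V w)).
Proof.
move=> aV; have aD : adapted G (fun w => dot (V w) (V w)).
  by apply: adapted_sum => i _; apply: measurable_funM; exact: aV.
exact: (measurableT_comp (continuous_measurable_fun (@sqrt_continuous R)) aD).
Qed.

Lemma path_diff_adapted (s u : R) i : 0 <= s -> - r%:num <= u <= s ->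
  adapted (F s) (fun w => path_diff u w i 0).
Proof.
move=> s0 us; have [a1 a2] := F_sub s0 us i.
by rewrite /path_diff; under eq_fun do rewrite !mxE; apply: measurable_funB.
Qed.

Lemma sup_diff_adapted (s : R) : 0 <= s -> adapted (F s) (sup_diff s).
Proof.
move=> s0; apply: supon_adapted; first exact: le_trans s0.
  by move=> w; exact: cez.
move=> u; rewrite in_itv/= => us; apply: measurable_funX; apply: adapted_enorm => i.
exact: path_diff_adapted.
Qed.

Lemma bounded_until_F R0 (s : R) : 0 <= s -> F s (bounded_until R0 s).
Proof.
move=> s0; have sF := filtration_sigma_algebra HF s0.
have a1 : adapted (F s) (fun w => supon (fun u => enorm (x u w)) (- r%:num) s).
  apply: supon_adapted; first exact: le_trans s0.
    move=> w; exact: (within_comp (@within_to s _ (@cx w)) (@enorm_continuous R d)).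
  move=> u; rewrite in_itv/= => us; apply: adapted_enorm => i; by case: (F_sub s0 us i).
have a2 : adapted (F s) (fun w => supon (fun u => enorm (y u w)) (- r%:num) s).
  apply: supon_adapted; first exact: le_trans s0.
    move=> w; exact: (within_comp (@within_to s _ (@cy w)) (@enorm_continuous R d)).
  move=> u; rewrite in_itv/= => us; apply: adapted_enorm => i; by case: (F_sub s0 us i).
pose b w := Num.max (supon (fun u => enorm (x u w)) (- r%:num) s)
  (supon (fun u => enorm (y u w)) (- r%:num) s).
have -> : bounded_until R0 s = [set w | b w <= R0].
  apply/seteqP; split=> w /=; rewrite /bounded_until /b /= ge_max; first by case=> -> ->.
  by case/andP.
by apply: adapted_le_set => //; exact: measurable_maxr.
Qed.

Lemma diffusion_adapted (z : R -> T -> 'cV[R]_d) (s : R) i b : adapted_path F r z -> 0 <= s ->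
  adapted (F s) (fun w => h (segment r (z ^~ w) s) i b).
Proof.
move=> az s0; have := segment_borel HF az s0 (psi := fun v : Cseg r d => h v i b).
apply=> v; apply: (@continuous_comp _ _ _ h (fun M => M i b)); first exact: ch.
exact: coord_continuous.
Qed.

Lemma path_diff_init : {ae P, forall w u, - r%:num <= u <= 0 ->
  enorm (path_diff u w) <= `|phi - psi|}.
Proof.
have := solution_init sx; have := solution_init sy; apply: filterS2 => w e1 e2 u ur.
have uI : u \in delay_itv r by rewrite inE /delay_itv/= in_itv.
have := enorm_le_Cseg_norm (phi - psi) (exist _ u uI).
rewrite -[(phi - psi) _]/(phi (exist _ u uI) - psi (exist _ u uI)) -e1 -e2.
by rewrite !segmentE// !add0r.
Qed.


Definition diffusion_diff (s : R) w : 'M[R]_(d, m) :=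
  h (segment r (x ^~ w) s) - h (segment r (y ^~ w) s).

Definition drift_diff (s : R) w : 'cV[R]_d :=
  (f (x s w) - f (y s w)) + (g (segment r (x ^~ w) s) - g (segment r (y ^~ w) s)).

Let segment_now (z : R -> T -> 'cV[R]_d) (s : R) w : {within `[- r%:num, +oo[, continuous (z ^~ w)} ->
  0 <= s -> segment r (z ^~ w) s (now r) = z s w.
Proof. by move=> c s0; rewrite segmentE//= addr0. Qed.

Lemma monotone_paths (s u : R) w : 0 <= s -> s <= u ->
  2 * dot (path_diff s w) (drift_diff s w) <= L * sup_diff u w /\
  hsnorm (diffusion_diff s w) ^+ 2 <= L * sup_diff u w.
Proof.
move=> s0 su.
have := mono (segment r (x ^~ w) s) (segment r (y ^~ w) s).
rewrite !segment_now// -/(diffusion_diff s w) -/(path_diff s w).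
have S := ler_wpM2l L0 (le_trans (segment_diff_le w s0) (sup_diff_homo w s0 su)).
move=> /le_trans/(_ S).
rewrite [dot _ (drift_diff s w)]dotC {1}/drift_diff [dot (_ - _ + _) _]dotDl.
set a := dot (f _ - f _) _; set b := dot (g _ - g _) _; have := sqr_ge0 (hsnorm (diffusion_diff s w)).
have a1 : a <= Num.max a 0 by rewrite le_max lexx.
have b1 : b <= Num.max b 0 by rewrite le_max lexx.
have a2 : 0 <= Num.max a 0 by rewrite le_max lexx orbT.
have b2 : 0 <= Num.max b 0 by rewrite le_max lexx orbT.
by split; lra.
Qed.

Let nonneg_sub (v : R) (q : R -> 'cV[R]_d) : {within `[- r%:num, +oo[, continuous q} ->
  {within `[0, v], continuous q}.
Proof.
apply: within_sub => u /=; rewrite !in_itv/= andbT => /andP[u0 _].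
exact: le_trans u0.
Qed.

Let drift_parts (v : R) w :
  [/\ {within `[0, v], continuous (fun s => f (x s w))},
      {within `[0, v], continuous (fun s => f (y s w))},
      {within `[0, v], continuous (fun s => g (segment r (x ^~ w) s))} &
      {within `[0, v], continuous (fun s => g (segment r (y ^~ w) s))}].
Proof.
split.
- exact: (within_comp (nonneg_sub (@cx w)) cf).
- exact: (within_comp (nonneg_sub (@cy w)) cf).
- exact: (within_comp (segment_continuous (@cx w)) cg).
- exact: (within_comp (segment_continuous (@cy w)) cg).
Qed.

Lemma drift_diff_continuous (v : R) w : {within `[0, v], continuous (drift_diff ^~ w)}.
Proof.
have [c1 c2 c3 c4] := drift_parts v w => u.
apply: (@cvgD _ _ _ (nbhs u) (nbhs_filter u));
  apply: (@cvgB _ _ _ (nbhs u) (nbhs_filter u)); [exact: c1|exact: c2|exact: c3|exact: c4].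
Qed.

Lemma diffusion_diff_adapted (s : R) : 0 <= s -> forall i b,
  adapted (F s) (fun w => diffusion_diff s w i b).
Proof.
move=> s0 i b.
rewrite (_ : (fun w => _) = (fun w => h (segment r (x ^~ w) s) i b - h (segment r (y ^~ w) s) i b)).
  by apply: measurable_funB; exact: diffusion_adapted.
by apply/funext => w; rewrite !mxE.
Qed.

Lemma ito_diff : exists Iu : R -> T -> 'cV[R]_d, [/\
  (forall w, Iu 0 w = 0), (forall u i, measurable_fun setT (fun w => Iu u w i 0)),
  (forall t k j, 0 < t -> cvg0_in_probability P (fun l w =>
     (enorm (fine_int B diffusion_diff t k l (j * l.+1) w - Iu (gridpt 0 t k j) w))%:E)) &
  (forall u, 0 <= u -> {ae P, forall w, path_diff u w =
     path_diff 0 w + time_integral (drift_diff ^~ w) u + Iu u w})].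
Proof.
have ex u : exists J : (T -> 'cV[R]_d) * (T -> 'cV[R]_d), 0 < u ->
   [/\ is_ito_integral P F B (fun s w => h (segment r (x ^~ w) s)) u J.1,
       is_ito_integral P F B (fun s w => h (segment r (y ^~ w) s)) u J.2 &
       {ae P, forall w, path_diff u w =
         path_diff 0 w + time_integral (drift_diff ^~ w) u + (J.1 w - J.2 w)}].
  have [u0|u0] := ltP 0 u; last by exists (fun=> 0, fun=> 0).
  have [I1 i1 e1] := solution_eq sx u0; have [I2 i2 e2] := solution_eq sy u0.
  exists (I1, I2) => _; split=> //=; move: e1 e2; apply: filterS2 => w e1 e2.
  have [c1 c2 c3 c4] := drift_parts u w.
  rewrite {1}/path_diff e1 e2 /drift_diff time_integralD.
  - rewrite !time_integralB//; apply/colP => i; rewrite /path_diff.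
    move: (time_integral _ _) (time_integral _ _) (time_integral _ _) (time_integral _ _) => p1 p2 p3 p4.
    by rewrite !mxE; ring.
  - by move=> v; apply: (@cvgB _ _ _ (nbhs v) (nbhs_filter v)); [exact: c1|exact: c2].
  - by move=> v; apply: (@cvgB _ _ _ (nbhs v) (nbhs_filter v)); [exact: c3|exact: c4].
pose J u := sval (cid (ex u)); have JE u := svalP (cid (ex u)).
pose Iu u w := if 0 < u then (J u).1 w - (J u).2 w else 0.
have IuE u w : 0 < u -> Iu u w = (J u).1 w - (J u).2 w.
  by move=> u0; rewrite /Iu u0.
have mJ u : 0 < u -> forall i, measurable_fun setT (fun w => (J u).1 w i 0) /\
    measurable_fun setT (fun w => (J u).2 w i 0).
  move=> u0 i; have [[m1 _] [m2 _] _] := JE u u0.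
  have me (V : T -> 'cV[R]_d) : measurable_wrt measurable V -> measurable_fun setT (fun w => V w i 0).
    move=> mV; apply: (@adapted_measurable _ _ _ (@measurable _ T)) => //.
    exact: (measurable_wrt_continuous mV (@coord_continuous _ _ _ i 0)).
  by split; exact: me.
exists Iu; split.
- by move=> w; rewrite /Iu ltxx.
- move=> u i; have [u0|u0] := boolP (0 < u); last first.
    rewrite (_ : (fun w => _) = (fun=> 0)); first exact: measurable_cst.
    by apply/funext => w; rewrite /Iu (negbTE u0) mxE.
  rewrite (_ : (fun w => _) = (fun w => (J u).1 w i 0 - (J u).2 w i 0)).
    by have [m1 m2] := mJ u u0 i; exact: measurable_funB.
  by apply/funext => w; rewrite /Iu u0 !mxE.
- move=> t k [|j] t0.
    move=> e e0; rewrite (_ : (fun _ => _) = (fun=> 0%E)); first exact: cvg_cst.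
    apply/funext => l; rewrite -(measure0 P); congr (P _); apply/seteqP; split=> w //=.
    rewrite /Iu gridpt0 ltxx subr0 mul0n (_ : fine_int _ _ _ _ _ _ _ = 0).
      by rewrite /enorm /dot big1 ?sqrtr0 ?lee_fin ?leNgt ?e0// => i _; rewrite mxE mulr0.
    by apply/colP => i; rewrite fine_int_entry big_ord0 mxE.
  set u := gridpt 0 t k j.+1.
  have u0 : 0 < u by rewrite /u /gridpt add0r subr0 divr_gt0// mulr_gt0// ltr0n.
  have [i1 i2 _] := JE u u0.
  have ch' (q : R -> T -> 'cV[R]_d) w : {within `[- r%:num, +oo[, continuous (q ^~ w)} ->
      {within `[0, u], continuous (fun s => h (segment r (q ^~ w) s))}.
    by move=> c; exact: (within_comp (segment_continuous c) ch).
  have c1 := ito_fine HF HB t0 (ltn0Sn j) (fun s s0 i b => diffusion_adapted i b ax s0)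
    (fun w => ch' x w (@cx w)) i1.
  have c2 := ito_fine HF HB t0 (ltn0Sn j) (fun s s0 i b => diffusion_adapted i b ay s0)
    (fun w => ch' y w (@cy w)) i2.
  have mD (q : R -> T -> 'cV[R]_d) (V : T -> 'cV[R]_d) l : adapted_path F r q -> (forall i, measurable_fun setT (fun w => V w i 0)) ->
      measurable_fun setT (fun w => enorm
        (fine_int B (fun s w => h (segment r (q ^~ w) s)) t k l (j.+1 * l.+1) w - V w)).
    move=> aq mV; apply: measurable_enorm => i.
    rewrite (_ : (fun w => _) = (fun w => fine_int B (fun s w => h (segment r (q ^~ w) s))
       t k l (j.+1 * l.+1) w i 0 - V w i 0)); last by apply/funext => w; rewrite !mxE.
    apply: measurable_funB => //; apply: (fine_int_measurable HF HB _ _ _ _ (ltW t0)).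
    by move=> s s0 i' b; exact: diffusion_adapted.
  have := cvg0_probabilityD (fun l => mD x _ l ax (fun i => (mJ u u0 i).1))
    (fun l => mD y _ l ay (fun i => (mJ u u0 i).2)) c1 c2.
  move=> c e e0; have {}c := c e e0.
  apply: (squeeze_cvge _ (cvg_cst 0%E) c); apply: nearW => l; rewrite measure_ge0/=.
  have mS (V : T -> R) : measurable_fun setT V -> measurable [set w | (e%:E <= (V w)%:E)%E].
    move=> mV; rewrite (_ : [set w | _] = [set w | e <= V w]); first exact: measurable_ge_set.
    by apply/seteqP; split=> w /=; rewrite lee_fin.
  apply: le_measure; rewrite ?inE.
  + apply: mS; apply: measurable_enorm => i.
    rewrite (_ : (fun w => _) = (fun w => fine_int B diffusion_diff t k l (j.+1 * l.+1) w i 0 -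
       ((J u).1 w i 0 - (J u).2 w i 0))); last by apply/funext => w; rewrite /Iu u0 !mxE.
    have [m1 m2] := mJ u u0 i; apply: measurable_funB; last exact: measurable_funB.
    apply: (fine_int_measurable HF HB _ _ _ _ (ltW t0)); exact: diffusion_diff_adapted.
  + apply: mS; apply: measurable_funD.
      by apply: mD => // i; case: (mJ u u0 i).
    by apply: mD => // i; case: (mJ u u0 i).
  + move=> w /=; rewrite !lee_fin => /le_trans; apply.
    set V1 := fine_int _ _ _ _ _ _ _ - (J u).1 w; set V2 := fine_int _ _ _ _ _ _ _ - (J u).2 w.
    rewrite (_ : _ - _ = V1 + - V2); last first.
      apply/colP => i; rewrite /Iu u0.
      have E : fine_int B diffusion_diff t k l (j.+1 * l.+1) w i 0 =
        fine_int B (fun s w => h (segment r (x ^~ w) s)) t k l (j.+1 * l.+1) w i 0 -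
        fine_int B (fun s w => h (segment r (y ^~ w) s)) t k l (j.+1 * l.+1) w i 0.
        rewrite !fine_int_entry -sumrB; apply: eq_bigr => p _; rewrite -sumrB.
        by apply: eq_bigr => b _; rewrite /diffusion_diff !mxE mulrBl.
      rewrite mxE E /V1 /V2.
      move: (fine_int _ _ _ _ _ _ _) (fine_int _ _ _ _ _ _ _) => n1 n2.
      by rewrite !mxE; ring.
    by apply: le_trans (ler_enormD _ _) _; rewrite enormN.
- move=> u; rewrite le_eqVlt => /predU1P[<-|u0].
    apply: aeW => w; rewrite /Iu ltxx addr0 (_ : time_integral _ _ = 0) ?addr0//.
    by apply/colP => i; rewrite !mxE set_itv1 Rintegral_set1.
  by have [_ _] := JE u u0; apply: filterS => w e1; rewrite {1}e1 IuE.
Qed.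


Section truncation.
Variable R0 : R.
Hypothesis R00 : 0 <= R0.
Let ind (s : R) w : R := \1_(bounded_until R0 s) w.

Definition trunc_sup (s : R) w : R := ind s w * sup_diff s w.

Let indP (s : R) w : (bounded_until R0 s w /\ ind s w = 1) \/ ind s w = 0.
Proof.
rewrite /ind indicE; have [b|b] := pselect (bounded_until R0 s w).
  by left; rewrite mem_set.
by right; rewrite memNset.
Qed.

Let tH (s : R) w := ind s w *: diffusion_diff s w.
Let tZ (s : R) w := ind s w *: path_diff s w.

Let ind_adapted (s : R) : 0 <= s -> adapted (F s) (ind s).
Proof.
move=> s0; have sF := filtration_sigma_algebra HF s0.
exact: (adapted_setP sF (bounded_until_F R0 s0)).
Qed.

Let aH (s : R) : 0 <= s -> forall i b, adapted (F s) (fun w => tH s w i b).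
Proof.
move=> s0 i b; under eq_fun do rewrite mxE.
by apply: measurable_funM; [exact: ind_adapted|exact: diffusion_diff_adapted].
Qed.

Let aZ (s : R) : 0 <= s -> forall i, adapted (F s) (fun w => tZ s w i 0).
Proof.
move=> s0 i; under eq_fun do rewrite mxE.
apply: measurable_funM; [exact: ind_adapted|apply: path_diff_adapted => //].
by rewrite lexx andbT (le_trans r0).
Qed.

Let aW (s : R) : 0 <= s -> adapted (F s) (trunc_sup s).
Proof. by move=> s0; apply: measurable_funM; [exact: ind_adapted|exact: sup_diff_adapted]. Qed.

Let trunc_bounds : exists2 M : R, 0 <= M &
  (forall (s : R) w, 0 <= s -> hsnorm (tH s w) ^+ 2 <= M) /\
  (forall (s : R) w, 0 <= s -> 0 <= trunc_sup s w <= M).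
Proof.
have [Mh hM] := h_bounded R0.
exists (4 * Mh ^+ 2 + 4 * R0 ^+ 2); first by rewrite addr_ge0// mulr_ge0 ?sqr_ge0.
have p1 := sqr_ge0 Mh; have p2 := sqr_ge0 R0.
split=> s w s0; rewrite /tH /trunc_sup; have [[b ->]|->] := indP s w.
- rewrite scale1r.
  have := sqr_hsnormB_le (h (segment r (x ^~ w) s)) (h (segment r (y ^~ w) s)) 0.
  rewrite subr0 sub0r -[X in _ + _ * hsnorm X ^+ 2]scaleN1r sqr_hsnormZ sqrrN expr1n mul1r.
  move=> /le_trans; apply.
  have n1 : hsnorm (h (segment r (x ^~ w) s)) <= Mh.
    apply: hM; apply: segment_norm => // u /andP[u1 u2].
    by case: (bounded_until_le s0 b (u := u)); rewrite // u2 (le_trans _ u1)// lerDr.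
  have n2 : hsnorm (h (segment r (y ^~ w) s)) <= Mh.
    apply: hM; apply: segment_norm => // u /andP[u1 u2].
    by case: (bounded_until_le s0 b (u := u)); rewrite // u2 (le_trans _ u1)// lerDr.
  have Mh0 : 0 <= Mh by apply: le_trans n1; exact: hsnorm_ge0.
  have sq (a : R) : 0 <= a -> a <= Mh -> 2 * a ^+ 2 <= 2 * Mh ^+ 2.
    by move=> a0 aM; rewrite ler_pM2l// ler_pXn2r ?nnegrE.
  apply: (@le_trans _ _ (2 * Mh ^+ 2 + 2 * Mh ^+ 2)); first by rewrite lerD ?sq ?hsnorm_ge0.
  by rewrite -mulrDl -natrD lerDl mulr_ge0.
- by rewrite scale0r /hsnorm mul0mx mxtrace0 sqrtr0 expr0n/= addr_ge0// mulr_ge0.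
- rewrite mul1r sup_diff_ge0//=; apply: sup_diff_le => // u us.
  have [b1 b2] := bounded_until_le s0 b us.
  have : enorm (path_diff u w) <= R0 + R0.
    by apply: le_trans (ler_enormD _ _) _; rewrite enormN lerD.
  rewrite -(@ler_pXn2r _ 2) ?nnegrE ?enorm_ge0 ?addr_ge0// => /le_trans; apply.
  rewrite (_ : (R0 + R0) ^+ 2 = 4 * R0 ^+ 2); last by ring.
  by rewrite lerDr mulr_ge0.
- by rewrite mul0r lexx/= addr_ge0// mulr_ge0.
Qed.

Let HW (s : R) w : 0 <= s -> hsnorm (tH s w) ^+ 2 <= L * trunc_sup s w.
Proof.
move=> s0; rewrite /tH /trunc_sup; have [[b ->]|->] := indP s w.
  by rewrite scale1r mul1r; case: (monotone_paths w s0 (lexx s)).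
by rewrite scale0r mul0r mulr0 /hsnorm mul0mx mxtrace0 sqrtr0 expr0n.
Qed.

Let ZHW (s u : R) w : 0 <= s -> s <= u ->
  enorm (tZ s w) ^+ 2 * hsnorm (tH u w) ^+ 2 <= L * trunc_sup u w ^+ 2.
Proof.
move=> s0 su; have u0 := le_trans s0 su.
have Zs : enorm (tZ s w) ^+ 2 <= sup_diff u w.
  have := @sup_diff_ge u s w; rewrite su (le_trans r0 s0) => /(_ isT) zs.
  rewrite /tZ; have [[_ ->]|->] := indP s w; first by rewrite scale1r.
  by rewrite scale0r sqr_enorm /dot big1 ?sup_diff_ge0// => i _; rewrite mxE mulr0.
rewrite /tH /trunc_sup; have [[b ->]|->] := indP u w.
  rewrite scale1r mul1r; have [_ hd] := monotone_paths w u0 (lexx u).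
  rewrite (_ : L * sup_diff u w ^+ 2 = sup_diff u w * (L * sup_diff u w)); last by ring.
  by apply: ler_pM => //; exact: sqr_ge0.
by rewrite scale0r mul0r /hsnorm mul0mx mxtrace0 sqrtr0 expr0n/= !mulr0.
Qed.

Definition growth_cst (Tm : R) : R := 3 * (L ^+ 2 * Tm * expR 1) +
  3 * (64 * (33 * m%:R) * L + 16 * (33 * m%:R) ^+ 2 * Tm * L ^+ 2).

Lemma trunc_step (lam K t Tm : R) : 0 < lam -> 0 <= K -> 0 < t -> t <= Tm ->
  (forall s, 0 <= s <= t -> Ex (fun w => trunc_sup s w ^+ 2) <= K * expR (lam * s)) ->
  Ex (fun w => trunc_sup t w ^+ 2) <=
    3 * `|phi - psi| ^+ 4 + growth_cst Tm * (K * (expR (lam * t) / lam)).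
Proof.
move=> lam0 K0 t0 tT WK; have t0' := ltW t0.
have [M M0 [HM WM]] := trunc_bounds.
have [Iu [Iu0 mIu cIu eIu]] := ito_diff.
have aHU s : 0 <= s -> forall i b, adapted (F s) (fun w => diffusion_diff s w i b).
  exact: diffusion_diff_adapted.
pose G := bounded_until R0 t; pose D2 := `|phi - psi| ^+ 2.
have mG : measurable G by apply: (filtration_measurable HF t0'); exact: bounded_until_F.
have HUE w : G w -> forall s, 0 <= s <= t -> tH s w = diffusion_diff s w.
  move=> Gw s /andP[s0 st]; rewrite /tH /ind indicE mem_set ?scale1r//.
  exact: bounded_until_homo Gw.
pose Phi k w := runmax (coarse_noise tZ (fun j => Iu (gridpt 0 t k j)) t k ^~ w) k.+1.
pose c1 := 64 * (33 * m%:R) * L + 16 * (33 * m%:R) ^+ 2 * t * L ^+ 2.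
pose c2 := (64 * (33 * m%:R) ^+ 2 + 1024 * m%:R ^+ 2) * (M * t) ^+ 2.
pose E := K * (expR (lam * t) / lam).
have E0 : 0 <= E by rewrite mulr_ge0// divr_ge0 ?expR_ge0// ltW.
have noiseP k : rint P (fun w => \1_G w * Phi k w ^+ 2) /\
    Ex (fun w => \1_G w * Phi k w ^+ 2) <= c1 * E + c2 / k.+1%:R.
  apply: (@coarse_noise_sqr _ _ _ P F d m B HF HB tH diffusion_diff tZ trunc_sup L M t) => //.
  by move=> j jk; exact: cIu.
have g_itv k i : (i <= k.+1)%N -> 0 <= gridpt 0 t k i <= t.
  move=> ik; suff : gridpt 0 t k i \in `[0, t] by rewrite in_itv.
  exact: gridpt_itv.
have sW s : 0 <= s -> sqint P (trunc_sup s).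
  move=> s0; apply: (@sqint_bounded _ _ _ _ _ M); first exact: (F_measurable HF s0 (aW s0)).
  by move=> w; have /andP[w0 wM] := WM s w s0; rewrite ger0_norm.
pose S k w := \sum_(i < k.+1) trunc_sup (gridpt 0 t k i.+1) w.
have sS k : sqint P (S k).
  by apply: sqint_sum => i _; apply: sW; case/andP: (g_itv k i.+1 (ltn_ord i)).
pose Y k w := D2 + L * (t / k.+1%:R * S k w) + \1_G w * Phi k w.
have mPhi k : measurable_fun setT (Phi k).
  apply: runmax_measurable => j.
  by apply: (coarse_noise_measurable HF) => //.
have G01 w : \1_G w ^+ 2 = \1_G w :> R.
  by rewrite indicE; case: (w \in G); rewrite ?expr1n ?expr0n.
have sPhi k : sqint P (fun w => \1_G w * Phi k w).
  split; first by apply: measurable_funM => //; exact: measurable_indic.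
  by under eq_fun do rewrite exprMn G01; case: (noiseP k).
have sD : sqint P (fun=> D2) by apply: (@sqint_bounded _ _ _ _ _ `|D2|).
have sY k : sqint P (Y k).
  by apply: sqintD => //; apply: sqintD => //; do 2 apply: sqintZ.
have S0 k w : 0 <= S k w.
  by apply: sumr_ge0 => i _; case/andP: (g_itv k i.+1 (ltn_ord i)) => i0 _; case/andP: (WM _ w i0).
have Y0 k w : 0 <= Y k w.
  rewrite !addr_ge0// ?exprn_ge0//; last by rewrite mulr_ge0 ?runmax_ge0// indicE.
  by rewrite mulr_ge0// mulr_ge0// divr_ge0.
have aeI : {ae P, forall w k j, (j <= k.+1)%N -> path_diff (gridpt 0 t k j) w =
    path_diff 0 w + time_integral (drift_diff ^~ w) (gridpt 0 t k j) + Iu (gridpt 0 t k j) w}.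
  apply/ae_foralln => k; apply/ae_foralln => j.
  have [jk|jk] := leqP j k.+1; last by apply: aeW.
  by have /andP[g0 _] := g_itv k j jk; apply: filterS (eIu _ g0) => w ->.
have XY : {ae P, forall w, G w -> forall e : R, 0 < e -> \forall k \near \oo,
    sup_diff t w <= Y k w + e}.
  move: aeI path_diff_init; apply: filterS2 => w zE zi Gw e e0.
  have cz' : {within `[0, t], continuous (path_diff ^~ w)} by exact: nonneg_sub (@cz w).
  have zaW s u : 0 <= s -> s <= u -> u <= t -> 2 * dot (path_diff s w) (drift_diff s w) <= L * sup_diff u w.
    by move=> s0 su _; case: (monotone_paths w s0 su).
  have Wf0 s : 0 <= s <= t -> 0 <= sup_diff s w by case/andP => s0 _; exact: sup_diff_ge0.
  have := @path_energy R d (drift_diff ^~ w) (path_diff ^~ w) t L (sup_diff ^~ w) (Iu ^~ w)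
    t0 (@drift_diff_continuous t w) cz' L0 Wf0 zaW zE e e0.
  apply: filterS => k hk.
  have indt s : 0 <= s <= t -> ind s w = 1.
    case/andP => s0 st; rewrite /ind indicE mem_set//; exact: bounded_until_homo Gw.
  have SE : S k w = \sum_(i < k.+1) sup_diff (gridpt 0 t k i.+1) w.
    by apply: eq_bigr => i _; rewrite /trunc_sup indt ?mul1r// g_itv// ltn_ord.
  have PE : \1_G w * Phi k w = runmax (fun j => 2 * \sum_(i < j) dot (path_diff (gridpt 0 t k i) w)
      (Iu (gridpt 0 t k i.+1) w - Iu (gridpt 0 t k i) w) +
     2 * \sum_(i < j) enorm (Iu (gridpt 0 t k i.+1) w - Iu (gridpt 0 t k i) w) ^+ 2) k.+1.
    rewrite indicE mem_set// mul1r; apply/le_anti; apply/andP; split; apply: runmax_le => j /andP[_ jk].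
      rewrite /coarse_noise lerD2r ler_pM2l//; apply: ler_sum => i _.
      by rewrite /tZ indt ?scale1r// g_itv//; apply: leq_trans (ltnW (ltn_ord i)) jk.
    rewrite /coarse_noise lerD2r ler_pM2l//; apply: ler_sum => i _.
    by rewrite /tZ indt ?scale1r// g_itv//; apply: leq_trans (ltnW (ltn_ord i)) jk.
  have z0D : enorm (path_diff 0 w) ^+ 2 <= D2.
    by rewrite ler_pXn2r ?nnegrE ?enorm_ge0// zi// lexx r0.
  apply: sup_diff_le => // u /andP[u1 u2]; have [u0|u0] := leP u 0.
    apply: (@le_trans _ _ D2).
      by rewrite ler_pXn2r ?nnegrE ?enorm_ge0// zi// u1.
    by rewrite /Y -!addrA lerDl addr_ge0 ?mulr_ge0 ?divr_ge0// addr_ge0 ?(ltW e0)// mulr_ge0 ?runmax_ge0// indicE.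
  apply: (@le_trans _ _ (supon (fun s => enorm (path_diff s w) ^+ 2) 0 t)).
    apply: (@supon_ge _ (fun s => enorm (path_diff s w) ^+ 2)) => //.
      apply: (@within_sub _ _ `[- r%:num, t]%classic `[0, t]%classic); last exact: cez.
      by move=> v /=; rewrite !in_itv/= => /andP[v0 ->]; rewrite (le_trans r0 v0).
    by rewrite in_itv/= (ltW u0).
  by apply: le_trans hk _; rewrite /Y PE SE; rewrite lerD2r lerD2r lerD2r.
have trE w : trunc_sup t w ^+ 2 = \1_G w * sup_diff t w ^+ 2.
  by rewrite /trunc_sup exprMn /ind G01.
under eq_Rintegral do rewrite trE.
apply/ler_addgt0Pr => e e0.
have e3 : 0 < e / 3 by rewrite divr_gt0.
have c20 : 0 <= c2.
  apply: mulr_ge0; last exact: sqr_ge0.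
  by apply: addr_ge0; apply: mulr_ge0; (exact: ler0n || exact: sqr_ge0).
have hk1 : \forall k \near \oo, (k.+1%:R^-1 : R) < (lam * t)^-1.
  by apply: (near_infty_natSinv_lt (PosNum _)); rewrite invr_gt0 mulr_gt0.
have hk2 : \forall k \near \oo, (k.+1%:R^-1 : R) < e / 3 / (c2 + 1).
  by apply: (near_infty_natSinv_lt (PosNum _)); rewrite divr_gt0// ltr_wpDl.
apply: (@ex_sqr_fatou _ _ _ P G (sup_diff t) Y _ mG _ _ sY Y0 XY _).2.
- exact: (F_measurable HF t0' (sup_diff_adapted t0')).
- by move=> w; exact: sup_diff_ge0.
move: hk1 hk2; apply: filterS2 => k hk1 hk2.
have k0 : 0 < k.+1%:R :> R by [].
have d0 : 0 <= t / k.+1%:R by rewrite divr_ge0.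
have hl : lam * (t / k.+1%:R) <= 1.
  rewrite mulrA -ler_pdivlMl ?mulr_gt0// mulr1; exact: ltW.
have i2 := (sS k).2; have [iP EP] := noiseP k.
have ES : Ex (fun w => (L * (t / k.+1%:R * S k w)) ^+ 2) <= L ^+ 2 * t * expR 1 * E.
  apply: (@le_trans _ _ (Ex (fun w => (L * (t / k.+1%:R)) ^+ 2 *
      (k.+1%:R * \sum_(i < k.+1) trunc_sup (gridpt 0 t k i.+1) w ^+ 2)))).
    have iS : rint P (fun w => \sum_(i < k.+1) trunc_sup (gridpt 0 t k i.+1) w ^+ 2).
      by apply: rint_sum => i _; case: (sW (gridpt 0 t k i.+1)) => //; case/andP: (g_itv k i.+1 (ltn_ord i)).
    apply: Ex_le => [||w]; [by case: (sqintZ L (sqintZ (t / k.+1%:R) (sS k)))|by do 2 apply: rintZ|].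
    by rewrite mulrA exprMn; apply: ler_wpM2l; [exact: sqr_ge0|exact: sqr_sum_le].
  have sWi (i : 'I_k.+1) : sqint P (trunc_sup (gridpt 0 t k i.+1)).
    by apply: sW; case/andP: (g_itv k i.+1 (ltn_ord i)).
  have iS : rint P (fun w => \sum_(i < k.+1) trunc_sup (gridpt 0 t k i.+1) w ^+ 2).
    by apply: rint_sum => i _; case: (sWi i).
  rewrite ExZ; last exact: rintZ.
  rewrite ExZ// Ex_sum; last by move=> i _; case: (sWi i).
  apply: (@le_trans _ _ (L ^+ 2 * t * (K * (t / k.+1%:R * \sum_(i < k.+1) expR (lam * gridpt 0 t k i.+1))))).
    have -> : (L * (t / k.+1%:R)) ^+ 2 * (k.+1%:R * \sum_(i < k.+1) Ex (fun w => trunc_sup (gridpt 0 t k i.+1) w ^+ 2)) =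
      L ^+ 2 * t * (t / k.+1%:R * \sum_(i < k.+1) Ex (fun w => trunc_sup (gridpt 0 t k i.+1) w ^+ 2)).
      have : k.+1%:R != 0 :> R by rewrite gt_eqF.
      by move: (k.+1%:R : R) (\sum_(i < k.+1) _) => kk ss kn; field.
    apply: ler_wpM2l; first by apply: mulr_ge0 => //; exact: sqr_ge0.
    rewrite [leRHS]mulrCA; apply: ler_wpM2l => //; rewrite mulr_sumr; apply: ler_sum => i _.
    by apply: WK; apply: g_itv.
  rewrite -[leRHS]mulrA; apply: ler_wpM2l; first by apply: mulr_ge0 => //; exact: sqr_ge0.
  by rewrite /E [leRHS]mulrCA; apply: ler_wpM2l => //; exact: exp_right_sum.
have c2k : c2 / k.+1%:R <= e / 3.
  apply: (@le_trans _ _ (c2 * (e / 3 / (c2 + 1)))); first by apply: ler_wpM2l => //; exact: ltW.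
  by rewrite mulrCA ler_piMr ?(ltW e3)// ler_pdivrMr ?ltr_wpDl// mul1r lerDl.
have i3 := sqintZ L (sqintZ (t / k.+1%:R) (sS k)).
have iPhi : rint P (fun w => (\1_G w * Phi k w) ^+ 2) by case: (sPhi k).
apply: (@le_trans _ _ (Ex (fun w => 3 * (D2 ^+ 2 + (L * (t / k.+1%:R * S k w)) ^+ 2 + (\1_G w * Phi k w) ^+ 2)))).
  apply: Ex_le => [||w]; first by case: (sY k).
    by apply: rintZ; apply: rintD => //; apply: rintD; [exact: rint_cst|exact: i3.2].
  rewrite /Y; move: (L * _) (\1_G w * _) => a c.
  have := sqr_sum_le (fun i : 'I_3 => [tuple D2; a; c]`_i).
  by rewrite !big_ord_recl !big_ord0 /= !addr0 !addrA.
rewrite ExZ; last by apply: rintD => //; apply: rintD; [exact: rint_cst|exact: i3.2].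
rewrite ExD//; last by apply: rintD; [exact: rint_cst|exact: i3.2].
rewrite ExD; [|exact: rint_cst|exact: i3.2]; rewrite Ex_cst.
under [X in _ + X]eq_Rintegral do rewrite exprMn G01.
have D4 : D2 ^+ 2 = `|phi - psi| ^+ 4 by rewrite /D2 -exprM.
rewrite D4.
have c1T : c1 * E <= (64 * (33 * m%:R) * L + 16 * (33 * m%:R) ^+ 2 * Tm * L ^+ 2) * E.
  apply: ler_wpM2r => //; rewrite /c1 lerD2l; apply: ler_wpM2r; first exact: sqr_ge0.
  exact: ler_wpM2l.
have LT : L ^+ 2 * t * expR 1 * E <= L ^+ 2 * Tm * expR 1 * E.
  apply: ler_wpM2r => //; apply: ler_wpM2r; first exact: expR_ge0.
  by apply: ler_wpM2l => //; exact: sqr_ge0.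
move: (le_trans ES LT) (le_trans EP (lerD c1T c2k)).
rewrite /growth_cst -/E.
set q1 := 64 * _ * L + _; set q2 := L ^+ 2 * Tm * expR 1; set D := `|phi - psi| ^+ 4 => h1 h2.
apply: (@le_trans _ _ (3 * (D + q2 * E + (q1 * E + e / 3)))).
  by rewrite ler_pM2l//; apply: lerD h2; apply: lerD h1.
rewrite le_eqVlt; apply/orP; left; apply/eqP; clearbody q1 q2 D E; by field.
Qed.


Lemma trunc_sup_sqint (s : R) : 0 <= s -> sqint P (trunc_sup s) /\ forall w, 0 <= trunc_sup s w.
Proof.
move=> s0; have [M M0 [_ WM]] := trunc_bounds.
split=> [|w]; last by case/andP: (WM s w s0).
apply: (@sqint_bounded _ _ _ _ _ M); first exact: (F_measurable HF s0 (aW s0)).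
by move=> w; have /andP[w0 wM] := WM s w s0; rewrite ger0_norm.
Qed.

(* Iterating the one-step bound K |-> 3 D^4 + K / 2 makes the a priori bound M^2 irrelevant. *)
Lemma trunc_sup_bound (lam t : R) : 0 < t -> 0 < lam -> growth_cst t / lam <= 1 / 2 ->
  Ex (fun w => trunc_sup t w ^+ 2) <= 6 * `|phi - psi| ^+ 4 * expR (lam * t).
Proof.
move=> t0 lam0 hl; have [M M0 [_ WM]] := trunc_bounds.
pose D := `|phi - psi| ^+ 4; have D0 : 0 <= D by rewrite exprn_ge0.
have sW s : 0 <= s -> sqint P (trunc_sup s).
  move=> s0; apply: (@sqint_bounded _ _ _ _ _ M); first exact: (F_measurable HF s0 (aW s0)).
  by move=> w; have /andP[w0 wM] := WM s w s0; rewrite ger0_norm.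
have e1 s : 0 <= s -> 1 <= expR (lam * s).
  by move=> s0; rewrite -expR0 ler_expR mulr_ge0// ltW.
have init : Ex (fun w => trunc_sup 0 w ^+ 2) <= D.
  have s00 := lexx (0 : R).
  have : rint P (fun w => \1_(setT : set T) w * trunc_sup 0 w ^+ 2) /\
      Ex (fun w => \1_(setT : set T) w * trunc_sup 0 w ^+ 2) <= D.
    apply: (@ex_sqr_fatou _ _ _ P setT (trunc_sup 0) (fun _ _ => `|phi - psi| ^+ 2)) => //.
    - by case: (sW 0 s00).
    - by move=> w; case/andP: (WM 0 w s00).
    - by move=> k; apply: (@sqint_bounded _ _ _ _ _ (`|phi - psi| ^+ 2)) => // w; rewrite ger0_norm.
    - move: path_diff_init; apply: filterS => w zi _ e e0; apply: nearW => _.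
      apply: (@le_trans _ _ (`|phi - psi| ^+ 2)); last by rewrite lerDl ltW.
      have S : sup_diff 0 w <= `|phi - psi| ^+ 2.
        by apply: sup_diff_le => // u us; rewrite ler_pXn2r ?nnegrE ?enorm_ge0// zi.
      rewrite /trunc_sup; have [[_ ->]|->] := indP 0 w; first by rewrite mul1r.
      by rewrite mul0r sqr_ge0.
    - by apply: nearW => _; rewrite Ex_cst -exprM.
  by case=> _; under eq_Rintegral do rewrite indicE in_setT mul1r.
pose K n := 6 * D + M ^+ 2 / 2 ^+ n.
have K0 n : 0 <= K n by rewrite addr_ge0 ?mulr_ge0// divr_ge0 ?sqr_ge0 ?exprn_ge0.
have step n s : 0 <= s <= t -> Ex (fun w => trunc_sup s w ^+ 2) <= K n * expR (lam * s).
  elim: n s => [|n ih] s /andP[s0 st].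
    apply: (@le_trans _ _ (K 0%N)); last by rewrite ler_peMr// e1.
    rewrite -(Ex_cst P (K 0%N)); apply: Ex_le => [||w]; [by case: (sW s s0)|exact: rint_cst|].
    rewrite /K expr0 divr1; apply: (@le_trans _ _ (M ^+ 2)); last by rewrite lerDr mulr_ge0.
    by have /andP[w0 wM] := WM s w s0; rewrite ler_pXn2r ?nnegrE.
  have [s00|s1] := leP s 0.
    have -> : s = 0 by apply/le_anti; rewrite s0 s00.
    rewrite mulr0 expR0 mulr1; apply: le_trans init _; rewrite /K.
    have := divr_ge0 (sqr_ge0 M) (exprn_ge0 n.+1 (ler0n R 2)).
    by move=> q0; apply: ler_wpDr => //; rewrite ler_peMl// ler1n.
  have ihs u : 0 <= u <= s -> Ex (fun w => trunc_sup u w ^+ 2) <= K n * expR (lam * u).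
    by case/andP=> u0 us; apply: ih; rewrite u0 (le_trans us st).
  apply: le_trans (trunc_step lam0 (K0 n) s1 st ihs) _; rewrite -/D.
  have x1 := e1 s s0; set z := expR (lam * s) in x1 *.
  have -> : growth_cst t * (K n * (z / lam)) = (growth_cst t / lam) * (K n * z) by ring.
  apply: (@le_trans _ _ (3 * D * z + 1 / 2 * (K n * z))).
    apply: lerD; first by rewrite ler_peMr// mulr_ge0.
    by apply: ler_wpM2r => //; rewrite mulr_ge0// (le_trans _ x1).
  have -> : K n.+1 = 3 * D + 1 / 2 * K n.
    rewrite /K (exprS 2 n); have : (2 : R) ^+ n != 0 by rewrite expf_neq0.
    by move: ((2 : R) ^+ n) (M ^+ 2) => q N q0; field.
  by rewrite [leRHS]mulrDl -(mulrA (1 / 2)) lexx.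
apply/ler_addgt0Pr => e e0.
have Mx0 : 0 < M ^+ 2 * expR (lam * t) + 1 by rewrite ltr_wpDl// mulr_ge0 ?sqr_ge0 ?expR_ge0.
have [n _ hn] : \forall n \near \oo, (n.+1%:R^-1 : R) < e / (M ^+ 2 * expR (lam * t) + 1).
  by apply: (near_infty_natSinv_lt (PosNum _)); rewrite divr_gt0.
have {}hn := hn n (leqnn n).
have tt : 0 <= t <= t by rewrite lexx ltW.
apply: le_trans (step n.+1 t tt) _; rewrite /K mulrDl -/D lerD2l.
have h2 : (2 ^+ n.+1)^-1 <= n.+1%:R^-1 :> R.
  rewrite lef_pV2 ?posrE ?exprn_gt0// -natrX ler_nat; exact: ltnW (ltn_expl _ _).
apply: (@le_trans _ _ (M ^+ 2 * expR (lam * t) * (e / (M ^+ 2 * expR (lam * t) + 1)))).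
  rewrite mulrAC; apply: ler_wpM2l; first by rewrite mulr_ge0 ?sqr_ge0 ?expR_ge0.
  exact: le_trans h2 (ltW hn).
by rewrite mulrCA ler_piMr ?(ltW e0)// ler_pdivrMr// mul1r lerDl.
Qed.

End truncation.

Lemma sup_diff_bound (lam t : R) : 0 < t -> 0 < lam -> growth_cst t / lam <= 1 / 2 ->
  rint P (fun w => sup_diff t w ^+ 2) /\
  Ex (fun w => sup_diff t w ^+ 2) <= 6 * `|phi - psi| ^+ 4 * expR (lam * t).
Proof.
move=> t0 lam0 hl; have t0' := ltW t0.
have E (X : T -> R) : (fun w => \1_(setT : set T) w * X w) = X.
  by apply/funext => w; rewrite indicE in_setT mul1r.
have := @ex_sqr_fatou _ _ _ P setT (sup_diff t) (fun n => trunc_sup n%:R t)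
  (6 * `|phi - psi| ^+ 4 * expR (lam * t)).
rewrite E; apply => //.
- exact: (F_measurable HF t0' (sup_diff_adapted t0')).
- by move=> w; exact: sup_diff_ge0.
- by move=> n; case: (trunc_sup_sqint (ler0n R n) t0').
- by move=> n w; case: (trunc_sup_sqint (ler0n R n) t0').
- apply: aeW => w _ e e0.
  pose c := `|supon (fun u => enorm (x u w)) (- r%:num) t| + `|supon (fun u => enorm (y u w)) (- r%:num) t|.
  have c0 : 0 <= c by rewrite addr_ge0.
  exists (Num.bound c) => // n /= cn.
  have cn' : c <= n%:R by apply: le_trans (ltW (archi_boundP c0)) _; rewrite ler_nat.
  rewrite /trunc_sup indicE mem_set ?mul1r; first by rewrite lerDl ltW.
  split; apply: le_trans cn'; apply: le_trans (ler_norm _) _; rewrite /c ?lerDl ?lerDr//.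
- by apply: nearW => n; exact: trunc_sup_bound.
Qed.

Lemma sup_diff4 (t : R) : 0 <= t ->
  measurable_fun setT (fun w => sup [set enorm (x s w - y s w) ^+ 4 | s in `[t - r%:num, t]]) /\
  forall w, 0 <= sup [set enorm (x s w - y s w) ^+ 4 | s in `[t - r%:num, t]] <= sup_diff t w ^+ 2.
Proof.
move=> t0; have rt : t - r%:num <= t by rewrite gerDl.
have rr : - r%:num <= t - r%:num by rewrite lerDr.
have c4 w : {within `[t - r%:num, t], continuous ((fun u => enorm (path_diff u w) ^+ 4) : R -> R^o)}.
  have cg' : continuous (fun v : 'cV[R]_d => enorm v * (enorm v * (enorm v * enorm v)) : R^o).
    move=> v; do 3 (apply: (@cvgM _ _ (nbhs v) (nbhs_filter v)); first exact: enorm_continuous).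
    exact: enorm_continuous.
  have cw : {within `[t - r%:num, t], continuous (path_diff ^~ w)}.
    apply: (@within_sub _ _ `[- r%:num, t]%classic); last exact: within_to (@cz w).
    by move=> u /=; rewrite !in_itv/= => /andP[u1 ->]; rewrite (le_trans rr u1).
  exact: (within_comp cw cg').
split.
  apply: (F_measurable HF t0).
  apply: (@supon_adapted _ _ _ (F t) (fun u w => enorm (path_diff u w) ^+ 4)) => //.
  move=> u; rewrite in_itv/= => /andP[u1 u2]; apply: measurable_funX; apply: adapted_enorm => i.
  by apply: path_diff_adapted; rewrite // u2 (le_trans rr u1).
move=> w; apply/andP; split.
  apply: le_trans (exprn_ge0 4 (enorm_ge0 (path_diff t w))) _.
  apply: (@supon_ge _ (fun u => enorm (path_diff u w) ^+ 4) _ _ rt (c4 w)).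
  by rewrite in_itv/= rt lexx.
apply: (@supon_le _ (fun u => enorm (path_diff u w) ^+ 4) _ _ rt (c4 w)) => u.
rewrite in_itv/= => /andP[u1 u2].
rewrite (_ : enorm _ ^+ 4 = (enorm (path_diff u w) ^+ 2) ^+ 2); last by rewrite -exprM.
rewrite ler_pXn2r ?nnegrE ?sqr_ge0 ?sup_diff_ge0//.
by apply: sup_diff_ge; rewrite u2 (le_trans rr u1).
Qed.

End two_solutions.

Section continuous_dependence.
Context {R : realType} {dT : measure_display} {T : measurableType dT}.
Variables (P : probability T R) (F : R -> set_system T) (d m : nat).
Variables (B : R -> T -> 'cV[R]_m) (r : {posnum R}).
Variables (f : 'cV[R]_d -> 'cV[R]_d) (g : Cseg r d -> 'cV[R]_d) (h : Cseg r d -> 'M[R]_(d, m)).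
Hypotheses (HF : is_filtration F) (HB : is_brownian P F B).
Hypotheses (cf : continuous f) (cg : continuous g) (ch : continuous h).
Hypothesis h_bounded : forall K : R, exists M : R, forall x : Cseg r d,
  `|x| <= K -> hsnorm (h x) <= M.
Hypothesis monotone : exists2 L : R, 0 < L & forall x y : Cseg r d,
  2 * Num.max (dot (f (x (now r)) - f (y (now r))) (x (now r) - y (now r))) 0
  + 2 * Num.max (dot (g x - g y) (x (now r) - y (now r))) 0
  + hsnorm (h x - h y) ^+ 2 <= L * `|x - y| ^+ 2.
Local Notation Ex X := (\int[P]_w (X w)).

Lemma rintE (X : T -> R) : rint P X -> (\int[P]_w (X w)%:E)%E = (Ex X)%:E.
Proof. by move=> iX; rewrite /Rintegral fineK//; exact: integrable_fin_num. Qed.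

Lemma sup_diff_cvg0 (phi_ : nat -> Cseg r d) (phi : Cseg r d)
    (x_ : nat -> R -> T -> 'cV[R]_d) (x : R -> T -> 'cV[R]_d) (t : R) :
  `|phi_ n - phi| @[n --> \oo] --> (0 : R) ->
  (forall n, is_solution P F B f g h (phi_ n) (x_ n)) ->
  is_solution P F B f g h phi x -> 0 < t ->
  (\int[P]_w (sup [set enorm (x_ n s w - x s w) ^+ 4 | s in `[t - r%:num, t]])%:E)%E
    @[n --> \oo] --> 0%E.
Proof.
move=> cphi sx_ sx t0; have [L L0 mono] := monotone.
have G0 : 0 <= growth_cst m L t.
  apply: addr_ge0; apply: mulr_ge0 => //.
    by rewrite mulr_ge0 ?expR_ge0// mulr_ge0 ?sqr_ge0// ltW.
  apply: addr_ge0; first by apply: mulr_ge0 (ltW L0); apply: mulr_ge0; rewrite ?ler0n// mulr_ge0.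
  apply: mulr_ge0 (sqr_ge0 _); apply: mulr_ge0 (ltW t0).
  by apply: mulr_ge0; [exact: ler0n|exact: sqr_ge0].
pose lam := 2 * growth_cst m L t + 1.
have lam0 : 0 < lam by rewrite ltr_wpDl// mulr_ge0.
have hl : growth_cst m L t / lam <= 1 / 2.
  rewrite ler_pdivrMr// /lam; move: G0; move: (growth_cst m L t) => q q0; lra.
have c : (6 * `|phi_ n - phi| ^+ 4 * expR (lam * t))%:E @[n --> \oo] --> 0%E.
  apply: cvg_EFin; first exact: nearW.
  have -> : 0 = 6 * 0 ^+ 4 * expR (lam * t) :> R by rewrite expr0n/= mulr0 mul0r.
  apply: cvgM; last exact: cvg_cst.
  apply: cvgM; first exact: cvg_cst.
  exact: (cvg_comp _ _ cphi (@exprn_continuous R 4 0)).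
apply: (squeeze_cvge _ (cvg_cst 0%E) c); apply: nearW => n.
have [mS S4] := sup_diff4 HF (sx_ n) sx (ltW t0).
have [iS ES] := sup_diff_bound HF HB cf cg ch h_bounded (ltW L0) mono (sx_ n) sx t0 lam0 hl.
apply/andP; split.
  by apply: integral_ge0 => w _; rewrite lee_fin; case/andP: (S4 w).
apply: (@le_trans _ _ (\int[P]_w (sup_diff r (x_ n) x t w ^+ 2)%:E)%E).
  apply: ge0_le_integral => //.
  - by move=> w _; rewrite lee_fin; case/andP: (S4 w).
  - by apply/measurable_EFinP; exact: mS.
  - by apply/measurable_EFinP; exact: (rint_measurable iS).
  - by move=> w _; rewrite lee_fin; case/andP: (S4 w).
by rewrite rintE// lee_fin.
Qed.

Lemma sup4_segment_cvg (x_ : nat -> R -> 'cV[R]_d) (x : R -> 'cV[R]_d) (t : R) : 0 <= t ->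
  (forall n, {within `[- r%:num, +oo[, continuous (x_ n)}) ->
  {within `[- r%:num, +oo[, continuous x} ->
  sup [set enorm (x_ n s - x s) ^+ 4 | s in `[t - r%:num, t]] @[n --> \oo] --> (0 : R) ->
  segment r (x_ n) t @[n --> \oo] --> segment r x t.
Proof.
move=> t0 cx_ cx c0; apply/cvgrPdist_le => e e0.
have e4 : 0 < e ^+ 4 by rewrite exprn_gt0.
move/cvgrPdist_lt : c0 => /(_ _ e4); apply: filterS => n; rewrite sub0r normrN => hn.
rewrite distrC; apply: segment_normB => // s st.
rewrite -(@ler_pXn2r _ 4) ?nnegrE ?enorm_ge0 ?(ltW e0)//.
apply: le_trans (ltW (le_lt_trans (ler_norm _) hn)).
have rt : t - r%:num <= t by rewrite gerDl.
have c4 : {within `[t - r%:num, t], continuous ((fun s => enorm (x_ n s - x s) ^+ 4) : R -> R^o)}.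
  have cg' : continuous (fun v : 'cV[R]_d => enorm v * (enorm v * (enorm v * enorm v)) : R^o).
    move=> v; do 3 (apply: (@cvgM _ _ (nbhs v) (nbhs_filter v)); first exact: enorm_continuous).
    exact: enorm_continuous.
  have cw : {within `[t - r%:num, t], continuous (fun s => x_ n s - x s)}.
    apply: (@within_sub _ _ `[- r%:num, +oo[%classic).
      by move=> u /=; rewrite !in_itv/= andbT => /andP[u1 _]; apply: le_trans u1; rewrite lerDr.
    by move=> u; apply: (@cvgB _ _ _ (nbhs u) (nbhs_filter u)); [exact: cx_|exact: cx].
  exact: (within_comp cw cg').
by apply: (@supon_ge _ (fun s => enorm (x_ n s - x s) ^+ 4) _ _ rt c4); rewrite in_itv.
Qed.

Variable X : Cseg r d -> R -> T -> 'cV[R]_d.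
Hypothesis solX : forall phi, is_solution P F B f g h phi (X phi).
Variables (t : R) (psi : Cseg r d -> R) (M : R).
Hypotheses (t0 : 0 <= t) (cpsi : continuous psi) (psiM : forall y, `|psi y| <= M).

Let v phi w := psi (segment r (X phi ^~ w) t).

Let v_measurable phi : measurable_fun setT (v phi).
Proof.
apply: (F_measurable HF t0).
exact: (segment_borel HF (solution_adapted_path HF (solX phi)) t0 cpsi).
Qed.

Let v_rint phi : rint P (v phi).
Proof. by apply: (@rint_bounded _ _ _ _ _ M) => // w; exact: psiM. Qed.

Lemma feller_bounded phi : `|Ex (v phi)| <= M.
Proof.
rewrite ler_norml; apply/andP; split.
  rewrite -(Ex_cst P (- M)); apply: Ex_le => //; first exact: rint_cst.
  by move=> w; have := psiM (segment r (X phi ^~ w) t); rewrite ler_norml => /andP[].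
rewrite -(Ex_cst P M); apply: Ex_le => //; first exact: rint_cst.
by move=> w; have := psiM (segment r (X phi ^~ w) t); rewrite ler_norml => /andP[].
Qed.

Lemma feller_subsequence (phi_ : nat -> Cseg r d) phi : 0 < t ->
  `|phi_ n - phi| @[n --> \oo] --> (0 : R) ->
  exists l : nat -> nat, Ex (v (phi_ (l n))) @[n --> \oo] --> Ex (v phi).
Proof.
move=> t1 cphi.
pose Y n w := sup [set enorm (X (phi_ n) s w - X phi s w) ^+ 4 | s in `[t - r%:num, t]].
have cY := sup_diff_cvg0 cphi (fun n => solX (phi_ n)) (solX phi) t1.
have Y4 n := sup_diff4 HF (solX (phi_ n)) (solX phi) t0.
have mY n : measurable_fun setT (Y n) by case: (Y4 n).
have Y0 n w : 0 <= Y n w by case: (Y4 n) => _ /(_ w)/andP[].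
have pY : cvg0_in_probability P (fun n w => (Y n w)%:E).
  move=> e e0.
  have c : ((e^-1)%:E * \int[P]_w (Y n w)%:E)%E @[n --> \oo] --> 0%E.
    by rewrite -(mule0 (e^-1)%:E); apply: cvgeZl.
  apply: (squeeze_cvge _ (cvg_cst 0%E) c); apply: nearW => n; rewrite measure_ge0/=.
  rewrite -(@lee_pmul2l _ e%:E)// ?lte_fin// muleA -EFinM divff ?gt_eqF// mul1e.
  have mYE : measurable_fun setT (fun w => (Y n w)%:E) by exact/measurable_EFinP.
  have := @le_integral_abse _ _ _ P setT measurableT (fun w => (Y n w)%:E) e mYE e0.
  rewrite setTI; under eq_integral do rewrite gee0_abs ?lee_fin//.
  rewrite (_ : [set w | _] = [set w | (e%:E <= (Y n w)%:E)%E])//.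
  by apply/seteqP; split=> w /=; rewrite ger0_norm.
have [|||l [_ cl]] := @cvg0_probability_subseq _ _ _ P (fun n w => (Y n w)%:E).
- by move=> n; exact/measurable_EFinP.
- by move=> n w; rewrite lee_fin.
- exact: pY.
exists l.
have cv : {ae P, forall w, setT w -> (v (phi_ (l n)) w)%:E @[n --> \oo] --> (v phi w)%:E}.
  apply: filterS cl => w cw _; apply: cvg_EFin; first exact: nearW.
  have cx z : {within `[- r%:num, +oo[, continuous (X z ^~ w)} := @solution_continuous _ _ _ _ _ _ _ _ _ _ _ _ _ _ (solX z) w.
  have /fine_cvgP[_ cw'] := cw.
  have cs := sup4_segment_cvg t0 (fun n => cx (phi_ (l n))) (cx phi) cw'.
  have c := cvg_comp _ _ cs (@cpsi (segment r (X phi ^~ w) t)).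
  apply: c.
have fg : {ae P, forall w n, setT w -> (`|(v (phi_ (l n)) w)%:E| <= M%:E)%E}.
  by apply: aeW => w n _; rewrite lee_fin; exact: psiM.
have mv phi' : measurable_fun setT (fun w => (v phi' w)%:E) by exact/measurable_EFinP.
have [_ _] := @dominated_convergence _ _ _ P setT measurableT (fun n w => (v (phi_ (l n)) w)%:E)
  (fun w => (v phi w)%:E) (fun=> M%:E) (fun n => mv _) (mv _) cv (rint_cst P M) fg.
under eq_fun do rewrite rintE//; rewrite rintE//.
by move=> /fine_cvgP[].
Qed.

Lemma feller_continuous : continuous (fun phi => Ex (v phi)).
Proof.
have [t1|t1] := ltP 0 t; last first.
  have -> : (fun phi => Ex (v phi)) = psi; last by [].
  apply/funext => phi; have t00 : t = 0 by apply/le_anti; rewrite t1 t0.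
  rewrite -[RHS](Ex_cst P); rewrite /Rintegral; congr fine.
  apply: ae_eq_integral => //; first exact/measurable_EFinP.
  have := solution_init (solX phi); apply: filterS => w e _.
  by rewrite /v t00 e.
move=> phi; apply/(@cvgrPdist_lt _ _ _ (nbhs phi) (nbhs_filter phi)) => e e0; apply: contrapT => nh.
have ex n : exists phi', `|phi' - phi| < n.+1%:R^-1 /\ e <= `|Ex (v phi) - Ex (v phi')|.
  apply: contrapT => h1; apply: nh; apply/nbhs_ballP.
  exists n.+1%:R^-1 => /=; first by rewrite invr_gt0.
  move=> phi'; rewrite -ball_normE /= => hb; rewrite ltNge; apply/negP => h2.
  by apply: h1; exists phi'; rewrite distrC.
pose phi_ n := sval (cid (ex n)).
have phiE n : `|phi_ n - phi| < n.+1%:R^-1 /\ e <= `|Ex (v phi) - Ex (v (phi_ n))|.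
  exact: svalP (cid (ex n)).
have cphi : `|phi_ n - phi| @[n --> \oo] --> (0 : R).
  apply: (squeeze_cvgr _ (cvg_cst 0) cvg_harmonic); apply: nearW => n.
  by rewrite normr_ge0 ltW//; case: (phiE n).
have [l /cvgrPdist_lt/(_ _ e0)[N _ hN]] := feller_subsequence t1 cphi.
by have := hN N (leqnn N); case: (phiE (l N)) => _ h1; rewrite /= ltNge h1.
Qed.

End continuous_dependence.

Theorem proposition3p1 (R : realType) (dT : measure_display)
    (T : measurableType dT) (P : probability T R) (F : R -> set_system T)
    (d m : nat) (B : R -> T -> 'cV[R]_m) (r : {posnum R})
    (f : 'cV[R]_d -> 'cV[R]_d) (g : Cseg r d -> 'cV[R]_d)
    (h : Cseg r d -> 'M[R]_(d, m))
    (F_filtration : is_filtration F) (B_brownian : is_brownian P F B)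
    (f_continuous : continuous f)
    (f_coercive : forall A : R, exists K : R, forall v : 'cV[R]_d,
       K < enorm v -> dot (f v) v / enorm v ^+ 2 < A)
    (g_continuous : continuous g) (h_continuous : continuous h)
    (g_bounded : forall K : R, exists M : R, forall x : Cseg r d,
       `|x| <= K -> enorm (g x) <= M)
    (h_bounded : forall K : R, exists M : R, forall x : Cseg r d,
       `|x| <= K -> hsnorm (h x) <= M)
    (monotone : exists2 L : R, 0 < L & forall x y : Cseg r d,
       2 * Num.max (dot (f (x (now r)) - f (y (now r)))
                        (x (now r) - y (now r))) 0
       + 2 * Num.max (dot (g x - g y) (x (now r) - y (now r))) 0
       + hsnorm (h x - h y) ^+ 2 <= L * `|x - y| ^+ 2) :
  (forall (phi_ : nat -> Cseg r d) (phi : Cseg r d)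
      (x_ : nat -> R -> T -> 'cV[R]_d) (x : R -> T -> 'cV[R]_d),
    `|phi_ n - phi| @[n --> \oo] --> (0 : R) ->
    (forall n, is_solution P F B f g h (phi_ n) (x_ n)) ->
    is_solution P F B f g h phi x ->
    forall t : R, 0 < t ->
      ('E_P[fun w => (sup [set enorm (x_ n s w - x s w) ^+ 4
                            | s in `[t - r%:num, t]])%R])%E
        @[n --> \oo] --> 0%E)
  /\
  (forall X : Cseg r d -> R -> T -> 'cV[R]_d,
    (forall phi, is_solution P F B f g h phi (X phi)) ->
    forall t : R, 0 <= t ->
    forall psi : Cseg r d -> R, continuous psi ->
      (exists M : R, forall y, `|psi y| <= M) ->
      let u := fun phi : Cseg r d =>
        fine ('E_P[fun w => psi (segment r (X phi ^~ w) t)])%E in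
      (exists M : R, forall phi, `|u phi| <= M) /\ continuous u).
Proof.
split=> [phi_ phi x_ x cphi sx_ sx t t0|X solX t t0 psi cpsi [M psiM] u].
  rewrite unlock.
  exact: (sup_diff_cvg0 F_filtration B_brownian f_continuous g_continuous h_continuous
    h_bounded monotone cphi sx_ sx t0).
have uE : u = fun phi => \int[P]_w psi (segment r (X phi ^~ w) t).
  by apply/funext => phi; rewrite /u unlock.
split.
  exists M => phi; rewrite uE.
  exact: (feller_bounded F_filtration solX t0 cpsi psiM).
rewrite uE; exact: (feller_continuous F_filtration B_brownian f_continuous g_continuous
  h_continuous h_bounded monotone solX t0 cpsi psiM).
Qed.
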